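(* Assume that $\xi_1$ is bounded. Let $(\delta_n)_{n\in\mathbb N}\subset(0,\infty)$ be a sequence with $\delta_n\to0$. Then, for every $t\ge0$, $x\in\mathbb R^d$ and $f\in C_b(\mathbb R^d)$, $$\delta_n^2\log\Big(\mathcal E\Big[\exp\Big(\frac1{\delta_n^2}f\big(X_t^{\delta_n,x}\big)\Big)\Big]\Big)\to(T_{1,0}(t)f)(x).$$
   Context: Sublinear expectations (Peng): a sublinear expectation space $(\Omega,\mathcal H,\mathcal E)$ consists of a linear space $\mathcal H$ of functions $\Omega\to\mathbb R$ containing the constants and a map $\mathcal E:\mathcal H\to\mathbb R$ that is monotone, constant preserving, subadditive and positively homogeneous; the functions of random vectors occurring below are understood to belong to $\mathcal H$. A sequence $(\xi_n)$ of $\mathbb R^d$-valued random vectors is i.i.d. if $\mathcal E[f(\xi_n)]=\mathcal E[f(\xi_1)]$ for all $f$, and $\xi_{n+1}$ is independent of $(\xi_1,\dots,\xi_n)$, i.e. $\mathcal E[f(\xi_1,\dots,\xi_{n+1})]=\mathcal E\big[\mathcal E[f(y,\xi_{n+1})]|_{y=(\xi_1,\dots,\xi_n)}\big]$ for all $f$ (bounded continuous test functions $f$). A $G$-Brownian motion is a $d$-dimensional continuous process $(W_t)_{t\ge0}$ on a sublinear expectation space (expectation again denoted $\mathcal E$) with $W_0=0$, such that $W_{t+s}-W_t$ is independent of $(W_{t_1},\dots,W_{t_m})$ for $t_1,\dots,t_m\le t$, and $\mathcal E[f(x+W_{t+s}-W_t)]=u(s,x)$ for bounded continuous $f$, where $u$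 is the viscosity solution of $\partial_tu=G(D^2u)$, $u(0,\cdot)=f$, with $G(a)=\frac12\mathcal E[W_1^TaW_1]$. Setting: $C_b(\mathbb R^d)$ is the space of bounded continuous functions; $\psi:\mathbb R^d\to\mathbb R^d$ is bounded and Lipschitz; $(\xi_n)_{n\in\mathbb N}$ is an i.i.d. sequence of $\mathbb R^d$-valued random vectors on a sublinear expectation space $(\Omega,\mathcal H,\mathcal E)$ with $\mathcal E[|\xi_1|^3]<\infty$ and $\mathcal E[a^T\xi_1]=0$ for all $a\in\mathbb R^d$. $X^{\delta,x}$ is the unique solution of $\mathrm dX_t^{\delta,x}=\psi(X_t^{\delta,x})\,\mathrm dt+\delta\,\mathrm dW_t$, $X_0^{\delta,x}=x$, driven by a $G$-Brownian motion $W$ with $\mathcal E[W_1^TaW_1]=\mathcal E[\xi_1^Ta\xi_1]$ for all symmetric $a\in\mathbb R^{d\times d}$. $(T_{1,0}(t))_{t\ge0}$ is the family of operators on $C_b(\mathbb R^d)$ given by $T_{1,0}(t)f:=\lim_{k\to\infty}J_k^{m_k}f$ (convergence in the sense of uniformly bounded and locally uniform convergence), where $(J_kf)(x):=\frac1{\alpha_k}\log\mathcal E\big[\exp\big(\alpha_kf(x+h_k\psi(x)+\eta_k\sqrt{h_k}\,\xi_1)\big)\big]$ for any sequences $h_k,\eta_k,\alpha_k\in(0,\infty)$ with $h_k\to0$, $\eta_k\to0$, $\alpha_k\eta_k^2\to1$, $\alpha_kh_k\to0$, and $m_k\in\mathbb N$ with $m_kh_k\to t$; the limit exists and does not depend on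 the chosen sequences. It is a strongly continuous convex monotone semigroup on $C_b(\mathbb R^d)$ whose generator is given on bounded smooth functions $f$ with bounded derivatives by $x\mapsto\frac12\mathcal E[|Df(x)^T\xi_1|^2]+Df(x)^T\psi(x)$. *)

(* Defs.v *)
(* R^d, d >= 1, is 'cV[R]_d.+1 for an arbitrary R : realType. *)
From HB Require Import structures.
From mathcomp Require Export all_boot all_order all_algebra.
From mathcomp Require Export all_classical all_reals all_analysis.
#[export] Set Implicit Arguments.
#[export] Unset Strict Implicit.
#[export] Unset Printing Implicit Defensive.
Export Order.TTheory GRing.Theory Num.Theory.
Export numFieldNormedType.Exports.
#[export] Set Warnings "-notation-overridden,-ambiguous-paths".

Local Open Scope classical_set_scope.
Local Open Scope ring_scope.

(* expect is only meaningful on the linear space dom of functions; since it is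
   real-valued there, "E[Y] < oo" for Y >= 0 is expressed by dom E Y. *)
Record sublinear_expectation (R : realType) (Omega : Type) := {
  dom : set (Omega -> R);
  expect :> (Omega -> R) -> R;
  dom_cst : forall c : R, dom (fun=> c);
  dom_lin : forall (a : R) (Y Z : Omega -> R),
    dom Y -> dom Z -> dom (fun w => a * Y w + Z w);
  expect_cst : forall c : R, expect (fun=> c) = c;
  expect_mono : forall Y Z : Omega -> R,
    dom Y -> dom Z -> (forall w, Y w <= Z w) -> expect Y <= expect Z;
  expect_subadd : forall Y Z : Omega -> R,
    dom Y -> dom Z -> expect (fun w => Y w + Z w) <= expect Y + expect Z;
  expect_homog : forall (a : R) (Y : Omega -> R),
    dom Y -> 0 <= a -> expect (fun w => a * Y w) = a * expect Y
}.

Definition Cb (R : realType) (S : topologicalType) : set (S -> R) :=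
  [set f | continuous f /\ bounded_fun f].
Arguments Cb : clear implicits.

Definition enorm (R : realType) (k : nat) (v : 'cV[R]_k) : R :=
  Num.sqrt (\sum_(i < k) v i 0 ^+ 2).

Definition quadr (R : realType) (k : nat) (a : 'M[R]_k) (v : 'cV[R]_k) : R :=
  (v^T *m a *m v) 0 0.

(* The random element (Z_{t_1}, ..., Z_{t_m}) of (R^k)^m, one vector per row. *)
Definition sample (R : realType) (Omega I : Type) (k m : nat)
    (Z : I -> Omega -> 'cV[R]_k) (ts : 'I_m -> I) (w : Omega) : 'M[R]_(m, k) :=
  \matrix_(i < m, j < k) Z (ts i) w j 0.

Section Independence.
Variables (R : realType) (Omega : Type) (E : sublinear_expectation R Omega).

(* Y is independent of Z (the relation is not symmetric). The first three
   conjuncts say that the functions whose expectation is taken lie in the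
   domain of E. *)
Definition independent (S T : topologicalType)
    (Y : Omega -> S) (Z : Omega -> T) : Prop :=
  forall f : T * S -> R, Cb R (T * S)%type f ->
  [/\ dom E (fun w => f (Z w, Y w)),
      forall z, dom E (fun w => f (z, Y w)),
      dom E (fun w => E (fun w' => f (Z w, Y w'))) &
      E (fun w => f (Z w, Y w)) = E (fun w => E (fun w' => f (Z w, Y w')))].

(* The sequence is indexed from 0, so that xi 0 is the first vector. *)
Definition iid (k : nat) (xi : nat -> Omega -> 'cV[R]_k) : Prop :=
  (forall n (f : 'cV[R]_k -> R), Cb R 'cV[R]_k f ->
     dom E (f \o xi n) /\ E (f \o xi n) = E (f \o xi 0%N)) /\
  (forall n, independent (xi n.+1) (sample xi (fun i : 'I_n.+1 => i : nat))).

End Independence.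

Section Viscosity.
Variables (R : realType) (d : nat).
Let V := 'cV[R]_d.+1.
Implicit Types (u phi : R * V -> R) (p : R * V).

Definition dt phi p : R := derive1 (fun s : R => phi (s, p.2)) p.1.
Definition dx (i : 'I_d.+1) phi p : R :=
  'D_(delta_mx i 0 : V) (fun y : V => phi (p.1, y)) p.2.
Definition hessian phi p : 'M[R]_d.+1 := \matrix_(i, j) dx i (dx j phi) p.

(* phi is of class C^{1,2} on (0, oo) x R^d *)
Definition C12 phi : Prop := forall p, 0 < p.1 ->
  [/\ derivable (fun s : R => phi (s, p.2)) p.1 1,
      forall i, derivable (fun y : V => phi (p.1, y)) p.2 (delta_mx i 0),
      forall i j,
        derivable (fun y : V => dx j phi (p.1, y)) p.2 (delta_mx i 0) &
      [/\ {for p, continuous phi}, {for p, continuous (dt phi)},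
          forall i, {for p, continuous (dx i phi)} &
          forall i j, {for p, continuous (dx i (dx j phi))}]].

(* u is a viscosity solution of d_t u = G(D^2 u) on (0, oo) x R^d,
   u(0, .) = f. *)
Definition viscosity_solution (G : 'M[R]_d.+1 -> R) (f : V -> R) u : Prop :=
  [/\ {within [set p | 0 <= p.1], continuous u},
      forall x, u (0, x) = f x,
      forall phi p, C12 phi -> 0 < p.1 ->
        (\forall q \near p, u q - phi q <= u p - phi p) ->
        dt phi p <= G (hessian phi p) &
      forall phi p, C12 phi -> 0 < p.1 ->
        (\forall q \near p, u p - phi p <= u q - phi q) ->
        G (hessian phi p) <= dt phi p].

End Viscosity.

Section GSDE.
Variables (R : realType) (d : nat) (Omega : Type).
Variable E : sublinear_expectation R Omega.
Let V := 'cV[R]_d.+1.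

(* Processes are indexed by R; only their values at times t >= 0 matter.
   The solution u of the G-heat equation is unique among bounded ones, and the
   function of (s, x) below is bounded by the bound of f. *)
Definition G_brownian_motion (W : R -> Omega -> V) : Prop :=
  let G a := 2^-1 * E (fun w => quadr a (W 1 w)) in
  [/\ forall w, W 0 w = 0,
      forall w, {within [set t | 0 <= t], continuous (fun t => W t w)},
      forall a : 'M[R]_d.+1, a^T = a -> dom E (fun w => quadr a (W 1 w)),
      forall m (ts : 'I_m -> R) t s, 0 <= t -> 0 <= s ->
        (forall i, 0 <= ts i <= t) ->
        independent E (fun w => W (t + s) w - W t w) (sample W ts) &
      forall f, Cb R V f ->
        exists2 u, viscosity_solution G f u &
          forall t s x, 0 <= t -> 0 <= s ->
            E (fun w => f (x + (W (t + s) w - W t w))) = u (s, x)].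

(* Continuous functions of linear growth of finitely many values of the
   process Z lie in the domain of E. *)
Definition process_in_dom (k : nat) (Z : R -> Omega -> 'cV[R]_k) : Prop :=
  forall m (ts : 'I_m -> R) (phi : 'M[R]_(m, k) -> R),
    (forall i, 0 <= ts i) -> continuous phi ->
    (exists C : R, forall A,
       `|phi A| <= C * (1 + \sum_(i < m) \sum_(j < k) `|A i j|)) ->
    dom E (fun w => phi (sample Z ts w)).

(* Y = \int_0^t eta_s ds in the sense of stochastic calculus under sublinear
   expectations: the integral of the simple processes
   \sum_i eta_{p_i} 1_[p_i, p_{i+1}) converges to Y in the norm E[| . |] as the
   mesh of the partition 0 = p_0 <= ... <= p_n = t vanishes. A pathwise
   integral would not do: E need not have any continuity along pointwise
   limits, so the finite-dimensional distributions of a process with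
   continuous paths do not determine E on functions of its pathwise
   integrals. *)
Definition is_time_integral (k : nat) (eta : R -> Omega -> 'cV[R]_k) (t : R)
    (Y : Omega -> 'cV[R]_k) : Prop :=
  forall e : R, 0 < e -> exists2 r : R, 0 < r &
    forall (n : nat) (p : nat -> R), p 0%N = 0 -> p n = t ->
      (forall i, (i < n)%N -> p i <= p i.+1 <= p i + r) ->
      let S w := \sum_(i < n) (p i.+1 - p i) *: eta (p i) w in
      dom E (fun w => enorm (Y w - S w)) /\
      E (fun w => enorm (Y w - S w)) <= e.

(* dX_t = psi(X_t) dt + delta dW_t, X_0 = x *)
Definition sde_solution (psi : V -> V) (W : R -> Omega -> V) (delta : R)
    (x : V) (X : R -> Omega -> V) : Prop :=
  [/\ process_in_dom (fun t w => col_mx (W t w) (X t w)),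
      forall w, X 0 w = x &
      forall t, 0 <= t ->
        is_time_integral (fun s w => psi (X s w)) t
          (fun w => X t w - x - delta *: W t w)].

End GSDE.

Section LimitSemigroup.
Variables (R : realType) (d : nat) (Omega : Type).
Variable E : sublinear_expectation R Omega.
Let V := 'cV[R]_d.+1.

Definition J (psi : V -> V) (xi1 : Omega -> V) (h eta alpha : R)
    (f : V -> R) : V -> R := fun x =>
  alpha^-1 * ln (E (fun w => expR (alpha *
    f (x + h *: psi x + (eta * Num.sqrt h) *: xi1 w)))).

(* uniformly bounded and locally uniform convergence *)
Definition bounded_loc_unif_cvg (F : nat -> V -> R) (f : V -> R) : Prop :=
  (exists C : R, forall k x, `|F k x| <= C) /\
  (forall K : set V, compact K -> {uniform K, F @ \oo --> f}).

(* T is the family of operators T_{1,0}: the limit of the iterated operators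
   exists, whatever the admissible sequences, and equals T t f. *)
Definition is_T10 (psi : V -> V) (xi1 : Omega -> V)
    (T : R -> (V -> R) -> (V -> R)) : Prop :=
  forall (t : R) (f : V -> R), 0 <= t -> Cb R V f ->
  Cb R V (T t f) /\
  forall (h eta alpha : nat -> R) (m : nat -> nat),
    (forall k, [/\ 0 < h k, 0 < eta k & 0 < alpha k]) ->
    h @ \oo --> (0 : R) -> eta @ \oo --> (0 : R) ->
    (fun k => alpha k * eta k ^+ 2) @ \oo --> (1 : R) ->
    (fun k => alpha k * h k) @ \oo --> (0 : R) ->
    (fun k => (m k)%:R * h k) @ \oo --> t ->
    bounded_loc_unif_cvg
      (fun k => iter (m k) (J psi xi1 (h k) (eta k) (alpha k)) f) (T t f).

End LimitSemigroup.

(* Main.v *)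
Require Import Defs.
From mathcomp Require Import ring lra.
Local Open Scope classical_set_scope.
Local Open Scope ring_scope.

(** Fix delta and put alpha = delta^-2 and g = exp(alpha f). With h = t/m and
    S u(x) = E[u(x + h psi(x) + delta sqrt(h) xi)], the m-th iterate of J on f
    is alpha^-1 ln (S^m g) (iter_J). Hence, for this delta, the two sides of the
    theorem are the same logarithmic transform of S^m g(x) and of
    E'[g(X_t)], and the core of the proof is a central limit theorem with
    delta fixed: S^m g(x) tends to E'[g(X_t)] as m grows (Cb_converge). For
    each n a number of steps m_n can then be chosen so large that the two
    transforms differ by at most 1/n and that delta_n^-2 h_n is at most 1/n. The
    sequences h_n = t/m_n, eta_n = delta_n, alpha_n = delta_n^-2 are admissible
    in the definition of the limit semigroup, which gives the theorem.

    The central limit theorem passes through the scheme P in which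
    sqrt(h) xi is replaced by the increment W_h of the G-Brownian motion.

    S and P agree to order h^(3/2) on functions with a second-order Taylor
    expansion (noise_consistent, W_consistent). For P this rests on
    the viscosity characterisation of W, through comparison of the solution with
    explicit polynomials (heat_upper, heat_lower); such a comparison follows
    directly from the definition of viscosity solution.

    The iterates of the schemes are merely Lipschitz, so they are first
    smoothed by averaging over small segments. Both schemes are sublinear and,
    apart from the drift, commute with translations, so Jensen's inequality
    gives S(smooth u) <= smooth(S u) up to an error proportional to h. Together
    with consistency on smooth functions this bounds the iterates of P by those
    of S, and, by symmetry, those of S by those of P (iterates_le).

    The iterates of P are expectations of the Euler scheme of the stochastic
    differential equation, by independence of increments (euler_markov), and
    the Euler scheme is close to X_t in mean (euler_error). Since E' is
    controlled only on bounded functions of the increments of W, noise terms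
    are truncated before their expectation is taken. Lipschitz functions are
    finally replaced by bounded continuous ones through a cutoff and the
    tightness of X_t (tail_bound). *)

(** * Sublinear expectations, bounded continuous functions, one-step operators *)

Section SublinearCalculus.
Variables (R : realType) (Omega : Type) (E : sublinear_expectation R Omega).
Implicit Types Y Z : Omega -> R.

Lemma eq_dom Y Z : Y =1 Z -> dom E Y -> dom E Z.
Proof. by move=> /funext ->. Qed.

Lemma eq_expect Y Z : Y =1 Z -> E Y = E Z.
Proof. by move=> /funext ->. Qed.

Lemma domD Y Z : dom E Y -> dom E Z -> dom E (fun w => Y w + Z w).
Proof.
by move=> dY dZ; apply: eq_dom (dom_lin 1 dY dZ) => w; rewrite mul1r.
Qed.

Lemma domZ (a : R) Y : dom E Y -> dom E (fun w => a * Y w).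
Proof.
by move=> dY; apply: eq_dom (dom_lin a dY (dom_cst E 0)) => w; rewrite addr0.
Qed.

Lemma domN Y : dom E Y -> dom E (fun w => - Y w).
Proof. by move=> dY; apply: eq_dom (domZ (-1) dY) => w; rewrite mulN1r. Qed.

Lemma expectDc Y (c : R) : dom E Y -> E (fun w => Y w + c) = E Y + c.
Proof.
move=> dY; have dc := dom_cst E c; have dNc := dom_cst E (- c).
apply/eqP; rewrite eq_le; apply/andP; split.
  by have := expect_subadd dY dc; rewrite expect_cst.
have := expect_subadd (domD dY dc) dNc; rewrite expect_cst.
rewrite (_ : E (fun w => Y w + c + - c) = E Y); first by lra.
by apply: eq_expect => w; rewrite addrK.
Qed.

(** Adding a constant commutes with a sublinear expectation, although adding a
    general variable does not; hence uniform errors pass through E unchanged. *)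
Lemma expect_leDc Y Z (c : R) : dom E Y -> dom E Z ->
  (forall w, Y w <= Z w + c) -> E Y <= E Z + c.
Proof.
move=> dY dZ YZ; rewrite -expectDc //; apply: expect_mono => //.
by apply: domD => //; exact: dom_cst.
Qed.

Lemma expect_dist Y Z (c : R) : dom E Y -> dom E Z ->
  (forall w, `|Y w - Z w| <= c) -> `|E Y - E Z| <= c.
Proof.
move=> dY dZ YZ; rewrite ler_distl; apply/andP; split.
  rewrite lerBlDr; apply: expect_leDc => // w.
  by move: (YZ w); rewrite ler_distl => /andP[]; lra.
by apply: expect_leDc => // w; move: (YZ w); rewrite ler_distl => /andP[]; lra.
Qed.

Lemma dom_sum n (Y : nat -> Omega -> R) :
  (forall i, (i < n)%N -> dom E (Y i)) -> dom E (fun w => \sum_(i < n) Y i w).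
Proof.
elim: n => [_|n IH dY].
  by apply: eq_dom (dom_cst E 0) => w; rewrite big_ord0.
have dn : dom E (fun w => \sum_(i < n) Y i w + Y n w).
  by apply: domD; [apply: IH => i /ltnW; exact: dY | exact: dY].
by apply: eq_dom dn => w; rewrite big_ord_recr.
Qed.

Lemma expect_sum_le n (Y : nat -> Omega -> R) :
  (forall i, (i < n)%N -> dom E (Y i)) ->
  E (fun w => \sum_(i < n) Y i w) <= \sum_(i < n) E (Y i).
Proof.
elim: n => [_|n IH dY].
  rewrite big_ord0 (_ : (fun w => _) = (fun=> 0)) ?expect_cst //.
  by apply/funext => w; rewrite big_ord0.
have dY' i : (i < n)%N -> dom E (Y i) by move=> /ltnW; exact: dY.
rewrite big_ord_recr /=.
apply: (@le_trans _ _ (E (fun w => \sum_(i < n) Y i w) + E (Y n))).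
  apply: le_trans (expect_subadd (dom_sum dY') (dY n (ltnSn n))).
  rewrite le_eqVlt; apply/orP; left; apply/eqP.
  by apply: eq_expect => w; rewrite big_ord_recr.
by rewrite lerD2r; exact: IH.
Qed.

Lemma expect_le_cst Y (c : R) : dom E Y -> (forall w, Y w <= c) -> E Y <= c.
Proof.
by move=> dY Yc; rewrite -(expect_cst E c); apply: expect_mono => //; exact: dom_cst.
Qed.

Lemma expect_ge_cst Y (c : R) : dom E Y -> (forall w, c <= Y w) -> c <= E Y.
Proof.
by move=> dY Yc; rewrite -(expect_cst E c); apply: expect_mono => //; exact: dom_cst.
Qed.

End SublinearCalculus.

Section CbFacts.
Variables (R : realType).

Lemma boundedP (S : Type) (W : normedModType R) (f : S -> W) :
  bounded_fun f <-> exists C : R, forall x, `|f x| <= C.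
Proof.
split=> [[M [Mr MH]]|[C HC]].
  by exists (M + 1) => x; apply: (MH (M + 1)) => //; rewrite ltrDl.
exists C; split; first exact: num_real.
by move=> r Cr x _; apply: le_trans (HC x) (ltW Cr).
Qed.

Lemma CbP (S : topologicalType) (f : S -> R) :
  Cb R S f <-> continuous f /\ exists C : R, forall x, `|f x| <= C.
Proof.
by split=> -[cf bf]; split=> //; apply/boundedP.
Qed.

Lemma continuous_compose (S T U : topologicalType) (f : S -> T) (g : T -> U) :
  continuous f -> continuous g -> continuous (fun x => g (f x)).
Proof. by move=> cf cg x; apply: continuous_comp; [exact: cf | exact: cg]. Qed.

Lemma Cb_comp (S T : topologicalType) (f : T -> R) (g : S -> T) :
  Cb R T f -> continuous g -> Cb R S (f \o g).
Proof.
move=> /CbP[cf [C bf]] cg; apply/CbP; split; last by exists C => x; exact: bf.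
by move=> x; apply: continuous_comp; [exact: cg | exact: cf].
Qed.

Lemma Cb_add (S : topologicalType) (f g : S -> R) :
  Cb R S f -> Cb R S g -> Cb R S (fun x => f x + g x).
Proof.
move=> /CbP[cf [C bf]] /CbP[cg [D bg]]; apply/CbP; split.
  by move=> x; apply: cvgD; [exact: cf | exact: cg].
by exists (C + D) => x; apply: le_trans (ler_normD _ _) (lerD (bf x) (bg x)).
Qed.

Lemma Cb_scale (S : topologicalType) (a : R) (f : S -> R) :
  Cb R S f -> Cb R S (fun x => a * f x).
Proof.
move=> /CbP[cf [C bf]]; apply/CbP; split.
  by move=> x; apply: cvgM; [exact: cvg_cst | exact: cf].
by exists (`|a| * C) => x; rewrite normrM; apply: ler_wpM2l.
Qed.

Lemma continuous_epsP (V W : normedModType R) (f : V -> W) (x : V) :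
  {for x, continuous f} <-> forall e, 0 < e -> exists2 r, 0 < r &
    forall y, `|y - x| < r -> `|f y - f x| < e.
Proof.
split=> [/cvgrPdist_lt cf e e0|H].
  have [r /= r0 H] := (@nbhs_ballP _ _ _ _).1 (cf e e0).
  exists r => // y yx; rewrite distrC; apply: H.
  by rewrite -ball_normE /= distrC.
apply/cvgrPdist_lt => e e0; have [r r0 Hr] := H e e0.
apply/nbhs_ballP; exists r => // y; rewrite -ball_normE /= distrC => yx.
by rewrite distrC; exact: Hr.
Qed.

Definition lip (V W : normedModType R) (L : R) (u : V -> W) :=
  forall x y, `|u x - u y| <= L * `|x - y|.

Lemma lip_continuous (V W : normedModType R) (L : R) (u : V -> W) :
  lip L u -> continuous u.
Proof.
move=> Lu x; apply/continuous_epsP => e e0.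
have L0 : 0 < `|L| + 1 by rewrite ltr_wpDl.
exists (e / (`|L| + 1)); first by rewrite divr_gt0.
move=> y yx; apply: le_lt_trans (Lu _ _) _.
apply: (@le_lt_trans _ _ ((`|L| + 1) * `|y - x|)).
  by apply: ler_wpM2r => //; apply: le_trans (ler_norm _) _; rewrite lerDl.
by rewrite mulrC -ltr_pdivlMr.
Qed.

Lemma min_dist (C a b : R) : `|Num.min C a - Num.min C b| <= `|a - b|.
Proof.
wlog ab : a b / a <= b => [H|].
  have [|/ltW ba] := leP a b; first exact: H.
  by rewrite distrC [leRHS]distrC; exact: H.
rewrite distrC [leRHS]distrC (ger0_norm (_ : 0 <= b - a)) ?subr_ge0 //.
rewrite ger0_norm; last by rewrite subr_ge0 le_min !ge_min lexx ab orbT.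
by have [|] := leP C a; have [|] := leP C b; lra.
Qed.

Lemma trunc_lip (V : normedModType R) (C L : R) (c : V) : 0 <= L ->
  lip L (fun y => Num.min C (L * `|y - c|)).
Proof.
move=> L0 x y; apply: le_trans (min_dist _ _ _) _.
rewrite -mulrBr normrM ger0_norm //; apply: ler_wpM2l => //.
by apply: le_trans (ler_dist_dist _ _) _; rewrite opprB addrA subrK.
Qed.

Lemma lip_Cb (V : normedModType R) (L K : R) (u : V -> R) :
  lip L u -> (forall x, `|u x| <= K) -> Cb R V u.
Proof. by move=> Lu Ku; apply/CbP; split; [exact: lip_continuous Lu | exists K]. Qed.

Lemma trunc_ge0 (C L r : R) : 0 <= C -> 0 <= L -> 0 <= r -> 0 <= Num.min C (L * r).
Proof. by move=> C0 L0 r0; rewrite le_min C0 mulr_ge0. Qed.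

Lemma trunc_Cb (V : normedModType R) (C L : R) (c : V) : 0 <= C -> 0 <= L ->
  Cb R V (fun y => Num.min C (L * `|y - c|)).
Proof.
move=> C0 L0; apply: (@lip_Cb _ L C _ (trunc_lip _ _ L0)) => x.
rewrite ger0_norm; last exact: trunc_ge0.
by rewrite ge_min lexx.
Qed.

Lemma scale_continuous (V : normedModType R) (s : R) : continuous (fun y : V => s *: y).
Proof. by apply: (@lip_continuous _ _ `|s|) => x y; rewrite -scalerBr normrZ. Qed.

End CbFacts.

Section ShiftOperators.
Variables (R : realType) (d : nat) (Omega : Type).
Let V := 'cV[R]_d.+1.
Variables (E : sublinear_expectation R Omega) (Z : Omega -> V).
Implicit Types (u v : V -> R) (b : V -> V) (K L : R).

(** Noise enters every scheme through this operator, which is sublinear,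
    monotone and commutes with translations. These properties alone give the
    preservation of bounds and Lipschitz constants and, later, Jensen's
    inequality for averages of translates. *)
Definition shiftE u : V -> R := fun x => E (fun w => u (x + Z w)).

(** Sublinear expectations need not be continuous along pointwise limits, so
    that E[u(x + Z)] is continuous in x has to be derived from the law of Z
    before the operator can be iterated on bounded continuous functions. *)
Definition feller := forall u, Cb R V u ->
  dom E (fun w => u (Z w)) /\ continuous (shiftE u).

Hypothesis FZ : feller.

Lemma shift_continuous (a : V) : continuous (fun x : V => a + x).
Proof. by move=> x; apply: (@cvgD _ V V (nbhs x)); [exact: cvg_cst | exact: cvg_id]. Qed.

Lemma shift_dom u x : Cb R V u -> dom E (fun w => u (x + Z w)).
Proof.
move=> Cu; have Cu' := Cb_comp Cu (@shift_continuous x).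
by have [] := FZ Cu'.
Qed.

Lemma shiftE_Cb u : Cb R V u -> Cb R V (shiftE u).
Proof.
move=> Cu; apply/CbP; split; first by have [] := FZ Cu.
have [_ [C bu]] := (CbP u).1 Cu; exists C => x; rewrite ler_norml; apply/andP; split.
  apply: expect_ge_cst; first exact: shift_dom.
  by move=> w; have := bu (x + Z w); rewrite ler_norml => /andP[].
apply: expect_le_cst; first exact: shift_dom.
by move=> w; have := bu (x + Z w); rewrite ler_norml => /andP[].
Qed.

Lemma shiftE_bound u C : Cb R V u -> (forall x, `|u x| <= C) ->
  forall x, `|shiftE u x| <= C.
Proof.
move=> Cu bu x; have := @expect_dist _ _ E _ _ C (shift_dom x Cu) (dom_cst E 0).
by rewrite expect_cst subr0; apply=> w; rewrite subr0.
Qed.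

Lemma shiftE_leDc u v (c : R) : Cb R V u -> Cb R V v ->
  (forall x, u x <= v x + c) -> forall x, shiftE u x <= shiftE v x + c.
Proof.
by move=> Cu Cv uv x; apply: expect_leDc => [||w]; [exact: shift_dom..|exact: uv].
Qed.

Lemma shiftE_lip u L : Cb R V u -> lip L u -> lip L (shiftE u).
Proof.
move=> Cu Lu x y; apply: expect_dist => [||w]; [exact: shift_dom..|].
by apply: le_trans (Lu _ _) _; rewrite opprD addrACA subrr addr0.
Qed.

Definition step b u : V -> R := fun x => shiftE u (b x).

Lemma step_Cb b u : continuous b -> Cb R V u -> Cb R V (step b u).
Proof. by move=> cb /shiftE_Cb Cu; exact: (Cb_comp Cu). Qed.

Lemma iter_step_Cb b u n : continuous b -> Cb R V u -> Cb R V (iter n (step b) u).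
Proof. by move=> cb Cu; elim: n => [|n IH] //=; exact: step_Cb. Qed.

Lemma iter_step_bound b u C n : continuous b -> Cb R V u ->
  (forall x, `|u x| <= C) -> forall x, `|iter n (step b) u x| <= C.
Proof.
move=> cb Cu bu; elim: n => [|n IH] x //=.
by apply: shiftE_bound => //; exact: iter_step_Cb.
Qed.

Lemma iter_step_leDc b u v c n : continuous b -> Cb R V u -> Cb R V v ->
  (forall x, u x <= v x + c) ->
  forall x, iter n (step b) u x <= iter n (step b) v x + c.
Proof.
move=> cb Cu Cv uv; elim: n => [|n IH] x //=.
by apply: shiftE_leDc => //; exact: iter_step_Cb.
Qed.

Lemma iter_step_lip b u L l n : lip l b -> 0 <= L -> Cb R V u -> lip L u ->
  lip (L * l ^+ n) (iter n (step b) u).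
Proof.
move=> lb L0 Cu Lu.
have cb := lip_continuous lb.
have l0 : 0 <= l.
  have := lb 0 (const_mx 1); set z := `|0 - _| => H.
  have z0 : 0 < z.
    rewrite normr_gt0 sub0r oppr_eq0; apply/eqP => /matrixP/(_ 0 0).
    by rewrite !mxE => /eqP; rewrite oner_eq0.
  have : 0 <= l * z by apply: le_trans H.
  by rewrite pmulr_lge0.
elim: n => [|n IH] x y; first by rewrite expr0 mulr1; exact: Lu.
rewrite iterS; apply: le_trans (shiftE_lip (iter_step_Cb n cb Cu) IH _ _) _.
rewrite exprSr mulrA -[leRHS]mulrA; apply: ler_wpM2l.
  by rewrite mulr_ge0 // exprn_ge0.
exact: lb.
Qed.

(** The iterates inherit sublinearity; this bounds the effect of replacing u by
    a function v that is close to it only up to a cutoff function c. *)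
Lemma iter_step_sublin b u v c (k : R) n : continuous b -> Cb R V u -> Cb R V v ->
  0 <= k -> Cb R V c -> (forall x, u x <= v x + k * c x) ->
  forall x, iter n (step b) u x <= iter n (step b) v x + k * iter n (step b) c x.
Proof.
move=> cb Cu Cv k0 Cc uv; elim: n => [|n IH] x //=.
have C1 := iter_step_Cb n cb Cu; have C2 := iter_step_Cb n cb Cv.
have C3 := iter_step_Cb n cb Cc; rewrite /step/shiftE.
have dc := shift_dom (b x) C3; have dv := shift_dom (b x) C2.
rewrite -(expect_homog dc k0); apply: le_trans (expect_subadd dv (domZ k dc)).
by apply: expect_mono => [|| w //]; [exact: shift_dom | apply: domD => //; exact: domZ].
Qed.

End ShiftOperators.

(** * The supremum norm on column vectors *)

Section SupNorm.
Variables (R : realType).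

Lemma mx_norm_le m n (x : 'M[R]_(m, n)) (r : R) : 0 <= r ->
  (forall i j, `|x i j| <= r) -> `|x| <= r.
Proof.
move=> r0 H; rewrite [leLHS]/Num.norm /= mx_normrE; by apply/bigmax_leP; split=> //= -[i j] _.
Qed.

Lemma mx_norm_ge m n (x : 'M[R]_(m, n)) i j : `|x i j| <= `|x|.
Proof.
by rewrite [leRHS]/Num.norm /= mx_normrE; apply/bigmax_geP; right => /=; exists (i, j).
Qed.

Lemma enorm_ge n (x : 'cV[R]_n) : `|x| <= enorm x.
Proof.
apply: mx_norm_le => [|i j]; first exact: sqrtr_ge0.
rewrite (ord1 j) -sqrtr_sqr; apply: ler_wsqrtr; rewrite (bigD1 i) //= lerDl.
by apply: sumr_ge0 => k _; exact: sqr_ge0.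
Qed.

Lemma cube_compact n (r : R) : compact [set x : 'cV[R]_n.+1 | `|x| <= r].
Proof.
have [r0|r0] := ltP r 0.
  rewrite (_ : [set _ | _] = set0); first exact: compact0.
  by apply/seteqP; split=> // x /= xr; have := normr_ge0 x; lra.
pose A := [set v : 'rV[R]_n.+1 | forall i, `[(- r)%R, r]%classic (v ord0 i)].
have cA : compact A.
  by apply: (@rV_compact R n.+1 (fun=> `[(- r)%R, r]%classic)) => i; exact: segment_compact.
rewrite (_ : [set _ | _] = (fun v : 'rV[R]_n.+1 => v^T) @` A).
  apply: continuous_compact => //; apply: continuous_subspaceT.
  apply: (@lip_continuous _ _ _ 1) => x y; rewrite mul1r.
  apply: mx_norm_le => // i j; rewrite !mxE.
  by have := @mx_norm_ge _ _ (x - y) j i; rewrite !mxE.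
apply/seteqP; split=> [x /= xr|_ [v Av <-]] /=.
  exists x^T; last by rewrite trmxK.
  move=> i /=; rewrite mxE in_itv /= -ler_norml.
  by apply: le_trans xr; exact: mx_norm_ge.
apply: mx_norm_le => // i j; rewrite mxE (ord1 j).
by have := Av i; rewrite /= in_itv /= -ler_norml.
Qed.

(** Unlike plain uniform continuity on the cube, only y is confined to the
    cube, while z ranges over a neighbourhood of it. *)
Lemma unif_continuous_cube n (g : 'cV[R]_n.+1 -> R) (r e : R) :
  continuous g -> 0 < e ->
  exists2 s, 0 < s &
    forall y z, `|y| <= r -> `|y - z| < s -> `|g y - g z| <= e.
Proof.
move=> cg e0.
pose P (s : R) (y : 'cV[R]_n.+1) := forall z, `|y - z| < s -> `|g y - g z| <= e.
have := @cube_compact n r; move=> /compact_near_coveringP /(_ R (0^'+) P _).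
have H : forall x : 'cV[R]_n.+1, [set x | `|x| <= r] x ->
    \forall x' \near x & i \near (0 : R)^'+, P i x'.
  move=> x _; have e2 : 0 < e / 2 by lra.
  have [s s0 Hs] := (continuous_epsP g x).1 (cg x) _ e2.
  near=> y t => z /= yz.
  have yx : `|y - x| < s / 2.
    rewrite distrC; near: y; apply/nbhs_ballP; exists (s / 2); first by rewrite /=; lra.
    by move=> y; rewrite -ball_normE.
  have ts : t < s / 2.
    by near: t; apply: nbhs_right_lt; lra.
  have h1 := Hs y; have h2 := Hs z.
  have zx : `|z - x| < s.
    rewrite (_ : z - x = (y - x) - (y - z)); last first.
      by apply/matrixP => i j; rewrite !mxE; ring.
    apply: le_lt_trans (ler_normB _ _) _. lra.
  have {}h1 : `|g y - g x| < e / 2 by apply: h1; lra.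
  have {}h2 := h2 zx.
  rewrite (_ : g y - g z = (g y - g x) - (g z - g x)); last by ring.
  by apply: le_trans (ler_normB _ _) _; lra.
move=> /(_ H) HP.
have HP2 : \forall s \near (0 : R)^'+, 0 < s /\ forall x, `|x| <= r -> P s x.
  by near=> s; split; [near: s; exact: nbhs_right_gt | near: s; exact: HP].
have [s [s0 Ps]] := @filter_ex _ _ _ _ HP2.
by exists s => // y z yr; exact: Ps.
Unshelve. all: by end_near. Qed.

End SupNorm.

(** * Polynomial test functions for the G-heat equation *)

Section ContinuityCalculus.
Variables (R : realType) (S : topologicalType).
Implicit Types f g : S -> R.

Lemma cont_cst (a : R) : continuous (fun _ : S => a).
Proof. by move=> x; exact: cvg_cst. Qed.

Lemma cont_add f g : continuous f -> continuous g -> continuous (fun x => f x + g x).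
Proof. by move=> cf cg x; apply: cvgD; [exact: cf | exact: cg]. Qed.

Lemma cont_mul f g : continuous f -> continuous g -> continuous (fun x => f x * g x).
Proof. by move=> cf cg x; apply: cvgM; [exact: cf | exact: cg]. Qed.

Lemma cont_exp f n : continuous f -> continuous (fun x => f x ^+ n).
Proof.
by move=> cf; elim: n => [|n IH] x /=;
  [rewrite /continuous_at expr0; under eq_fun do rewrite expr0; exact: cvg_cst
  |rewrite /continuous_at exprS; under eq_fun do rewrite exprS; apply: cvgM; [exact: cf|exact: IH]].
Qed.

Lemma cont_sum n (f : 'I_n -> S -> R) :
  (forall i, continuous (f i)) -> continuous (fun x => \sum_i f i x).
Proof.
elim: n f => [f _ |n IH f cf].
  by rewrite (_ : (fun x => _) = fun=> 0); [exact: cont_cst | apply/funext => x; rewrite big_ord0].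
rewrite (_ : (fun x => _) = fun x => \sum_(i < n) f (widen_ord (leqnSn n) i) x + f ord_max x).
  by apply: cont_add; [apply: IH | exact: cf].
by apply/funext => x; rewrite big_ord_recr.
Qed.

Lemma cont_coord n (f : S -> 'cV[R]_n) i : continuous f -> continuous (fun x => f x i 0).
Proof.
by move=> cf x; apply: (@continuous_comp _ _ _ f (fun M : 'cV[R]_n => M i 0));
  [exact: cf | exact: coord_continuous].
Qed.

End ContinuityCalculus.

(** All test functions are polynomials of degree at most four along every
    line, so their directional derivatives are read off from an exact finite
    expansion instead of a chain of derivation rules. *)
Lemma is_derive_poly4 (R : realType) (W : normedModType R) (f : W -> R) (x v : W)
    (al be ga ze : R) :
  (forall s : R, f (s *: v + x) = f x + s * (al + s * (be + s * (ga + s * ze)))) ->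
  is_derive x v f al.
Proof.
move=> H.
have cv : (fun h : R => h^-1 *: ((f \o shift x) (h *: v) - f x)) @ 0^' --> al.
  apply: (@cvg_trans _ ((fun s : R => al + s * (be + s * (ga + s * ze))) @ 0^')).
    apply: near_eq_cvg; near=> h.
    have h0 : h != 0 by near: h; exact: nbhs_dnbhs_neq.
    rewrite /= H addrAC subrr add0r scalerA.
    by rewrite -[_ *: _]/(_ * _ * _) mulVf // mul1r.
  have := @nbhs_dnbhs R 0 => nd.
  apply: cvg_trans (cvg_app _ nd) _.
  have c0 : {for (0 : R), continuous (fun s : R => al + s * (be + s * (ga + s * ze)))}.
    by do 3! (apply: cont_add; [exact: cont_cst | apply: cont_mul; [move=> ?; exact: cvg_id|]]);
      apply: cont_cst.
  have := c0; rewrite /prop_for /continuous_at mul0r addr0; exact.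
by split; [apply/cvg_ex; exists al | exact: cvg_lim cv].
Unshelve. all: by end_near. Qed.

Section HeatPolynomial.
Variables (R : realType) (d : nat).
Let V := 'cV[R]_d.+1.
Implicit Types (y e : V) (A : 'M[R]_d.+1).

Definition sq2 y : R := \sum_i y i 0 ^+ 2.
Definition sq4 y : R := \sum_i y i 0 ^+ 4.
Definition dotp (p y : V) : R := \sum_i p i 0 * y i 0.

Let E1 (i : 'I_d.+1) : V := delta_mx i 0.

Lemma line_coord (s : R) (i j : 'I_d.+1) y : (s *: E1 i + y) j 0 = s * (j == i)%:R + y j 0.
Proof. by rewrite !mxE eqxx andbT. Qed.

Lemma sum_line (F : R -> R) (s : R) (i : 'I_d.+1) y :
  \sum_j F ((s *: E1 i + y) j 0) = \sum_j F (y j 0) + (F (s + y i 0) - F (y i 0)).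
Proof.
rewrite (bigD1 i) //= [in RHS](bigD1 i) //= line_coord eqxx mulr1.
rewrite (eq_bigr (fun j => F (y j 0))); first by ring.
by move=> j ji; rewrite line_coord (negbTE ji) mulr0 add0r.
Qed.

Lemma dotp_line p (s : R) (i : 'I_d.+1) y :
  dotp p (s *: E1 i + y) = dotp p y + s * p i 0.
Proof.
rewrite /dotp (bigD1 i) //= [in RHS](bigD1 i) //= line_coord eqxx mulr1.
rewrite (eq_bigr (fun j => p j 0 * y j 0)); first by ring.
by move=> j ji; rewrite line_coord (negbTE ji) mulr0 add0r.
Qed.

Lemma mulmx_line A (s : R) (i j : 'I_d.+1) y :
  (A *m (s *: E1 i + y)) j 0 = (A *m y) j 0 + s * A j i.
Proof.
rewrite !mxE (bigD1 i) //= [in RHS](bigD1 i) //= !mxE !eqxx mulr1.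
rewrite (eq_bigr (fun k => A j k * y k 0)); first by ring.
by move=> k ki; rewrite !mxE (negbTE ki) /= mulr0 add0r.
Qed.

Lemma quadrE A y : quadr A y = dotp y (A *m y).
Proof.
by rewrite /quadr -mulmxA mxE; apply: eq_bigr => i _; rewrite !mxE.
Qed.

Lemma dotp_delta (i : 'I_d.+1) y : dotp (E1 i) y = y i 0.
Proof.
rewrite /dotp (bigD1 i) //= !mxE !eqxx mul1r big1 ?addr0 // => j ji.
by rewrite !mxE (negbTE ji) mul0r.
Qed.

Lemma dotpDr p y e : dotp p (y + e) = dotp p y + dotp p e.
Proof. by rewrite /dotp -big_split; apply: eq_bigr => i _; rewrite mxE mulrDr. Qed.

Lemma dotpZr p s y : dotp p (s *: y) = s * dotp p y.
Proof. by rewrite /dotp mulr_sumr; apply: eq_bigr => i _; rewrite mxE mulrCA. Qed.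

Lemma dotpC p y : dotp p y = dotp y p.
Proof. by apply: eq_bigr => i _; rewrite mulrC. Qed.

Lemma dotp_sym A y e : A^T = A -> dotp y (A *m e) = dotp e (A *m y).
Proof.
move=> sA; have trE (u v : V) : dotp u v = (u^T *m v) 0 0.
  by rewrite mxE; apply: eq_bigr => i _; rewrite mxE.
rewrite !trE -[in LHS](trmxK (y^T *m _)) mxE.
by rewrite !trmx_mul trmxK sA mulmxA.
Qed.

Lemma dotpDl p e y : dotp (p + e) y = dotp p y + dotp e y.
Proof. by rewrite dotpC dotpDr !(dotpC y). Qed.

Lemma dotpZl p s y : dotp (s *: p) y = s * dotp p y.
Proof. by rewrite dotpC dotpZr (dotpC y). Qed.

Lemma quadrD A e y : A^T = A ->
  quadr A (e + y) = quadr A e + 2 * dotp e (A *m y) + quadr A y.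
Proof.
move=> sA; rewrite !quadrE mulmxDr !dotpDl !dotpDr (dotp_sym y e sA); ring.
Qed.

Lemma quadrZ A s y : quadr A (s *: y) = s ^+ 2 * quadr A y.
Proof. by rewrite !quadrE -scalemxAr dotpZl dotpZr mulrA expr2. Qed.

Lemma quadr_line A (s : R) (i : 'I_d.+1) y : A^T = A ->
  quadr A (s *: E1 i + y) = quadr A y + s * (2 * (A *m y) i 0 + s * A i i).
Proof.
move=> sA; rewrite quadrD // quadrZ dotpZl dotp_delta quadrE dotp_delta.
have -> : (A *m E1 i) i 0 = A i i.
  by have := mulmx_line A 1 i i 0; rewrite addr0 scale1r mulmx0 mul1r => ->; rewrite mxE add0r.
by ring.
Qed.

Section TestFunction.
Variables (c : R) (p : V) (A : 'M[R]_d.+1) (a b g k l : R).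
Hypothesis sA : A^T = A.

(** A quadratic polynomial in y, corrected by quartic terms. The terms in t are
    those that the heat operator generates from sq2 and sq4, so that suitable
    g, k, l make hpoly a classical strict super- or subsolution. *)
Definition hpoly (q : R * V) : R :=
  c + dotp p q.2 + 2^-1 * quadr A q.2 + a * sq2 q.2 + b * sq4 q.2
  + g * q.1 + k * (q.1 * sq2 q.2) + l * q.1 ^+ 2.

Let dthpoly (q : R * V) : R := g + k * sq2 q.2 + 2 * l * q.1.
Let dxhpoly (j : 'I_d.+1) (q : R * V) : R :=
  p j 0 + (A *m q.2) j 0 + 2 * a * q.2 j 0 + 4 * b * q.2 j 0 ^+ 3
  + 2 * k * (q.1 * q.2 j 0).
Let hess_hpoly (i j : 'I_d.+1) (q : R * V) : R :=
  A j i + (j == i)%:R * (2 * a + 12 * b * q.2 j 0 ^+ 2 + 2 * k * q.1).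

Let is_dt (q : R * V) : is_derive q.1 1 (fun s : R => hpoly (s, q.2)) (dthpoly q).
Proof.
apply: (@is_derive_poly4 _ _ _ _ _ _ l 0 0) => s.
by rewrite /hpoly /dthpoly /= -[s *: _]/(s * 1); ring.
Qed.

Let is_dx i (q : R * V) :
  is_derive q.2 (E1 i) (fun y : V => hpoly (q.1, y)) (dxhpoly i q).
Proof.
apply: (@is_derive_poly4 _ _ _ _ _ _ (2^-1 * A i i + a + 6 * b * q.2 i 0 ^+ 2 + k * q.1)
  (4 * b * q.2 i 0) b) => s.
rewrite /hpoly /dxhpoly /= dotp_line quadr_line // /sq2 /sq4.
rewrite (sum_line (fun z => z ^+ 2)) (sum_line (fun z => z ^+ 4)).
by field.
Qed.

Let is_dxx i j (q : R * V) :
  is_derive q.2 (E1 i) (fun y : V => dxhpoly j (q.1, y)) (hess_hpoly i j q).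
Proof.
apply: (@is_derive_poly4 _ _ _ _ _ _ (12 * b * q.2 i 0 * (j == i)%:R)
  (4 * b * (j == i)%:R) 0) => s.
rewrite /dxhpoly /hess_hpoly /= mulmx_line line_coord.
by case: eqP => [->|_] /=; ring.
Qed.

Lemma dt_hpoly q : dt hpoly q = g + k * sq2 q.2 + 2 * l * q.1.
Proof. by rewrite /dt derive1E; exact: derive_val. Qed.

Let dx_hpoly j : dx j hpoly = dxhpoly j.
Proof. by apply/funext => q; rewrite /dx; exact: (@derive_val _ _ _ _ _ _ _ (is_dx j q)). Qed.

Let dxx_hpoly i j : dx i (dx j hpoly) = hess_hpoly i j.
Proof. by apply/funext => q; rewrite dx_hpoly /dx; exact: (@derive_val _ _ _ _ _ _ _ (is_dxx i j q)). Qed.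

Let cont1 : continuous (fun q : R * V => q.1).
Proof. by move=> q; exact: cvg_fst. Qed.

Let contc i : continuous (fun q : R * V => q.2 i 0).
Proof. by apply: cont_coord => q; exact: cvg_snd. Qed.

Let cont_mulmx i : continuous (fun q : R * V => (A *m q.2) i 0).
Proof.
under eq_fun do rewrite mxE.
by apply: cont_sum => j; apply: cont_mul; [exact: cont_cst | exact: contc].
Qed.

Lemma cont_sq2 : continuous (fun q : R * V => sq2 q.2).
Proof. by apply: cont_sum => j; apply: cont_exp; exact: contc. Qed.

Lemma cont_sq4 : continuous (fun q : R * V => sq4 q.2).
Proof. by apply: cont_sum => j; apply: cont_exp; exact: contc. Qed.

Let cstc (r : R) : continuous (fun _ : R * V => r).
Proof. exact: cont_cst. Qed.

Let cont_dotp : continuous (fun q : R * V => dotp p q.2).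
Proof. by apply: cont_sum => i; apply: cont_mul; [exact: cstc | exact: contc]. Qed.

Let cont_quadr : continuous (fun q : R * V => quadr A q.2).
Proof.
under eq_fun do rewrite quadrE.
by apply: cont_sum => i; apply: cont_mul; [exact: contc | exact: cont_mulmx].
Qed.

Lemma cont_hpoly : continuous hpoly.
Proof.
exact: (cont_add (cont_add (cont_add (cont_add (cont_add (cont_add (cont_add
  (@cstc c) cont_dotp) (cont_mul (@cstc 2^-1) cont_quadr))
  (cont_mul (@cstc a) cont_sq2)) (cont_mul (@cstc b) cont_sq4))
  (cont_mul (@cstc g) cont1)) (cont_mul (@cstc k) (cont_mul cont1 cont_sq2)))
  (cont_mul (@cstc l) (cont_exp (n := 2) cont1))).
Qed.

Let cont_dthpoly : continuous dthpoly.
Proof.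
exact: (cont_add (cont_add (@cstc g) (cont_mul (@cstc k) cont_sq2))
  (cont_mul (@cstc (2 * l)) cont1)).
Qed.

Let cont_dxhpoly j : continuous (dxhpoly j).
Proof.
exact: (cont_add (cont_add (cont_add (cont_add (@cstc (p j 0)) (@cont_mulmx j))
  (cont_mul (@cstc (2 * a)) (@contc j)))
  (cont_mul (@cstc (4 * b)) (cont_exp (n := 3) (@contc j))))
  (cont_mul (@cstc (2 * k)) (cont_mul cont1 (@contc j)))).
Qed.

Let cont_hess_hpoly i j : continuous (hess_hpoly i j).
Proof.
exact: (cont_add (@cstc (A j i)) (cont_mul (@cstc (j == i)%:R)
  (cont_add (cont_add (@cstc (2 * a))
    (cont_mul (@cstc (12 * b)) (cont_exp (n := 2) (@contc j))))
    (cont_mul (@cstc (2 * k)) cont1)))).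
Qed.

Lemma C12_hpoly : C12 hpoly.
Proof.
move=> q _; split.
- exact: (@ex_derive _ _ _ _ _ _ _ (is_dt q)).
- by move=> i; exact: (@ex_derive _ _ _ _ _ _ _ (is_dx i q)).
- by move=> i j; rewrite dx_hpoly; exact: (@ex_derive _ _ _ _ _ _ _ (is_dxx i j q)).
split.
- exact: cont_hpoly.
- have -> : dt hpoly = dthpoly by apply/funext => r; exact: dt_hpoly.
  exact: cont_dthpoly.
- by move=> i; rewrite dx_hpoly; exact: cont_dxhpoly.
- by move=> i j; rewrite dxx_hpoly; exact: cont_hess_hpoly.
Qed.

Lemma hessian_hpoly q : hessian hpoly q =
  A + diag_mx (\row_j (2 * a + 12 * b * q.2 j 0 ^+ 2 + 2 * k * q.1)).
Proof.
apply/matrixP => i j; rewrite !mxE dxx_hpoly /hess_hpoly eq_sym mulr_natl.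
rewrite -[in A j i]sA mxE; congr (_ + _); by case: eqP => [->|_] //; rewrite !mulr0n.
Qed.

End TestFunction.

End HeatPolynomial.

(** * Coercivity and interior maxima *)

Section Coercivity.
Variables (R : realType) (d : nat).
Let V := 'cV[R]_d.+1.
Implicit Types (y : V).

Lemma norm_coord y : exists i, `|y| = `|y i 0|.
Proof.
have [y0|y0] := eqVneq (mx_norm y) 0.
  by exists 0; rewrite [LHS]y0 (mx_norm_eq0 y0) mxE normr0.
by have [[i j] /=] := mx_norm_neq0 y0; rewrite (ord1 j); exists i.
Qed.

Lemma sq2_ge y i : y i 0 ^+ 2 <= sq2 y.
Proof.
by rewrite /sq2 (bigD1 i) //= lerDl; apply: sumr_ge0 => j _; exact: sqr_ge0.
Qed.

Lemma sq4_ge y i : y i 0 ^+ 4 <= sq4 y.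
Proof.
rewrite /sq4 (bigD1 i) //= lerDl; apply: sumr_ge0 => j _.
by rewrite (exprM _ 2 2); exact: sqr_ge0.
Qed.

Lemma norm2_sq2 y : `|y| ^+ 2 <= sq2 y.
Proof. by have [i ->] := norm_coord y; rewrite real_normK ?num_real // sq2_ge. Qed.

Lemma norm4_sq4 y : `|y| ^+ 4 <= sq4 y.
Proof.
have [i ->] := norm_coord y.
by rewrite (exprM _ 2 2) real_normK ?num_real // -exprM sq4_ge.
Qed.

Lemma sq2_ge0 y : 0 <= sq2 y.
Proof. by apply: sumr_ge0 => i _; exact: sqr_ge0. Qed.

Lemma sq4_ge0 y : 0 <= sq4 y.
Proof. by apply: sumr_ge0 => i _; rewrite (exprM _ 2 2); exact: sqr_ge0. Qed.

Lemma dotp_bound (p : V) : exists2 P, 0 <= P & forall y, `|dotp p y| <= P * (1 + sq2 y).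
Proof.
exists (\sum_i `|p i 0|); first by apply: sumr_ge0.
move=> y; apply: le_trans (ler_norm_sum _ _ _) _; rewrite mulr_suml.
apply: ler_sum => i _; rewrite normrM; apply: ler_wpM2l => //.
have := sq2_ge y i; rewrite -(@real_normK _ (y i 0)) ?num_real //.
by have := sqr_ge0 (`|y i 0| - 1); rewrite sqrrB; have := normr_ge0 (y i 0); lra.
Qed.

Lemma quadr_bound (A : 'M[R]_d.+1) :
  exists2 Q, 0 <= Q & forall y, `|quadr A y| <= Q * sq2 y.
Proof.
exists (\sum_i \sum_j `|A i j|).
  by apply: sumr_ge0 => i _; apply: sumr_ge0.
move=> y; rewrite quadrE; apply: le_trans (ler_norm_sum _ _ _) _; rewrite mulr_suml.
apply: ler_sum => i _; rewrite normrM mxE.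
apply: (@le_trans _ _ (`|y i 0| * \sum_j `|A i j * y j 0|)).
  by apply: ler_wpM2l => //; exact: ler_norm_sum.
rewrite mulr_sumr mulr_suml; apply: ler_sum => j _; rewrite normrM mulrCA.
apply: ler_wpM2l => //.
have := sq2_ge y i; have := sq2_ge y j.
rewrite -(@real_normK _ (y i 0)) ?num_real // -(@real_normK _ (y j 0)) ?num_real //.
by have := sqr_ge0 (`|y i 0| - `|y j 0|); rewrite sqrrB; lra.
Qed.

(** The quartic term and t^2 dominate everything else. Growth in t spares a
    terminal time at which a maximum could sit on the boundary. *)
Lemma hpoly_coercive (c : R) (p : V) A a b g k l (B : R) :
  0 <= a -> 0 < b -> 0 <= k -> 0 < l ->
  exists rho tau : R, forall q : R * V, 0 <= q.1 -> rho < `|q.2| \/ tau < q.1 ->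
    B <= hpoly c p A a b g k l q.
Proof.
move=> a0 b0 k0 l0.
have [P P0 HP] := dotp_bound p; have [Q Q0 HQ] := quadr_bound A.
pose C := P + Q; pose N : R := d.+1%:R.
pose c' := c - P - N * (C ^+ 2 / (2 * b)) - g ^+ 2 / (2 * l).
have low (q : R * V) : 0 <= q.1 ->
    c' + b / 2 * sq4 q.2 + l / 2 * q.1 ^+ 2 <= hpoly c p A a b g k l q.
  case: q => t y /= t0; rewrite /hpoly /=.
  have H1 : - (g ^+ 2 / (2 * l)) <= g * t + l / 2 * t ^+ 2.
    have : 0 <= (l * t + g) ^+ 2 / (2 * l) by rewrite divr_ge0 ?sqr_ge0 //; lra.
    have -> : (l * t + g) ^+ 2 / (2 * l) = l / 2 * t ^+ 2 + g * t + g ^+ 2 / (2 * l).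
      by field; rewrite gt_eqF.
    lra.
  have H2 : C * sq2 y - N * (C ^+ 2 / (2 * b)) <= b / 2 * sq4 y.
    rewrite /sq2 /sq4 /N mulr_sumr [leRHS]mulr_sumr.
    have -> : d.+1%:R * (C ^+ 2 / (2 * b)) = \sum_(i < d.+1) C ^+ 2 / (2 * b).
      by rewrite sumr_const card_ord mulr_natl.
    rewrite -sumrB; apply: ler_sum => i _.
    have : 0 <= (b * y i 0 ^+ 2 - C) ^+ 2 / (2 * b) by rewrite divr_ge0 ?sqr_ge0 //; lra.
    have -> : (b * y i 0 ^+ 2 - C) ^+ 2 / (2 * b) =
       b / 2 * y i 0 ^+ 4 - C * y i 0 ^+ 2 + C ^+ 2 / (2 * b).
      by field; rewrite gt_eqF.
    lra.
  have H3 := HP y; have H4 := HQ y; rewrite !ler_norml in H3 H4.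
  case/andP: H3 => H3 _; case/andP: H4 => H4 _.
  have H5 : 0 <= k * (t * sq2 y) by rewrite !mulr_ge0 // sq2_ge0.
  have H6 : 0 <= a * sq2 y by rewrite mulr_ge0 // sq2_ge0.
  have H7 : 0 <= Q * sq2 y by rewrite mulr_ge0 // sq2_ge0.
  move: H2 H3 H4; rewrite /c' /C mulrDl mulrDr mulr1; lra.
pose D := `|B - c'|.
exists (1 + 2 * D / b), (1 + 2 * D / l) => q q0 H.
apply: le_trans (low q q0).
have s4 := sq4_ge0 q.2; have t2 := sqr_ge0 q.1.
have D0 : 0 <= D by exact: normr_ge0.
have BD : B - c' <= D by exact: ler_norm.
have b4 : 0 <= b / 2 * sq4 q.2 by rewrite mulr_ge0 //; lra.
have l2 : 0 <= l / 2 * q.1 ^+ 2 by rewrite mulr_ge0 //; lra.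
have Xb : 0 <= 2 * D / b by rewrite divr_ge0 //; lra.
have Xl : 0 <= 2 * D / l by rewrite divr_ge0 //; lra.
case: H => H.
  have : 2 * D / b <= sq4 q.2.
    apply: le_trans (norm4_sq4 q.2).
    have n1 : 1 <= `|q.2| by lra.
    by apply: (@le_trans _ _ `|q.2|); [lra | rewrite ler_eXnr].
  by rewrite ler_pdivrMr // => ?; lra.
have : 2 * D / l <= q.1 ^+ 2.
  have n1 : 1 <= q.1 by lra.
  by apply: (@le_trans _ _ q.1); [lra | rewrite ler_eXnr].
by rewrite ler_pdivrMr // => ?; lra.
Qed.

(** Compactness yields a maximum point; the sign conditions on F push it off
    the initial time and off the artificial lateral boundary. *)
Lemma interior_max (F : R * V -> R) (rho tau s0 : R) (y0 : V) :
  {within [set p : R * V | 0 <= p.1], continuous F} -> 0 <= s0 ->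
  (forall y, F (0, y) <= 0) ->
  (forall p, 0 <= p.1 -> rho < `|p.2| \/ tau < p.1 -> F p <= 0) ->
  0 < F (s0, y0) ->
  exists2 p : R * V, 0 < p.1 & \forall q \near p, F q <= F p.
Proof.
move=> cF s00 F0 Fout F1.
pose K : set (R * V) := `[0, tau]%classic `*` [set y | `|y| <= rho].
have cK : compact K by apply: compact_setX; [exact: segment_compact | exact: cube_compact].
have inK p : 0 <= p.1 -> 0 < F p -> K p.
  move=> p0 Fp; split; rewrite /= ?in_itv /= ?p0 /= leNgt; apply/negP => H.
    by have := Fout p p0 (or_intror H); lra.
  by have := Fout p p0 (or_introl H); lra.
have KF : {within K, continuous F}.
  by apply: continuous_subspaceW cF => -[t y] [] /=; rewrite in_itv /= => /andP[].
have K0 : K !=set0 by exists (s0, y0); exact: inK.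
have [c cinK cmax] := compact_EVT_max K0 cK KF.
have Fc : 0 < F c.
  by apply: (lt_le_trans F1); apply: cmax; apply: mem_set; apply: inK.
have [] := set_mem cinK; rewrite /= in_itv /= => /andP[c0 _] _.
have c1 : 0 < c.1.
  rewrite lt_neqAle c0 andbT; apply/eqP => c10.
  have E0 : (0, c.2) = c by rewrite c10 -surjective_pairing.
  by have := F0 c.2; rewrite E0; lra.
exists c => //.
have : \forall q \near c, 0 < q.1.
  have : \forall x \near c.1, 0 < x by exact: lt_nbhsr.
  have cf : continuous (fun q : R * V => q.1) by move=> q; exact: cvg_fst.
  by move=> H; exact: (cf c _ H).
apply: filterS => q q0.
have [Fq|Fq] := ltP 0 (F q); last by apply: le_trans Fq (ltW Fc).
by apply: cmax; apply: mem_set; apply: inK => //; exact: ltW.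
Qed.

End Coercivity.

(** * Comparison of a viscosity solution with polynomials *)

Section GFunction.
Variables (R : realType) (d : nat) (Omega : Type) (E : sublinear_expectation R Omega).
Let V := 'cV[R]_d.+1.
Variable Y : Omega -> V.
Hypothesis domY : forall a : 'M[R]_d.+1, a^T = a -> dom E (fun w => quadr a (Y w)).
Implicit Types (A B : 'M[R]_d.+1) (D : 'rV[R]_d.+1) (y : V).

Definition Gfun A : R := 2^-1 * E (fun w => quadr A (Y w)).
(** Bounds G on diagonal perturbations of its argument, and therefore on all
    correction terms of the polynomial barriers. *)
Definition kappa : R := Gfun 1%:M.

Lemma quadrDm A B y : quadr (A + B) y = quadr A y + quadr B y.
Proof. by rewrite !quadrE mulmxDl dotpDr. Qed.

Lemma quadrZm s A y : quadr (s *: A) y = s * quadr A y.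
Proof. by rewrite !quadrE -scalemxAl dotpZr. Qed.

Lemma quadr_diag (D : 'rV[R]_d.+1) y : quadr (diag_mx D) y = \sum_j D 0 j * y j 0 ^+ 2.
Proof.
rewrite quadrE; apply: eq_bigr => i _.
by rewrite mul_diag_mx mxE mulrCA expr2.
Qed.

Lemma quadr1 y : quadr 1%:M y = sq2 y.
Proof. by rewrite quadrE mul1mx; apply: eq_bigr => i _; rewrite expr2. Qed.

Lemma quadr_diag_le D y (m : R) : (forall j, D 0 j <= m) -> quadr (diag_mx D) y <= m * sq2 y.
Proof.
move=> Dm; rewrite quadr_diag /sq2 mulr_sumr; apply: ler_sum => j _.
by apply: ler_wpM2r => //; exact: sqr_ge0.
Qed.

Lemma quadr_diag_ge D y (m : R) : (forall j, - m <= D 0 j) -> - (m * sq2 y) <= quadr (diag_mx D) y.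
Proof.
move=> Dm; rewrite quadr_diag /sq2 mulr_sumr -sumrN; apply: ler_sum => j _.
by rewrite -mulNr; apply: ler_wpM2r => //; exact: sqr_ge0.
Qed.

Let s1 : (1%:M : 'M[R]_d.+1)^T = 1%:M. Proof. by rewrite trmx1. Qed.

Let dom1 : dom E (fun w => sq2 (Y w)).
Proof. by apply: eq_dom (domY s1) => w; rewrite quadr1. Qed.

Lemma kappaE : E (fun w => sq2 (Y w)) = 2 * kappa.
Proof.
rewrite /kappa /Gfun mulrA divff ?mul1r ?pnatr_eq0 //.
by apply: eq_expect => w; rewrite quadr1.
Qed.

Lemma kappa_ge0 : 0 <= kappa.
Proof.
have := @expect_ge_cst _ _ E _ 0 dom1 (fun w => sq2_ge0 (Y w)); rewrite kappaE; lra.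
Qed.

Lemma G_diag_le A D (m : R) : A^T = A -> 0 <= m -> (forall j, D 0 j <= m) ->
  Gfun (A + diag_mx D) <= Gfun A + m * kappa.
Proof.
move=> sA m0 Dm.
have sD : (A + diag_mx D)^T = A + diag_mx D by rewrite linearD /= sA tr_diag_mx.
suff : E (fun w => quadr (A + diag_mx D) (Y w)) <= E (fun w => quadr A (Y w)) + m * (2 * kappa).
  by rewrite /Gfun; lra.
rewrite -kappaE -(expect_homog dom1 m0).
apply: le_trans (expect_subadd (domY sA) (domZ m dom1)).
apply: expect_mono; [exact: domY | by apply: domD; [exact: domY | exact: domZ] |].
by move=> w; rewrite quadrDm lerD2l; exact: quadr_diag_le.
Qed.

Lemma G_diag_ge A D (m : R) : A^T = A -> 0 <= m -> (forall j, - m <= D 0 j) ->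
  Gfun A - m * kappa <= Gfun (A + diag_mx D).
Proof.
move=> sA m0 Dm.
have sD : (A + diag_mx D)^T = A + diag_mx D by rewrite linearD /= sA tr_diag_mx.
suff : E (fun w => quadr A (Y w)) <= E (fun w => quadr (A + diag_mx D) (Y w)) + m * (2 * kappa).
  by rewrite /Gfun; lra.
rewrite -kappaE -(expect_homog dom1 m0).
apply: le_trans (expect_subadd (domY sD) (domZ m dom1)).
apply: expect_mono; [exact: domY | by apply: domD; [exact: domY | exact: domZ] |].
move=> w; rewrite quadrDm -addrA lerDl.
by have := quadr_diag_ge (Y w) Dm; lra.
Qed.

Lemma hpoly_axis c (p : V) A a b g k l (s : R) :
  hpoly c p A a b g k l (s, 0) = c + s * g + l * s ^+ 2.
Proof.
have dp0 (q : V) : dotp q 0 = 0 by rewrite /dotp big1 // => i _; rewrite mxE mulr0.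
have q0 : quadr A (0 : V) = 0 by rewrite quadrE dotpC dp0.
have s20 : sq2 (0 : V) = 0 by rewrite /sq2 big1 // => i _; rewrite mxE expr0n.
have s40 : sq4 (0 : V) = 0 by rewrite /sq4 big1 // => i _; rewrite mxE expr0n.
by rewrite /hpoly /= dp0 q0 s20 s40; ring.
Qed.

(** A viscosity solution u of the G-heat equation is compared with explicit
    polynomials only: at a maximum of u - v, with v a strict classical
    supersolution, the definition of viscosity subsolution is contradicted at
    once because v is itself an admissible test function. *)
Section HeatBounds.
Variables (u : R * V -> R) (f : V -> R) (B c : R) (p : V) (A : 'M[R]_d.+1) (a b : R).
Hypothesis vu : viscosity_solution Gfun f u.
Hypothesis bu : forall q : R * V, 0 <= q.1 -> `|u q| <= B.
Hypothesis sA : A^T = A.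
Hypotheses (a0 : 0 <= a) (b0 : 0 < b).

(* The constants are forced by v_t >= G(D^2 v): differentiating b * sq4 twice
   costs 12 b kappa sq2, compensated by k t sq2, which in turn costs
   2 k kappa t, compensated by l t^2. The extra 1 in l keeps l positive when
   kappa vanishes. *)
Let k := 12 * b * kappa.
Let l := b * (12 * kappa ^+ 2 + 1).

Let b0' : 0 <= 12 * b. Proof. by apply: mulr_ge0 => //; exact: ltW. Qed.

Let k0 : 0 <= k. Proof. by apply: mulr_ge0 => //; exact: kappa_ge0. Qed.
Let l0 : 0 < l.
Proof. by rewrite /l mulr_gt0 //; have := sqr_ge0 kappa; lra. Qed.

Let m (q : R * V) := 2 * a + 12 * b * sq2 q.2 + 2 * k * q.1.
Let m_ge0 (q : R * V) : 0 <= q.1 -> 0 <= m q.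
Proof.
by move=> q0; apply: addr_ge0; [apply: addr_ge0; apply: mulr_ge0 => //; exact: sq2_ge0
  | apply: mulr_ge0 => //; exact: mulr_ge0].
Qed.

Let m_kappa (q : R * V) : 0 < q.1 -> m q * kappa < 2 * a * kappa + k * sq2 q.2 + 2 * l * q.1.
Proof.
move=> q0; rewrite /m /k /l -subr_gt0.
rewrite [ltRHS](_ : _ = 2 * b * q.1); last by ring.
by rewrite !mulr_gt0.
Qed.

Let coefD (q : R * V) j : 0 <= q.1 -> 2 * a + 12 * b * q.2 j 0 ^+ 2 + 2 * k * q.1 <= m q.
Proof.
by move=> q0; rewrite /m lerD2r lerD2l; apply: ler_wpM2l => //; exact: sq2_ge.
Qed.

Let withinB (v : R * V -> R) : continuous v ->
  {within [set q : R * V | 0 <= q.1], continuous (fun q => u q - v q)}.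
Proof.
move=> cv; have [cu _ _ _] := vu.
by move=> q; apply: cvgB; [exact: cu | apply: continuous_subspaceT].
Qed.

(** The strictness e * s of the barrier tends to 0 at the end. *)
Lemma heat_upper s : 0 <= s ->
  (forall y, f y <= c + dotp p y + 2^-1 * quadr A y + a * sq2 y + b * sq4 y) ->
  u (s, 0) <= c + s * (Gfun A + 2 * a * kappa) + l * s ^+ 2.
Proof.
move=> s0 Hf; have [_ u0 sub _] := vu.
suff H e : 0 < e -> u (s, 0) <= c + s * (Gfun A + 2 * a * kappa + e) + l * s ^+ 2.
  apply/ler_addgt0Pr => e e0.
  have e1 : 0 < e / (s + 1) by rewrite divr_gt0 // ltr_wpDl.
  apply: (le_trans (H _ e1)); rewrite mulrDr.
  have : s * (e / (s + 1)) <= e.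
    by rewrite mulrCA ger_pMr // ler_pdivrMr ?ltr_wpDl // mul1r lerDl.
  lra.
move=> e0; pose g := Gfun A + 2 * a * kappa + e.
pose v := hpoly c p A a b g k l.
have v0 y : v (0, y) = c + dotp p y + 2^-1 * quadr A y + a * sq2 y + b * sq4 y.
  by rewrite /v /hpoly /=; ring.
have vs : v (s, 0) = c + s * g + l * s ^+ 2.
  by rewrite /v hpoly_axis; ring.
rewrite -/g -vs leNgt; apply/negP => us.
have [rho [tau H]] := @hpoly_coercive _ _ c p A a b g k l B a0 b0 k0 l0.
have [||||q q0 qmax] := @interior_max _ _ (fun q => u q - v q) rho tau s 0 (withinB (@cont_hpoly _ _ c p A a b g k l)).
- exact: s0.
- by move=> y; rewrite u0 v0; have := Hf y; lra.
- move=> q q0 out; have := H q q0 out; have := bu q0.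
  by rewrite ler_norml => /andP[_]; rewrite -/v; lra.
- by lra.
have := sub v q (C12_hpoly _ _ _ _ _ _ _ sA) q0 qmax.
rewrite dt_hpoly // hessian_hpoly // leNgt => /negP; apply.
have q0' := ltW q0.
apply: (@le_lt_trans _ _ (Gfun A + m q * kappa)).
  apply: G_diag_le => //; first exact: m_ge0.
  by move=> j; rewrite mxE; exact: coefD.
by have := m_kappa q0; rewrite /g; lra.
Qed.

Lemma heat_lower s : 0 <= s ->
  (forall y, c + dotp p y + 2^-1 * quadr A y - a * sq2 y - b * sq4 y <= f y) ->
  c + s * (Gfun A - 2 * a * kappa) - l * s ^+ 2 <= u (s, 0).
Proof.
move=> s0 Hf; have [_ u0 _ sup] := vu.
suff H e : 0 < e -> c + s * (Gfun A - 2 * a * kappa - e) - l * s ^+ 2 <= u (s, 0).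
  apply/ler_addgt0Pl => e e0.
  have e1 : 0 < e / (s + 1) by rewrite divr_gt0 // ltr_wpDl.
  have := H _ e1; rewrite !mulrBr.
  have : s * (e / (s + 1)) <= e.
    by rewrite mulrCA ger_pMr // ler_pdivrMr ?ltr_wpDl // mul1r lerDl.
  lra.
move=> e0; pose g := Gfun A - 2 * a * kappa - e.
pose v := hpoly c p A (- a) (- b) g (- k) (- l).
have v0 y : v (0, y) = c + dotp p y + 2^-1 * quadr A y - a * sq2 y - b * sq4 y.
  by rewrite /v /hpoly /=; ring.
have vs : v (s, 0) = c + s * g - l * s ^+ 2.
  by rewrite /v hpoly_axis; ring.
have vN q : v q = - hpoly (- c) (- p) (- A) a b (- g) k l q.
  have dN : dotp (- p) q.2 = - dotp p q.2 by rewrite -scaleN1r dotpZl mulN1r.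
  have qN : quadr (- A) q.2 = - quadr A q.2 by rewrite -scaleN1r quadrZm mulN1r.
  by rewrite /v /hpoly /= dN qN; ring.
rewrite -/g -vs leNgt; apply/negP => us.
have [rho [tau H]] := @hpoly_coercive _ _ (- c) (- p) (- A) a b (- g) k l B a0 b0 k0 l0.
have [|||||q q0 qmax] := @interior_max _ _ (fun q => - (u q - v q)) rho tau s 0.
- by move=> q; apply: cvgN; apply: withinB; exact: cont_hpoly.
- exact: s0.
- by move=> y; rewrite u0 v0; have := Hf y; lra.
- move=> q q0 out; have := H q q0 out; have := bu q0.
  by rewrite ler_norml vN => /andP[]; lra.
- by lra.
have qmin : \forall q' \near q, u q - v q <= u q' - v q'.
  by apply: filterS qmax => q'; rewrite lerN2.
have := sup v q (C12_hpoly _ _ _ _ _ _ _ sA) q0 qmin.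
rewrite dt_hpoly // hessian_hpoly // leNgt => /negP; apply.
have q0' := ltW q0.
apply: (@lt_le_trans _ _ (Gfun A - m q * kappa)).
  by have := m_kappa q0; rewrite /g; lra.
apply: G_diag_ge => //; first exact: m_ge0.
by move=> j; rewrite mxE; have := @coefD q j q0'; lra.
Qed.

End HeatBounds.
End GFunction.

(** * One-step expansions for the G-Brownian motion and for bounded noise *)

(** With eta = sqrt s this trades a cubic remainder for the quadratic and
    quartic terms of the barriers, at a total cost of order s^(3/2). *)
Lemma cube_young (R : realFieldType) (eta r : R) : 0 < eta -> 0 <= r ->
  r ^+ 3 <= eta * r ^+ 2 + eta^-1 * r ^+ 4.
Proof.
move=> e0 r0; rewrite -subr_ge0.
have -> : eta * r ^+ 2 + eta^-1 * r ^+ 4 - r ^+ 3 =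
    eta^-1 * r ^+ 2 * ((eta - r / 2) ^+ 2 + 3 / 4 * r ^+ 2).
  by field; rewrite gt_eqF.
by rewrite !mulr_ge0 ?sqr_ge0 ?invr_ge0 ?(ltW e0) // addr_ge0 ?sqr_ge0 // mulr_ge0 ?sqr_ge0.
Qed.

Lemma line_young (R : realFieldType) (eta r : R) : 0 < eta -> 0 <= r ->
  r <= eta + eta^-1 * r ^+ 2.
Proof.
move=> e0 r0; rewrite -subr_ge0.
have -> : eta + eta^-1 * r ^+ 2 - r = eta^-1 * ((r - eta / 2) ^+ 2 + 3 / 4 * eta ^+ 2).
  by field; rewrite gt_eqF.
by rewrite mulr_ge0 ?invr_ge0 ?(ltW e0) // addr_ge0 ?sqr_ge0 // mulr_ge0 ?sqr_ge0.
Qed.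

Section TaylorBound.
Variables (R : realType) (d : nat).
Let V := 'cV[R]_d.+1.

(** The cubic remainder makes one time step of length s accurate to order
    s^(3/2), which stays negligible after summation over t/s steps. *)
Definition taylor2 (f : V -> R) c p (A : 'M[R]_d.+1) (M : R) :=
  A^T = A /\ forall y, `|f y - (c + dotp p y + 2^-1 * quadr A y)| <= M * `|y| ^+ 3.

Lemma taylor2_scale f c p A M (s : R) : taylor2 f c p A M ->
  taylor2 (fun y => f (s *: y)) c (s *: p) (s ^+ 2 *: A) (M * `|s| ^+ 3).
Proof.
move=> [sA H]; split; first by rewrite linearZ /= sA.
move=> y; have := H (s *: y); rewrite dotpZr quadrZ dotpZl quadrZm normrZ exprMn.
by rewrite -!mulrA.
Qed.
End TaylorBound.

Section GBrownianMoments.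
Variables (R : realType) (d : nat) (Omega : Type) (E : sublinear_expectation R Omega).
Let V := 'cV[R]_d.+1.
Variable W : R -> Omega -> V.
Hypothesis BW : G_brownian_motion E W.

Let domW1 : forall a : 'M[R]_d.+1, a^T = a -> dom E (fun w => quadr a (W 1 w)).
Proof. by case: BW. Qed.

Let kap := kappa E (W 1).

Lemma dom_increment (f : V -> R) t s : Cb R V f -> 0 <= t -> 0 <= s ->
  dom E (fun w => f (W (t + s) w - W t w)).
Proof.
move=> Cf t0 s0; have [_ _ _ ind _] := BW.
have ts (i : 'I_0) : 0 <= (fun=> 0 : R) i <= t by case: i.
have := ind 0 (fun=> 0) t s t0 s0 ts.
have Cg : Cb R ('M[R]_(0, d.+1) * V)%type (fun q => f q.2).
  by apply: (Cb_comp Cf) => q; exact: cvg_snd.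
by move=> /(_ _ Cg) [].
Qed.

Lemma W0 w : W 0 w = 0. Proof. by case: BW. Qed.

Lemma dom_W (f : V -> R) s : Cb R V f -> 0 <= s -> dom E (fun w => f (W s w)).
Proof.
by move=> Cf s0; have := dom_increment Cf (lexx 0) s0; under eq_fun do rewrite add0r W0 subr0.
Qed.

Lemma increment_stationary (f : V -> R) x t s : Cb R V f -> 0 <= t -> 0 <= s ->
  E (fun w => f (x + (W (t + s) w - W t w))) = shiftE E (W s) f x.
Proof.
move=> Cf t0 s0; have [_ _ _ _ /(_ f Cf) [u _ Hu]] := BW.
rewrite Hu // -(Hu 0 s x (lexx 0) s0) /shiftE.
by under eq_fun do rewrite add0r W0 subr0.
Qed.

Lemma heat_solution (f : V -> R) : Cb R V f -> exists u B,
  [/\ viscosity_solution (Gfun E (W 1)) f u,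
      forall q : R * V, 0 <= q.1 -> `|u q| <= B &
      forall s x, 0 <= s -> u (s, x) = shiftE E (W s) f x].
Proof.
move=> Cf; have [_ _ _ _ /(_ f Cf) [u vu Hu]] := BW.
have [cf [B bf]] := (CbP f).1 Cf.
have Hu' s x : 0 <= s -> u (s, x) = shiftE E (W s) f x.
  by move=> s0; rewrite -(Hu 0 s x (lexx 0) s0); exact: increment_stationary.
exists u, B; split=> // -[s x] /= s0; rewrite Hu' //.
have Cfx := Cb_comp Cf (@shift_continuous _ _ x).
rewrite -[shiftE _ _ _ _]subr0 -[X in _ - X](expect_cst E 0).
by apply: expect_dist => [||w]; [exact: dom_W Cfx s0|exact: dom_cst|rewrite subr0].
Qed.

Lemma feller_W (del s : R) : 0 < del -> 0 <= s -> feller E (fun w => del *: W s w).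
Proof.
move=> del0 s0 f Cf.
have cs : continuous (fun y : V => del *: y) by exact: scale_continuous.
have Cg : Cb R V (fun y => f (del *: y)) := Cb_comp Cf cs.
split; first exact: dom_W Cg s0.
have [u [B [vu _ Hu]]] := heat_solution Cg.
have [cu _ _ _] := vu.
have -> : shiftE E (fun w => del *: W s w) f = fun x => u (s, del^-1 *: x).
  apply/funext => x; rewrite Hu //; apply: eq_expect => w.
  by rewrite scalerDr scalerA divff ?scale1r // gt_eqF.
move=> x; have := (subspace_continuousP _ _).1 cu (s, del^-1 *: x) s0.
move=> H.
have ct : (fun y : V => (s, del^-1 *: y)) @ x --> (s, del^-1 *: x).
  apply: (@cvg_pair _ _ _ (nbhs x) (nbhs s) (nbhs (del^-1 *: x))); [exact: cvg_cst | exact: scale_continuous].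
move=> U HU; have HH := H U HU.
apply: (@filterS _ (nbhs x) _ _ _ _ (ct _ HH)) => y /=; apply; exact: s0.
Qed.

Definition bm_const : R := 2 * kap + 12 * kap ^+ 2 + 1.

Lemma bm_const_gt0 : 0 < bm_const.
Proof. by have := kappa_ge0 domW1; have := sqr_ge0 kap; rewrite /bm_const -/kap; lra. Qed.

(** The expansion E[f(W_s)] = f(0) + s G(D^2 f(0)) + O(s^(3/2)), obtained by
    enclosing f between two polynomial barriers. It holds with a constant that
    depends on f through the remainder M only. *)
Lemma W_consistent (f : V -> R) c p A M s : Cb R V f -> 0 < M -> 0 < s ->
  taylor2 f c p A M ->
  `|E (fun w => f (W s w)) - (c + s * Gfun E (W 1) A)| <= bm_const * M * (s * Num.sqrt s).
Proof.
move=> Cf M0 s0 [sA HM]; have [u [B [vu bu Hu]]] := heat_solution Cf.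
have us : u (s, 0) = E (fun w => f (W s w)).
  by rewrite Hu ?ltW // /shiftE; apply: eq_expect => w; rewrite add0r.
set r := Num.sqrt s; have r0 : 0 < r by rewrite sqrtr_gt0.
have rr : r ^+ 2 = s by rewrite sqr_sqrtr // ltW.
pose a := M * r; pose b := M / r.
have a0 : 0 <= a by rewrite mulr_ge0 // ltW.
have b0 : 0 < b by rewrite divr_gt0.
have rem (y : V) : M * `|y| ^+ 3 <= a * sq2 y + b * sq4 y.
  rewrite /a /b -!mulrA -mulrDr; apply: ler_wpM2l; first exact: ltW.
  apply: le_trans (cube_young r0 (normr_ge0 y)) _.
  apply: lerD; apply: ler_wpM2l; rewrite ?invr_ge0 ?(ltW r0) //.
    exact: norm2_sq2.
  exact: norm4_sq4.
have s0' := ltW s0.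
have up : u (s, 0) <= c + s * (Gfun E (W 1) A + 2 * a * kap) + b * (12 * kap ^+ 2 + 1) * s ^+ 2.
  apply: (heat_upper domW1 vu bu sA a0 b0 s0') => y.
  by have := HM y; have := rem y; rewrite ler_distl => ? /andP[]; lra.
have lo : c + s * (Gfun E (W 1) A - 2 * a * kap) - b * (12 * kap ^+ 2 + 1) * s ^+ 2 <= u (s, 0).
  apply: (heat_lower domW1 vu bu sA a0 b0 s0') => y.
  by have := HM y; have := rem y; rewrite ler_distl => ? /andP[]; lra.
rewrite -us ler_distl; move: up lo; rewrite -/kap.
have -> : s * (Gfun E (W 1) A + 2 * a * kap) =
    s * Gfun E (W 1) A + 2 * kap * M * (s * r) by rewrite /a; ring.
have -> : s * (Gfun E (W 1) A - 2 * a * kap) =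
    s * Gfun E (W 1) A - 2 * kap * M * (s * r) by rewrite /a; ring.
have -> : b * (12 * kap ^+ 2 + 1) * s ^+ 2 = (12 * kap ^+ 2 + 1) * M * (s * r).
  by rewrite /b -rr; field; rewrite gt_eqF.
have -> : bm_const * M * (s * r) = 2 * kap * M * (s * r) +
   (12 * kap ^+ 2 + 1) * M * (s * r) by rewrite /bm_const; ring.
by move=> up lo; apply/andP; split; lra.
Qed.

(** The truncation at C is essential: E is constrained only on bounded
    functions of the increments, and E|W_s| itself may be much larger than
    sqrt s. *)
Lemma increment_moment (C L : R) t s : 0 <= C -> 0 < L -> 0 <= t -> 0 < s ->
  E (fun w => Num.min C (L * `|W (t + s) w - W t w|)) <= L * bm_const * 2 * Num.sqrt s.
Proof.
move=> C0 L0 t0 s0.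
pose f (y : V) := Num.min C (L * `|y|).
have f_ge0 y : 0 <= f y by rewrite /f le_min C0 mulr_ge0 // ltW.
have Cf : Cb R V f.
  have := trunc_Cb (0 : V) C0 (ltW L0).
  by under eq_fun do rewrite subr0.
have -> : E (fun w => Num.min C (L * `|W (t + s) w - W t w|)) = shiftE E (W s) f 0.
  rewrite -(increment_stationary 0 Cf t0 (ltW s0)).
  by apply: eq_expect => w; rewrite add0r.
have [u [B [vu bu Hu]]] := heat_solution Cf.
rewrite -Hu; last exact: ltW.
set r := Num.sqrt s; have r0 : 0 < r by rewrite sqrtr_gt0.
have rr : r ^+ 2 = s by rewrite sqr_sqrtr // ltW.
pose a := L / r; pose b := L / (s * r).
have a0 : 0 <= a by rewrite divr_ge0 // ltW.
have b0 : 0 < b by rewrite divr_gt0 // mulr_gt0.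
have s0' := ltW s0.
have k0 : 0 <= kap by exact: kappa_ge0.
have G0 : Gfun E (W 1) 0 = 0.
  rewrite /Gfun (_ : (fun w => _) = fun=> 0) ?expect_cst ?mulr0 //.
  by apply/funext => w; rewrite /quadr mulmx0 mul0mx mxE.
have up : u (s, 0) <= L * r + s * (Gfun E (W 1) 0 + 2 * a * kap) + b * (12 * kap ^+ 2 + 1) * s ^+ 2.
  apply: (@heat_upper _ _ _ _ _ domW1 _ _ _ _ 0 _ _ _ vu bu _ a0 b0 _ s0'); first exact: trmx0.
  move=> y; rewrite quadrE mul0mx.
  have -> : dotp (0 : V) y = 0 by rewrite /dotp big1 // => i _; rewrite mxE mul0r.
  have -> : dotp y (0 : V) = 0 by rewrite /dotp big1 // => i _; rewrite mxE mulr0.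
  rewrite mulr0 !addr0.
  have h1 : f y <= L * `|y| by rewrite /f ge_min lexx orbT.
  have h2 : L * `|y| <= L * r + a * `|y| ^+ 2.
    rewrite /a -mulrA -mulrDr; apply: ler_wpM2l; first exact: ltW.
    exact: line_young.
  have h3 : a * `|y| ^+ 2 <= a * sq2 y by apply: ler_wpM2l => //; exact: norm2_sq2.
  have h4 : 0 <= b * sq4 y by apply: mulr_ge0; [exact: ltW | exact: sq4_ge0].
  by lra.
apply: (le_trans up); rewrite G0 add0r.
have -> : L * r + s * (2 * a * kap) + b * (12 * kap ^+ 2 + 1) * s ^+ 2 =
    L * r * (1 + 2 * kap + (12 * kap ^+ 2 + 1)).
  by rewrite /a /b -rr; field; rewrite gt_eqF.
rewrite [leRHS](_ : _ = L * r * (bm_const * 2)); last by ring.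
apply: ler_wpM2l; first by rewrite mulr_ge0 // ltW.
by rewrite /bm_const; have := sqr_ge0 kap; lra.
Qed.

End GBrownianMoments.

Section BoundedNoise.
Variables (R : realType) (d : nat) (Omega : Type) (E : sublinear_expectation R Omega).
Let V := 'cV[R]_d.+1.
Variables (xi : Omega -> V) (B : R).
Hypothesis xiB : forall w, `|xi w| <= B.
Hypothesis xi_dom : forall f, Cb R V f -> dom E (fun w => f (xi w)).
Hypothesis xi_centered : forall a : V,
  dom E (fun w => (a^T *m xi w) 0 0) /\ E (fun w => (a^T *m xi w) 0 0) = 0.
Hypothesis xi_quad : forall a : 'M[R]_d.+1, a^T = a -> dom E (fun w => quadr a (xi w)).

Lemma feller_bounded (s : R) : feller E (fun w => s *: xi w).
Proof.
move=> f Cf; have [cf _] := (CbP f).1 Cf.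
have cs : continuous (fun y : V => s *: y) by exact: scale_continuous.
split; first by apply: xi_dom (Cb_comp Cf cs).
move=> x; apply/continuous_epsP => e e0.
have e2 : 0 < e / 2 by lra.
have [r r0 Hr] := unif_continuous_cube (`|x| + `|s| * B) cf e2.
exists r => // y yx; apply: (@le_lt_trans _ _ (e / 2)); last by lra.
have dd z : dom E (fun w => f (z + s *: xi w)).
  have cz : continuous (fun y : V => z + s *: y).
    by move=> z'; apply: (@cvgD _ V V (nbhs z')); [exact: cvg_cst | exact: cs].
  exact: xi_dom (Cb_comp Cf cz).
apply: expect_dist => [||w]; [exact: dd..|].
rewrite distrC; apply: Hr.
  apply: le_trans (ler_normD _ _) _; rewrite lerD2l normrZ.
  exact: ler_wpM2l.
by rewrite opprD addrACA subrr addr0 distrC.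
Qed.

Let dotp_dom (p : V) : dom E (fun w => dotp p (xi w)) /\ E (fun w => dotp p (xi w)) = 0.
Proof.
have H : (fun w => dotp p (xi w)) = (fun w => (p^T *m xi w) 0 0).
  by apply/funext => w; rewrite mxE; apply: eq_bigr => i _; rewrite mxE.
by rewrite H; exact: xi_centered.
Qed.

(** The same expansion as for the G-Brownian motion, by Taylor's formula and
    the vanishing of all linear terms; the generating function G is the same
    when the covariances agree. *)
Lemma noise_consistent (f : V -> R) c p A M s : Cb R V f -> 0 < M -> 0 < s ->
  taylor2 f c p A M ->
  `|E (fun w => f (Num.sqrt s *: xi w)) - (c + s * Gfun E xi A)| <=
     `|B| ^+ 3 * M * (s * Num.sqrt s).
Proof.
move=> Cf M0 s0 HT.
set r := Num.sqrt s; have r0 : 0 < r by rewrite sqrtr_gt0.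
have rr : r ^+ 2 = s by rewrite sqr_sqrtr // ltW.
have [sA HM] := taylor2_scale r HT.
have cs : continuous (fun y : V => r *: y) by exact: scale_continuous.
have df := xi_dom (Cb_comp Cf cs).
have [dp Ep] := dotp_dom (r *: p); have [dNp ENp] := dotp_dom (- (r *: p)).
have dq := xi_quad sA.
set e := `|B| ^+ 3 * M * (s * r).
have rem w : M * `|r| ^+ 3 * `|xi w| ^+ 3 <= e.
  have -> : e = M * `|r| ^+ 3 * `|B| ^+ 3 by rewrite /e (ger0_norm (ltW r0)) -rr; ring.
  apply: ler_wpM2l; first by rewrite mulr_ge0 ?exprn_ge0 // ltW.
  by rewrite lerXn2r ?nnegrE //; apply: le_trans (xiB w) _; exact: ler_norm.
have EA : E (fun w => 2^-1 * quadr (r ^+ 2 *: A) (xi w)) = s * Gfun E xi A.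
  rewrite expect_homog // (_ : (fun w => _) = (fun w => r ^+ 2 * quadr A (xi w))).
    rewrite expect_homog ?sqr_ge0 //; last by apply: xi_quad; case: HT.
    by rewrite /Gfun rr; ring.
  by apply/funext => w; rewrite quadrZm.
have dq2 := domZ 2^-1 dq.
rewrite ler_distl -EA; apply/andP; split.
  have -> : c + E (fun w => 2^-1 * quadr (r ^+ 2 *: A) (xi w)) - e =
     E (fun w => 2^-1 * quadr (r ^+ 2 *: A) (xi w) + (c - e)).
    by rewrite expectDc //; ring.
  rewrite -[leRHS]addr0 -ENp.
  apply: le_trans (expect_subadd df dNp).
  apply: expect_mono; [by apply: domD => //; exact: dom_cst | exact: domD |].
  move=> w; have := HM (xi w); have := rem w; rewrite ler_distl => ? /andP[].
  by rewrite -(scaleN1r (r *: p)) [dotp (-1 *: _) _]dotpZl /=; lra.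
have -> : c + E (fun w => 2^-1 * quadr (r ^+ 2 *: A) (xi w)) + e =
   0 + E (fun w => 2^-1 * quadr (r ^+ 2 *: A) (xi w) + (c + e)).
  by rewrite expectDc //; ring.
rewrite -[X in X + E _]Ep.
have dq3 : dom E (fun w => 2^-1 * quadr (r ^+ 2 *: A) (xi w) + (c + e)).
  by apply: domD => //; exact: dom_cst.
apply: le_trans (expect_subadd dp dq3).
apply: expect_mono; [exact: df | exact: domD |].
by move=> w; have := HM (xi w); have := rem w; rewrite ler_distl => ? /andP[] /=; lra.
Qed.

End BoundedNoise.

(** * Means of Lipschitz functions on the unit interval *)

Section Limits.
Variable R : realType.
Implicit Types (u v : nat -> R).

Lemma cvg_seq_le u (l c : R) : u @ \oo --> l -> (forall n, u n <= c) -> l <= c.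
Proof.
move=> ul uc; have := @cvg_lim _ _ _ _ _ _ _ ul => <- //.
by apply: limr_le; [apply/cvg_ex; exists l | near=> n; exact: uc].
Unshelve. all: by end_near. Qed.

Lemma cvg_seq_norm_le u (l c : R) : u @ \oo --> l -> (forall n, `|u n| <= c) -> `|l| <= c.
Proof. by move=> ul uc; apply: (@cvg_seq_le (fun n => `|u n|)) => //; exact: cvg_norm. Qed.

Lemma le_of_harmonic (a b C : R) : (forall n : nat, a <= b + C / n.+1%:R) -> a <= b.
Proof.
move=> H; apply: (@cvg_seq_le (fun n => a - C * n.+1%:R^-1)); last first.
  by move=> n; rewrite lerBlDr.
rewrite -[X in _ --> X]subr0 -[X in _ - X](mulr0 C).
by apply: cvgB; [exact: cvg_cst | apply: cvgM; [exact: cvg_cst | exact: cvg_harmonic]].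
Qed.

Lemma cvg_of_harmonic u (l C : R) :
  (forall n : nat, `|u n - l| <= C / n.+1%:R) -> u @ \oo --> l.
Proof.
move=> H; apply: (@squeeze_cvgr _ _ _ _ (fun n => l - C * n.+1%:R^-1) (fun n => l + C * n.+1%:R^-1)).
- by near=> n; have := H n; rewrite ler_distl.
- rewrite -[X in _ --> X]subr0 -[X in _ - X](mulr0 C).
  by apply: cvgB; [exact: cvg_cst | apply: cvgM; [exact: cvg_cst | exact: cvg_harmonic]].
- rewrite -[X in _ --> X]addr0 -[X in _ + X](mulr0 C).
  by apply: cvgD; [exact: cvg_cst | apply: cvgM; [exact: cvg_cst | exact: cvg_harmonic]].
Unshelve. all: by end_near. Qed.

End Limits.

Section RiemannSums.
Variable R : realType.
Implicit Types (phi : R -> R) (l : R) (n m : nat).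

(** Left Riemann sum on the unit interval. Sublinear expectations interact with
    finite sums but not with integrals, so the integral is kept at hand as a
    limit of Riemann sums with an explicit rate. *)
Definition riem n phi : R := n%:R^-1 * \sum_(j < n) phi (j%:R / n%:R).

Lemma sum_blocks n m (F : nat -> R) :
  \sum_(j < n * m) F j = \sum_(i < n) \sum_(k < m) F (i * m + k)%N.
Proof.
elim: n => [|n IH]; first by rewrite !big_ord0.
by rewrite mulSnr big_split_ord /= IH big_ord_recr.
Qed.

Lemma sum_const n (c : R) : \sum_(j < n) c = n%:R * c.
Proof. by rewrite sumr_const card_ord -[c *+ _]mulr_natl. Qed.

Lemma average_const n (c : R) : n.+1%:R^-1 * \sum_(j < n.+1) c = c.
Proof. by rewrite sum_const mulrA mulVf ?mul1r ?pnatr_eq0. Qed.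

Lemma riem_const n (c : R) : riem n.+1 (fun=> c) = c.
Proof. exact: average_const. Qed.

Lemma riem_le n phi psi : (forall j, (j < n)%N -> phi (j%:R / n%:R) <= psi (j%:R / n%:R)) ->
  riem n phi <= riem n psi.
Proof.
move=> H; apply: ler_wpM2l; first by rewrite invr_ge0 ler0n.
by apply: ler_sum => j _; exact: H.
Qed.

Lemma riem_dist n phi (a c : R) :
  (forall j, (j < n.+1)%N -> `|phi (j%:R / n.+1%:R) - a| <= c) -> `|riem n.+1 phi - a| <= c.
Proof.
move=> H; rewrite ler_distl -[a - c](riem_const n) -[a + c](riem_const n).
by apply/andP; split; apply: riem_le => j jn; have := H j jn; rewrite ler_distl => /andP[].
Qed.

Lemma riem_refine n m phi l : lip l phi ->
  `|riem (n.+1 * m.+1) phi - riem n.+1 phi| <= l / n.+1%:R.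
Proof.
move=> Lphi.
have n0 : (n.+1%:R : R) != 0 by rewrite pnatr_eq0.
have m0 : (m.+1%:R : R) != 0 by rewrite pnatr_eq0.
have l0 : 0 <= l.
  by have := Lphi 1 0; rewrite subr0 normr1 mulr1; apply: le_trans.
have -> : riem (n.+1 * m.+1) phi = n.+1%:R^-1 *
    \sum_(i < n.+1) (m.+1%:R^-1 * \sum_(k < m.+1) phi ((i * m.+1 + k)%:R / (n.+1 * m.+1)%:R)).
  rewrite /riem (sum_blocks _ _ (fun j => phi (j%:R / (n.+1 * m.+1)%:R))).
  by rewrite natrM invfM -mulrA mulr_sumr.
rewrite /riem -mulrBr -sumrB normrM ger0_norm ?invr_ge0 ?ler0n //.
have -> : l / n.+1%:R = n.+1%:R^-1 * \sum_(i < n.+1) (l / n.+1%:R).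
  by rewrite average_const.
apply: ler_wpM2l; first by rewrite invr_ge0 ler0n.
apply: le_trans (ler_norm_sum _ _ _) _; apply: ler_sum => i _.
have -> : phi (i%:R / n.+1%:R) = m.+1%:R^-1 * \sum_(k < m.+1) phi (i%:R / n.+1%:R).
  by rewrite average_const.
rewrite -mulrBr -sumrB normrM ger0_norm ?invr_ge0 ?ler0n //.
have -> : l / n.+1%:R = m.+1%:R^-1 * \sum_(k < m.+1) (l / n.+1%:R).
  by rewrite average_const.
apply: ler_wpM2l; first by rewrite invr_ge0 ler0n.
apply: le_trans (ler_norm_sum _ _ _) _; apply: ler_sum => k _.
apply: le_trans (Lphi _ _) _; apply: ler_wpM2l => //.
have -> : (i * m.+1 + k)%:R / (n.+1 * m.+1)%:R - i%:R / n.+1%:R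
    = (k%:R / m.+1%:R) / n.+1%:R :> R.
  by rewrite !natrD !natrM; field; rewrite !nat1r n0 m0.
rewrite ger0_norm; last by rewrite !divr_ge0 ?ler0n.
rewrite ler_pdivrMr ?ltr0n // mulVf // ler_pdivrMr ?ltr0n // mul1r ler_nat.
by apply: ltnW.
Qed.

Definition mean phi : R := lim ((fun n => riem n.+1 phi) @ \oo).

(** By refinement, any two of the intervals riem n +- l/n meet, through the
    Riemann sum with n * m nodes; their common point is the limit. *)
Lemma mean_dist phi l n : lip l phi -> `|riem n.+1 phi - mean phi| <= l / n.+1%:R.
Proof.
move=> Lphi.
pose S := [set riem k.+1 phi - l / k.+1%:R | k in [set: nat]].
have ub k : ubound S (riem k.+1 phi + l / k.+1%:R).
  move=> _ [j _ <-].
  have := riem_refine k j Lphi; rewrite mulnC; have := riem_refine j k Lphi.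
  by rewrite !ler_distl => /andP[h1 _] /andP[_ h4]; exact: le_trans h1 h4.
have supS : has_sup S.
  split; first by exists (riem 1 phi - l / 1); exists 0%N.
  by exists (riem 1 phi + l / 1%:R); exact: ub 0%N.
have I k : `|riem k.+1 phi - sup S| <= l / k.+1%:R.
  rewrite distrC ler_distl; apply/andP; split.
    by apply: sup_upper_bound => //; exists k.
  by apply: ge_sup; [case: supS | exact: ub].
have cv : (fun n => riem n.+1 phi) @ \oo --> sup S by exact: cvg_of_harmonic I.
by rewrite /mean (cvg_lim _ cv).
Qed.

Lemma cvg_mean phi l : lip l phi -> (fun n => riem n.+1 phi) @ \oo --> mean phi.
Proof. by move=> Lphi; apply: cvg_of_harmonic => n; exact: mean_dist. Qed.

Lemma mean_near phi l a c : lip l phi ->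
  (forall r, 0 <= r <= 1 -> `|phi r - a| <= c) -> `|mean phi - a| <= c.
Proof.
move=> Lphi H; apply: (@cvg_seq_norm_le _ (fun n => riem n.+1 phi - a)).
  by apply: cvgB; [exact: cvg_mean Lphi | exact: cvg_cst].
move=> n; apply: riem_dist => j jn; apply: H.
by rewrite divr_ge0 ?ler0n //= ler_pdivrMr ?ltr0n // mul1r ler_nat ltnW.
Qed.

Lemma mean_leDc phi psi l l' c : lip l phi -> lip l' psi ->
  (forall r, 0 <= r <= 1 -> phi r <= psi r + c) -> mean phi <= mean psi + c.
Proof.
move=> Lphi Lpsi H; rewrite -lerBlDl.
apply: (@cvg_seq_le _ (fun n => riem n.+1 phi - riem n.+1 psi)).
  by apply: cvgB; [exact: cvg_mean Lphi | exact: cvg_mean Lpsi].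
move=> n; rewrite lerBlDl -[c](riem_const n) /riem -mulrDr -big_split /=.
apply: (@riem_le n.+1 phi (fun r => psi r + c)) => j jn; apply: H.
by rewrite divr_ge0 ?ler0n //= ler_pdivrMr ?ltr0n // mul1r ler_nat ltnW.
Qed.

(** The fundamental theorem of calculus in disguise: translating the window
    changes the mean at rate phi 1 - phi 0. At the level of Riemann sums the
    difference of the two windows telescopes. *)
Lemma mean_shift_ge0 phi l (s : R) : lip l phi -> 0 <= s ->
  `|mean (fun r => phi (s + r)) - mean phi - s * (phi 1 - phi 0)| <= 2 * l * s ^+ 2.
Proof.
move=> Lphi s0.
have l0 : 0 <= l.
  by have := Lphi 1 0; rewrite subr0 normr1 mulr1; apply: le_trans.
have Lphis : lip l (fun r => phi (s + r)).
  by move=> a b; apply: le_trans (Lphi _ _) _; rewrite opprD addrACA subrr add0r.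
apply: (@le_of_harmonic _ _ _ (4 * l)) => n.
set N : R := n.+1%:R.
have N0 : 0 < N by rewrite ltr0n.
have d1 := mean_dist n Lphis; have d2 := mean_dist n Lphi.
suff H : `|riem n.+1 (fun r => phi (s + r)) - riem n.+1 phi - s * (phi 1 - phi 0)|
    <= 2 * l * s ^+ 2 + 2 * l / N.
  move: d1 d2 H; rewrite -/N -!mulrA; move: (l / N) => a; rewrite !ler_norml.
  by move=> /andP[? ?] /andP[? ?] /andP[? ?]; apply/andP; split; lra.
(* s is rounded to the grid of mesh 1/N *)
pose k := Num.trunc (s * N).
have kN : k%:R <= s * N < k.+1%:R by apply: trunc_itv; rewrite mulr_ge0 // ltW.
have {}kN : 0 <= s - k%:R / N <= N^-1.
  case/andP: kN => k1 k2; rewrite subr_ge0 ler_pdivrMr // k1 /=.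
  rewrite lerBlDl -[X in _ + X]mul1r -mulrDl ler_pdivlMr //; apply: ltW.
  by rewrite natr1.
have stepk : `|riem n.+1 (fun r => phi (s + r)) - riem n.+1 (fun r => phi (k%:R / N + r))| <= l / N.
  rewrite /riem -mulrBr -sumrB.
  have := @riem_dist n (fun r => phi (s + r) - phi (k%:R / N + r)) 0 (l / N).
  rewrite /riem subr0; apply => j _; rewrite subr0.
  apply: le_trans (Lphi _ _) _; apply: ler_wpM2l => //.
  rewrite opprD addrACA subrr addr0 ger0_norm; last by case/andP: kN.
  by case/andP: kN.
have tele : riem n.+1 (fun r => phi (k%:R / N + r)) - riem n.+1 phi =
    N^-1 * \sum_(j < k) (phi (1 + j%:R / N) - phi (j%:R / N)).
  rewrite /riem -/N -mulrBr; congr (_ * _).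
  pose F (j : nat) := phi (j%:R / N).
  have -> : \sum_(j < n.+1) phi (k%:R / N + j%:R / N) = \sum_(j < n.+1) F (k + j)%N.
    by apply: eq_bigr => j _; rewrite /F natrD mulrDl.
  have -> : \sum_(j < k) (phi (1 + j%:R / N) - phi (j%:R / N)) =
      \sum_(j < k) F (n.+1 + j)%N - \sum_(j < k) F j.
    rewrite -sumrB; apply: eq_bigr => j _; rewrite /F natrD mulrDl divff //.
  have e1 : \sum_(j < k + n.+1) F j = \sum_(j < k) F j + \sum_(j < n.+1) F (k + j)%N.
    by rewrite big_split_ord.
  have e2 : \sum_(j < n.+1 + k) F j = \sum_(j < n.+1) F j + \sum_(j < k) F (n.+1 + j)%N.
    by rewrite big_split_ord.
  rewrite addnC e2 in e1.
  have alg (a b c e : R) : b + c = e + a -> a - b = c - e by move=> h; lra.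
  exact: alg e1.
set D := phi 1 - phi 0.
have DL j : `|phi (1 + j%:R / N) - phi (j%:R / N) - D| <= 2 * l * (j%:R / N).
  have jN : 0 <= j%:R / N by rewrite divr_ge0 ?ler0n // ltW.
  have := Lphi (1 + j%:R / N) 1; have := Lphi (j%:R / N) 0.
  rewrite addrAC subrr add0r subr0 (ger0_norm jN) -mulrA !ler_norml /D.
  move: (l * _) (phi (1 + _)) (phi (_ / _)) => x y z.
  by move=> /andP[? ?] /andP[? ?]; apply/andP; split; lra.
have kNs : k%:R / N <= s by case/andP: kN; rewrite subr_ge0.
have k0 : 0 <= k%:R / N by rewrite divr_ge0 ?ler0n // ltW.
have sumD : `|N^-1 * \sum_(j < k) (phi (1 + j%:R / N) - phi (j%:R / N)) - k%:R / N * D|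
    <= 2 * l * s ^+ 2.
  have -> : k%:R / N * D = N^-1 * \sum_(j < k) D.
    by rewrite sum_const; ring.
  rewrite -mulrBr -sumrB normrM (ger0_norm (_ : 0 <= N^-1)) ?invr_ge0 ?(ltW N0) //.
  apply: (@le_trans _ _ (N^-1 * \sum_(j < k) (2 * l * s))).
    apply: ler_wpM2l; first by rewrite invr_ge0 ltW.
    apply: le_trans (ler_norm_sum _ _ _) _; apply: ler_sum => j _.
    apply: le_trans (DL j) _; apply: ler_wpM2l; first by rewrite mulr_ge0.
    apply: le_trans kNs; apply: ler_wpM2r; first by rewrite invr_ge0 ltW.
    by rewrite ler_nat ltnW.
  rewrite sum_const [leLHS](_ : _ = k%:R / N * (2 * l * s)); last by ring.
  rewrite [leRHS](_ : _ = s * (2 * l * s)); last by ring.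
  by apply: ler_wpM2r => //; rewrite !mulr_ge0.
have DN : `|(s - k%:R / N) * D| <= l / N.
  rewrite normrM mulrC; case/andP: kN => k1 k2; rewrite (ger0_norm k1).
  apply: ler_pM => //.
  by have := Lphi 1 0; rewrite subr0 normr1 mulr1.
have -> : riem n.+1 (fun r => phi (s + r)) - riem n.+1 phi - s * D =
   (riem n.+1 (fun r => phi (s + r)) - riem n.+1 (fun r => phi (k%:R / N + r)))
   + (N^-1 * \sum_(j < k) (phi (1 + j%:R / N) - phi (j%:R / N)) - k%:R / N * D)
   - (s - k%:R / N) * D by rewrite -tele; ring.
rewrite (_ : 2 * l * s ^+ 2 + 2 * l / N = l / N + 2 * l * s ^+ 2 + l / N); last by ring.
apply: le_trans (ler_normB _ _) (lerD _ DN).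
exact: le_trans (ler_normD _ _) (lerD stepk sumD).
Qed.

Lemma mean_shift phi l (s : R) : lip l phi ->
  `|mean (fun r => phi (s + r)) - mean phi - s * (phi 1 - phi 0)| <= 4 * l * s ^+ 2.
Proof.
move=> Lphi.
have l0 : 0 <= l.
  by have := Lphi 1 0; rewrite subr0 normr1 mulr1; apply: le_trans.
have [s0|s0] := leP 0 s.
  apply: le_trans (mean_shift_ge0 Lphi s0) _; apply: ler_wpM2r; first exact: sqr_ge0.
  by lra.
have Lphis : lip l (fun r => phi (s + r)).
  by move=> a b; apply: le_trans (Lphi _ _) _; rewrite opprD addrACA subrr add0r.
have ns0 : 0 <= - s by lra.
have := mean_shift_ge0 Lphis ns0; rewrite sqrrN addr0.
under eq_fun do rewrite addrA subrr add0r.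
have := Lphi (s + 1) 1; have := Lphi s 0; rewrite subr0 addrK.
rewrite (ltr0_norm s0) => h1 h2 h3.
have h4 : `|s * (phi (s + 1) - phi s - (phi 1 - phi 0))| <= 2 * l * s ^+ 2.
  have -> : 2 * l * s ^+ 2 = - s * (l * (- s) + l * (- s)) by ring.
  rewrite normrM (ltr0_norm s0); apply: ler_wpM2l => //.
  rewrite (_ : _ - _ = (phi (s + 1) - phi 1) - (phi s - phi 0)); last by ring.
  by apply: le_trans (ler_normB _ _) _; apply: lerD.
move: h3 h4; rewrite !ler_norml => /andP[? ?] /andP[? ?].
by apply/andP; split; lra.
Qed.

End RiemannSums.

(** * Averages along a segment and Jensen's inequality *)

Section Averaging.
Variables (R : realType) (d : nat).
Let V := 'cV[R]_d.+1.
Implicit Types (u v : V -> R) (x y e : V) (K L c : R).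

Definition avg e u : V -> R := fun x => mean (fun r => u (x + r *: e)).

Lemma line_lip u L x e : lip L u -> lip (L * `|e|) (fun r : R => u (x + r *: e)).
Proof.
move=> Lu r s; apply: le_trans (Lu _ _) _.
by rewrite opprD addrACA subrr add0r -scalerBl normrZ -mulrA [`|e| * _]mulrC.
Qed.

Lemma lip_ge0 (W W' : normedModType R) (f : W -> W') L (x y : W) : x != y -> lip L f -> 0 <= L.
Proof.
move=> xy Lf; have h : 0 <= L * `|x - y| by apply: le_trans (Lf x y).
by move: h; rewrite pmulr_lge0 // normr_gt0 subr_eq0.
Qed.

Lemma const1_neq0 : (const_mx 1 : V) != 0.
Proof.
by apply/eqP => /matrixP/(_ 0 0); rewrite !mxE => /eqP; rewrite oner_eq0.
Qed.

Lemma lipV_ge0 (W' : normedModType R) (f : V -> W') L : lip L f -> 0 <= L.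
Proof. exact: lip_ge0 const1_neq0. Qed.

Lemma avg_leDc u v L L' c e : lip L u -> lip L' v ->
  (forall x, u x <= v x + c) -> forall x, avg e u x <= avg e v x + c.
Proof.
by move=> Lu Lv uv x; apply: mean_leDc (line_lip x e Lu) (line_lip x e Lv) _ => r _.
Qed.

Lemma avg_near u L e x : lip L u -> `|avg e u x - u x| <= L * `|e|.
Proof.
move=> Lu; have L0 := lipV_ge0 Lu.
apply: mean_near (line_lip x e Lu) _ => r /andP[r0 r1].
apply: le_trans (Lu _ _) _; rewrite addrAC subrr add0r normrZ (ger0_norm r0).
by apply: ler_wpM2l => //; apply: ler_piMl.
Qed.

Lemma avg_bound u L K e : lip L u -> (forall x, `|u x| <= K) -> forall x, `|avg e u x| <= K.
Proof.
move=> Lu Ku x; rewrite -[avg e u x]subr0.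
by apply: mean_near (line_lip x e Lu) _ => r _; rewrite subr0.
Qed.

Lemma cvg_ord_sum n (F : 'I_n -> nat -> R) (l : 'I_n -> R) :
  (forall i, F i @ \oo --> l i) -> (fun N => \sum_i F i N) @ \oo --> \sum_i l i.
Proof.
elim: n F l => [F l _|n IH F l H].
  rewrite big_ord0 (_ : (fun N => _) = fun=> 0); first exact: cvg_cst.
  by apply/funext => N; rewrite big_ord0.
rewrite big_ord_recr (_ : (fun N => _) = fun N => \sum_(i < n) F (widen_ord (leqnSn n) i) N
    + F ord_max N); last by apply/funext => N; rewrite big_ord_recr.
by apply: cvgD; [apply: IH => i; exact: H | exact: H].
Qed.

(** Expansions that hold uniformly in x survive averaging, coefficient by
    coefficient; this replaces differentiation under the integral sign. *)
Lemma avg_expansion n u L (g : 'I_n -> V -> R) Lg (a : 'I_n -> R) y C e :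
  lip L u -> (forall i, lip Lg (g i)) ->
  (forall x, `|u (x + y) - u x - \sum_i g i x * a i| <= C) ->
  forall x, `|avg e u (x + y) - avg e u x - \sum_i avg e (g i) x * a i| <= C.
Proof.
move=> Lu Lgi H x.
pose F N := riem N.+1 (fun r => u (x + y + r *: e)) - riem N.+1 (fun r => u (x + r *: e))
  - \sum_i riem N.+1 (fun r => g i (x + r *: e)) * a i.
apply: (@cvg_seq_norm_le _ F).
  apply: cvgB; first by apply: cvgB; [exact: cvg_mean (line_lip (x + y) e Lu)
    | exact: cvg_mean (line_lip x e Lu)].
  apply: cvg_ord_sum => i; apply: cvgM; last exact: cvg_cst.
  exact: cvg_mean (line_lip x e (Lgi i)).
move=> N; pose phi r := u (x + r *: e + y) - u (x + r *: e) - \sum_i g i (x + r *: e) * a i.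
have -> : F N = riem N.+1 phi - 0.
  rewrite subr0 /F /phi /riem.
  have -> : \sum_i N.+1%:R^-1 * (\sum_(j < N.+1) g i (x + (j%:R / N.+1%:R) *: e)) * a i =
      N.+1%:R^-1 * \sum_(j < N.+1) \sum_i g i (x + (j%:R / N.+1%:R) *: e) * a i.
    by rewrite exchange_big mulr_sumr; apply: eq_bigr => i _; rewrite -mulrA mulr_suml.
  rewrite -!mulrBr -!sumrB; congr (_ * _); apply: eq_bigr => j _.
  by rewrite [x + y + _]addrAC.
by apply: riem_dist => j _; rewrite subr0; exact: H.
Qed.

Lemma avg_lip u L e : lip L u -> lip L (avg e u).
Proof.
move=> Lu x y.
have H (a b : V) : avg e u a <= avg e u b + L * `|a - b|.
  apply: mean_leDc (line_lip a e Lu) (line_lip b e Lu) _ => r _.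
  rewrite -lerBlDl; apply: le_trans (ler_norm _) _; apply: le_trans (Lu _ _) _.
  by rewrite opprD addrACA subrr addr0.
by rewrite ler_distl H lerBlDr distrC H.
Qed.

(** Averaging along e gains one derivative in the direction of e. *)
Lemma avg_shift u L e x (s : R) : lip L u ->
  `|avg e u (x + s *: e) - avg e u x - s * (u (x + e) - u x)| <= 4 * (L * `|e|) * s ^+ 2.
Proof.
move=> Lu; have := mean_shift s (line_lip x e Lu).
rewrite scale1r scale0r addr0 /avg.
by under eq_fun do rewrite scalerDl addrA.
Qed.

Section Jensen.
Variables (Omega : Type) (E : sublinear_expectation R Omega) (Z : Omega -> V).
Hypothesis FZ : feller E Z.

Lemma shiftE_riem u K L n x e : lip L u -> (forall x, `|u x| <= K) ->
  E (fun w => riem n.+1 (fun r => u (x + Z w + r *: e)))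
   <= riem n.+1 (fun r => shiftE E Z u (x + r *: e)).
Proof.
move=> Lu Ku; have Cu := lip_Cb Lu Ku.
have dd (j : nat) : dom E (fun w => u (x + Z w + (j%:R / n.+1%:R) *: e)).
  by under eq_fun do rewrite addrAC; exact: shift_dom.
pose F (j : nat) w := u (x + Z w + (j%:R / n.+1%:R) *: e).
have dF i : (i < n.+1)%N -> dom E (F i) by move=> _; exact: dd.
rewrite /riem expect_homog; [|exact: (dom_sum dF)|by rewrite invr_ge0 ler0n].
apply: ler_wpM2l; first by rewrite invr_ge0 ler0n.
apply: (le_trans (expect_sum_le dF)).
by apply: ler_sum => i _; rewrite /shiftE /F; under eq_fun do rewrite addrAC.
Qed.

(** Jensen's inequality: subadditivity gives it for Riemann sums, which
    approximate the average uniformly. *)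
Lemma shiftE_avg u K L x e : lip L u -> (forall x, `|u x| <= K) ->
  shiftE E Z (avg e u) x <= avg e (shiftE E Z u) x.
Proof.
move=> Lu Ku; have Cu := lip_Cb Lu Ku.
have La := avg_lip e Lu; have Ka := avg_bound e Lu Ku.
have Ls := shiftE_lip FZ Cu Lu.
apply: (@le_of_harmonic _ _ _ (L * `|e| + L * `|e|)) => n.
have h1 := mean_dist n (line_lip x e Ls).
rewrite mulrDl addrA -lerBlDr.
apply: (@le_trans _ _ (riem n.+1 (fun r => shiftE E Z u (x + r *: e)))); last first.
  by move: h1; rewrite ler_distl => /andP[_].
rewrite lerBlDr; apply: le_trans (lerD (shiftE_riem n x e Lu Ku) (lexx _)).
apply: expect_leDc.
- exact: shift_dom (lip_Cb La Ka).
- rewrite /riem; apply: domZ; apply: (@dom_sum _ _ _ n.+1 (fun j w => u (x + Z w + (j%:R / n.+1%:R) *: e))).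
  by move=> i _; under eq_fun do rewrite addrAC; exact: shift_dom.
- move=> w; have := mean_dist n (line_lip (x + Z w) e Lu).
  by rewrite ler_distlC => /andP[_]; rewrite /avg.
Qed.

(** A drift spoils translation invariance. Since b differs from the identity by
    a map of Lipschitz constant kap, the loss is proportional to kap, which for
    an Euler drift is of the order of the time step. *)
Lemma step_avg b u K L kap x e : lip L u -> (forall x, `|u x| <= K) ->
  (forall x y, `|b x - b y - (x - y)| <= kap * `|x - y|) ->
  continuous b -> (exists l, lip l b) ->
  step E Z b (avg e u) x <= avg e (step E Z b u) x + L * kap * `|e|.
Proof.
move=> Lu Ku Hb cb [l lb]; have Cu := lip_Cb Lu Ku; have L0 := lipV_ge0 Lu.
have Ls := shiftE_lip FZ Cu Lu.
have kap0 : 0 <= kap.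
  have := Hb (const_mx 1) 0 => h.
  have : 0 <= kap * `|(const_mx 1 : V) - 0| by apply: le_trans h.
  by rewrite pmulr_lge0 // normr_gt0 subr0; exact: const1_neq0.
apply: le_trans (shiftE_avg _ _ Lu Ku) _.
have lstep : lip (L * l) (step E Z b u).
  move=> y z; apply: le_trans (Ls _ _) _; rewrite -mulrA.
  by apply: ler_wpM2l.
apply: mean_leDc (line_lip (b x) e Ls) (line_lip x e lstep) _ => r /andP[r0 r1].
rewrite -lerBlDl; apply: le_trans (ler_norm _) _.
apply: le_trans (Ls _ _) _; rewrite -mulrA; apply: ler_wpM2l => //.
have := Hb (x + r *: e) x; rewrite [x + _ - x]addrAC subrr add0r distrC => h.
rewrite (_ : b x + r *: e - b (x + r *: e) = r *: e - (b (x + r *: e) - b x)); last first.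
  by rewrite opprB addrA [r *: e + _]addrC.
apply: (le_trans h); apply: ler_wpM2l => //.
by rewrite normrZ (ger0_norm r0); apply: ler_piMl.
Qed.

End Jensen.

End Averaging.

(** * Smoothing of Lipschitz functions *)

Section Smoothing.
Variables (R : realType) (d : nat).
Let V := 'cV[R]_d.+1.
Variable eps : R.
Hypothesis eps0 : 0 < eps.
Implicit Types (u v : V -> R) (x y e : V) (K L c : R) (k : nat).

Definition ebase k : V := eps *: delta_mx (inord k) 0.

Lemma ebase_norm k : `|ebase k| <= eps.
Proof.
rewrite normrZ (gtr0_norm eps0); apply: ler_piMr; first exact: ltW.
by apply: mx_norm_le => // i j; rewrite mxE; case: (_ && _); rewrite ?normr1 ?normr0.
Qed.

Definition smoothk k u : V -> R := iteri k (fun j => avg (ebase j)) u.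

Lemma smoothk_lip k u L : lip L u -> lip L (smoothk k u).
Proof. by move=> Lu; elim: k => [//|k IH] /=; exact: avg_lip. Qed.

Lemma smoothk_bound k u L K : lip L u -> (forall x, `|u x| <= K) ->
  forall x, `|smoothk k u x| <= K.
Proof.
move=> Lu Ku; elim: k => [//|k IH] x /=; exact: avg_bound (smoothk_lip k Lu) IH x.
Qed.

Lemma smoothk_near k u L x : lip L u -> `|smoothk k u x - u x| <= k%:R * (L * eps).
Proof.
move=> Lu; have L0 := lipV_ge0 Lu; elim: k => [|k IH] /=; first by rewrite subrr normr0 mul0r.
rewrite -natr1 mulrDl mul1r [leRHS]addrC -(subrKA (smoothk k u x)).
apply: le_trans (ler_normD _ _) (lerD _ IH).
apply: le_trans (avg_near _ _ (smoothk_lip k Lu)) _; apply: ler_wpM2l => //; exact: ebase_norm.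
Qed.

Lemma smoothk_leDc k u v L L' c : lip L u -> lip L' v ->
  (forall x, u x <= v x + c) -> forall x, smoothk k u x <= smoothk k v x + c.
Proof.
move=> Lu Lv uv; elim: k => [//|k IH] /=.
exact: avg_leDc (smoothk_lip k Lu) (smoothk_lip k Lv) IH.
Qed.

Lemma smoothk_expansion k n u L (g : 'I_n -> V -> R) Lg (a : 'I_n -> R) y C :
  lip L u -> (forall i, lip Lg (g i)) ->
  (forall x, `|u (x + y) - u x - \sum_i g i x * a i| <= C) ->
  forall x, `|smoothk k u (x + y) - smoothk k u x - \sum_i smoothk k (g i) x * a i| <= C.
Proof.
move=> Lu Lg' H; elim: k => [//|k IH] /=.
apply: (@avg_expansion _ _ n (smoothk k u) L (fun i => smoothk k (g i)) Lg a y C _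
  (smoothk_lip k Lu) _ IH) => i.
exact: smoothk_lip.
Qed.

(** Uniform first-order expansion in the directions of the first k coordinate
    axes only; it is gained one axis at a time. *)
Definition tangent k u (g : 'I_d.+1 -> V -> R) (M : R) :=
  forall x y, (forall i : 'I_d.+1, (k <= i)%N -> y i 0 = 0) ->
    `|u (x + y) - u x - \sum_i g i x * y i 0| <= M * `|y| ^+ 2.

Definition tangent_const L : R := 6 * L / eps.

(** Averaging in direction k creates the k-th partial derivative and keeps the
    earlier ones. The partial derivatives stay Lipschitz, which permits a
    second round. *)
Lemma smoothk_tangent k u L : (k <= d.+1)%N -> lip L u ->
  exists2 g, forall i, lip (2 * L / eps) (g i) & tangent k (smoothk k u) g (k%:R * tangent_const L).
Proof.
move=> kd Lu; have L0 := lipV_ge0 Lu.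
have Le0 : 0 <= 2 * L / eps by rewrite divr_ge0 ?mulr_ge0 // ltW.
elim: k kd => [_|k IH kd].
  exists (fun _ _ => 0) => [i x y|x y y0]; first by rewrite subrr normr0 mulr_ge0.
  have -> : y = 0 by apply/matrixP => i j; rewrite (ord1 j) y0 // mxE.
  by rewrite addr0 subrr big1 ?subr0 ?normr0 ?mul0r // => i _; rewrite mul0r.
have [g Lg tg] := IH (ltnW kd).
set v := smoothk k u in tg *; have Lv : lip L v by exact: smoothk_lip.
pose ik : 'I_d.+1 := inord k.
have ikE : ik = k :> nat by rewrite inordK.
pose e := ebase k.
pose gk x := (v (x + e) - v x) / eps.
have Lgk : lip (2 * L / eps) gk.
  move=> x y; rewrite /gk -mulrBl normrM (ger0_norm (_ : 0 <= eps^-1)) ?invr_ge0 ?(ltW eps0) //.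
  rewrite mulrAC; apply: ler_wpM2r; first by rewrite invr_ge0 ltW.
  have -> : v (x + e) - v x - (v (y + e) - v y) = (v (x + e) - v (y + e)) - (v x - v y) by ring.
  apply: le_trans (ler_normB _ _) _; have := Lv (x + e) (y + e); have := Lv x y.
  by rewrite opprD addrACA subrr addr0; lra.
pose g' i := if i == ik then gk else avg e (g i).
exists g' => [i|x y y0]; first by rewrite /g'; case: eqP => // _; exact: avg_lip.
pose s := y ik 0; pose y' : V := y - s *: delta_mx ik 0.
have y'E i : y' i 0 = if i == ik then 0 else y i 0.
  rewrite /y' !mxE eqxx andbT; case: eqP => [->|_]; first by rewrite mulr1 subrr.
  by rewrite mulr0 subr0.
have yE : y = y' + (s / eps) *: e.
  by rewrite /e /ebase scalerA divfK ?gt_eqF // /y' subrK.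
have y'0 (i : 'I_d.+1) : (k <= i)%N -> y' i 0 = 0.
  rewrite y'E; case: eqP => // /eqP ine; rewrite leq_eqVlt => /orP[/eqP ki|]; last exact: y0.
  by move: ine; rewrite -val_eqE /= ikE ki eqxx.
have ny' : `|y'| <= `|y|.
  apply: mx_norm_le => // i j; rewrite (ord1 j) y'E; case: eqP => _; last exact: mx_norm_ge.
  by rewrite normr0.
have ns : `|s| <= `|y| by exact: mx_norm_ge.
have h1 := avg_shift e (x + y') (s / eps) Lv.
have h2 : `|avg e v (x + y') - avg e v x - \sum_i avg e (g i) x * y' i 0| <= k%:R * tangent_const L * `|y'| ^+ 2.
  by apply: (@avg_expansion _ _ _ v L g _ (fun i => y' i 0) y' _ e Lv Lg) => z; exact: tg.
have h3 : `|s * (gk (x + y') - gk x)| <= 2 * L / eps * (`|y| ^+ 2).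
  rewrite normrM expr2 mulrCA; apply: ler_pM => //.
  apply: le_trans (Lgk _ _) _; rewrite addrAC subrr add0r; apply: ler_wpM2l => //.
have -> : smoothk k.+1 u (x + y) - smoothk k.+1 u x - \sum_i g' i x * y i 0 =
   (avg e v (x + y' + (s / eps) *: e) - avg e v (x + y') - s / eps * (v (x + y' + e) - v (x + y')))
   + (avg e v (x + y') - avg e v x - \sum_i avg e (g i) x * y' i 0)
   + s * (gk (x + y') - gk x).
  rewrite {1}yE addrA /= -/v -/e.
  have -> : \sum_i g' i x * y i 0 = gk x * s + \sum_i avg e (g i) x * y' i 0.
    rewrite (bigD1 ik) //= [in RHS](bigD1 ik) //= y'E /g' eqxx mulr0 add0r; congr (_ + _).
    by apply: eq_bigr => i /negbTE ine; rewrite y'E ine.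
  have -> : s / eps * (v (x + y' + e) - v (x + y')) = s * gk (x + y') by rewrite /gk; ring.
  by ring.
have h1' : 4 * (L * `|e|) * (s / eps) ^+ 2 <= 4 * L / eps * `|y| ^+ 2.
  apply: (@le_trans _ _ (4 * (L * eps) * (s / eps) ^+ 2)).
    apply: ler_wpM2r; first exact: sqr_ge0.
    by apply: ler_wpM2l => //; apply: ler_wpM2l => //; exact: ebase_norm.
  have -> : 4 * (L * eps) * (s / eps) ^+ 2 = 4 * L / eps * s ^+ 2 by field; rewrite gt_eqF.
  apply: ler_wpM2l; first by rewrite divr_ge0 ?mulr_ge0 // ltW.
  by rewrite -(real_normK (num_real s)) lerXn2r ?nnegrE.
have h2' : k%:R * tangent_const L * `|y'| ^+ 2 <= k%:R * tangent_const L * `|y| ^+ 2.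
  apply: ler_wpM2l; last by rewrite lerXn2r ?nnegrE.
  by rewrite mulr_ge0 // /tangent_const divr_ge0 ?mulr_ge0 // ltW.
have -> : k.+1%:R * tangent_const L * `|y| ^+ 2 =
   4 * L / eps * `|y| ^+ 2 + k%:R * tangent_const L * `|y| ^+ 2 + 2 * L / eps * `|y| ^+ 2.
  by rewrite -natr1 /tangent_const; ring.
apply: le_trans (ler_normD _ _) (lerD _ h3).
apply: le_trans (ler_normD _ _) (lerD _ _); first exact: le_trans h1 h1'.
exact: le_trans h2 h2'.
Qed.

(** Two rounds of averaging: the first makes u differentiable with Lipschitz
    gradient, the second makes the gradient differentiable with Lipschitz
    derivative. *)
Definition smooth u := smoothk d.+1 (smoothk d.+1 u).

(** A mean value inequality for functions with a uniform first-order expansion,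
    by summing the expansion over n equal pieces. *)
Lemma discrete_mvt (th th' : R -> R) K C :
  (forall s r, 0 <= s -> 0 <= r -> `|th (s + r) - th s - r * th' s| <= C * r ^+ 2) ->
  (forall s, 0 <= s <= 1 -> `|th' s| <= K) -> `|th 1 - th 0| <= K.
Proof.
move=> H Hth'; apply: (@le_of_harmonic _ _ _ C) => n.
set N : R := n.+1%:R; have N0 : 0 < N by rewrite ltr0n.
have tele (k : nat) : (k <= n.+1)%N ->
    `|th (k%:R / N) - th 0| <= k%:R * (K / N + C / N ^+ 2).
  elim: k => [_|k IH kn]; first by rewrite !mul0r subrr normr0.
  have kN0 : 0 <= k%:R / N by rewrite divr_ge0 ?ler0n // ltW.
  have kN1 : 0 <= k%:R / N <= 1.
    by rewrite kN0 ler_pdivrMr // mul1r ler_nat ltnW.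
  have iN : 0 <= N^-1 by rewrite invr_ge0 ltW.
  have h1 := H _ _ kN0 iN; have h2 := Hth' _ kN1; have h3 := IH (ltnW kn).
  have h4 : `|N^-1 * th' (k%:R / N)| <= K / N.
    by rewrite normrM (ger0_norm iN) mulrC; apply: ler_wpM2r.
  have -> : k.+1%:R / N = k%:R / N + N^-1 by rewrite -natr1 mulrDl mul1r.
  have -> : th (k%:R / N + N^-1) - th 0 = (th (k%:R / N) - th 0) +
    (N^-1 * th' (k%:R / N) + (th (k%:R / N + N^-1) - th (k%:R / N) - N^-1 * th' (k%:R / N))) by ring.
  rewrite -natr1 mulrDl mul1r.
  apply: le_trans (ler_normD _ _) (lerD h3 _).
  by apply: le_trans (ler_normD _ _) (lerD h4 _); rewrite -exprVn.
have := tele _ (leqnn _); rewrite -/N divff ?gt_eqF // => /le_trans; apply.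
have -> : N * (K / N + C / N ^+ 2) = K + C / N by field; rewrite gt_eqF.
exact: lexx.
Qed.

Definition taylor_const L : R := d.+1%:R * (d.+1%:R * tangent_const (2 * L / eps)).

Lemma tangent_const_ge0 L : 0 <= L -> 0 <= tangent_const L.
Proof. by move=> L0; rewrite /tangent_const divr_ge0 ?mulr_ge0 // ltW. Qed.

Lemma taylor_const_ge0 L : 0 <= L -> 0 <= taylor_const L.
Proof.
move=> L0; rewrite /taylor_const mulr_ge0 // mulr_ge0 // tangent_const_ge0 //.
by rewrite divr_ge0 ?mulr_ge0 // ltW.
Qed.

(** The expansion of the gradient is integrated along the segment from x to
    x + y. The matrix of second derivatives is symmetrised, which does not
    change its quadratic form. *)
Lemma smooth_taylor u L x : lip L u ->
  exists p A, taylor2 (fun y => smooth u (x + y)) (smooth u x) p A (taylor_const L).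
Proof.
move=> Lu; have L0 := lipV_ge0 Lu.
have [g Lg tg] := smoothk_tangent (leqnn _) Lu.
pose G i := smoothk d.+1 (g i).
have tG y z : `|smooth u (z + y) - smooth u z - \sum_i G i z * y i 0| <= d.+1%:R * tangent_const L * `|y| ^+ 2.
  apply: (@smoothk_expansion d.+1 _ _ L g _ (fun i => y i 0) y _ (smoothk_lip d.+1 Lu) Lg) => z'.
  apply: tg => i.
  by rewrite leqNgt ltn_ord.
have [h Hh] : exists h : 'I_d.+1 -> 'I_d.+1 -> V -> R,
    forall i, tangent d.+1 (G i) (h i) (d.+1%:R * tangent_const (2 * L / eps)).
  apply: (@fin_all_exists _ _ (fun i hi => tangent d.+1 (G i) hi (d.+1%:R * tangent_const (2 * L / eps)))) => i.
  by have [h _ H] := smoothk_tangent (leqnn _) (Lg i); exists h.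
pose A : 'M[R]_d.+1 := \matrix_(i, j) (2^-1 * (h i j x + h j i x)).
pose p : V := \col_i G i x.
exists p, A; split.
  by apply/matrixP => i j; rewrite !mxE addrC.
move=> y; pose Q := \sum_i y i 0 * \sum_j h i j x * y j 0.
have QE : quadr A y = Q.
  rewrite quadrE /dotp /Q.
  under eq_bigr => i _ do rewrite mxE mulr_sumr.
  under [RHS]eq_bigr => i _ do rewrite mulr_sumr.
  pose T i j := y i 0 * (h i j x * y j 0).
  transitivity (\sum_i \sum_j 2^-1 * (T i j + T j i)).
    by apply: eq_bigr => i _; apply: eq_bigr => j _; rewrite mxE /T; ring.
  have Tsym : \sum_i \sum_j T j i = \sum_i \sum_j T i j by rewrite exchange_big.
  transitivity (2^-1 * (\sum_i \sum_j T i j + \sum_i \sum_j T j i)).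
    rewrite -big_split mulr_sumr; apply: eq_bigr => i _.
    by rewrite -big_split mulr_sumr.
  by rewrite Tsym /T; lra.
have pE : dotp p y = \sum_i G i x * y i 0 by apply: eq_bigr => i _; rewrite mxE.
rewrite QE pE.
pose P := \sum_i G i x * y i 0.
pose th s := smooth u (x + s *: y) - s * P - 2^-1 * s ^+ 2 * Q.
pose th' s := \sum_i G i (x + s *: y) * y i 0 - P - s * Q.
have -> : smooth u (x + y) - (smooth u x + \sum_i G i x * y i 0 + 2^-1 * Q) = th 1 - th 0.
  by rewrite /th scale1r scale0r addr0 -/P; ring.
apply: (@discrete_mvt th th' _ (d.+1%:R * tangent_const L * `|y| ^+ 2 + `|2^-1 * Q|)).
  move=> s r s0 r0; have := tG (r *: y) (x + s *: y).
  rewrite -[x + _ + r *: y]addrA -scalerDl normrZ (ger0_norm r0) => H.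
  have -> : th (s + r) - th s - r * th' s =
     (smooth u (x + (s + r) *: y) - smooth u (x + s *: y) - \sum_i G i (x + s *: y) * (r *: y) i 0)
     - r ^+ 2 * (2^-1 * Q).
    have -> : \sum_i G i (x + s *: y) * (r *: y) i 0 = r * \sum_i G i (x + s *: y) * y i 0.
      by rewrite mulr_sumr; apply: eq_bigr => i _; rewrite mxE mulrCA.
    by rewrite /th /th'; field.
  apply: le_trans (ler_normB _ _) _; rewrite mulrDl; apply: lerD.
    by apply: le_trans H _; rewrite exprMn; rewrite le_eqVlt; apply/orP; left; apply/eqP; ring.
  by rewrite normrM (ger0_norm (sqr_ge0 r)) mulrC.
move=> s /andP[s0 s1].
have -> : th' s = \sum_i (G i (x + s *: y) - G i x - \sum_j h i j x * (s *: y) j 0) * y i 0.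
  rewrite /th' /P /Q mulr_sumr -!sumrB; apply: eq_bigr => i _.
  have -> : \sum_j h i j x * (s *: y) j 0 = s * \sum_j h i j x * y j 0.
    by rewrite mulr_sumr; apply: eq_bigr => j _; rewrite mxE mulrCA.
  by ring.
apply: le_trans (ler_norm_sum _ _ _) _.
rewrite /taylor_const -mulrA -sum_const; apply: ler_sum => i _.
rewrite normrM exprSr mulrA; apply: ler_pM => //; last exact: mx_norm_ge.
have vac (z : V) : forall j : 'I_d.+1, (d.+1 <= j)%N -> z j 0 = 0.
  by move=> j; rewrite leqNgt ltn_ord.
apply: le_trans (Hh i x (s *: y) (vac _)) _; apply: ler_wpM2l.
  by rewrite mulr_ge0 // /tangent_const !(divr_ge0, mulr_ge0) // ltW.
rewrite lerXn2r ?nnegrE // normrZ (ger0_norm s0); exact: ler_piMl.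
Qed.

Lemma smooth_near u L x : lip L u -> `|smooth u x - u x| <= 2 * d.+1%:R * (L * eps).
Proof.
move=> Lu; rewrite -[_ - _](subrKA (smoothk d.+1 u x)).
apply: le_trans (ler_normD _ _) _.
rewrite (_ : 2 * d.+1%:R * (L * eps) = d.+1%:R * (L * eps) + d.+1%:R * (L * eps)); last by ring.
by apply: lerD; apply: smoothk_near => //; exact: smoothk_lip.
Qed.

Lemma smooth_lip u L : lip L u -> lip L (smooth u).
Proof. by move=> Lu; do 2! apply: smoothk_lip. Qed.

Lemma smooth_bound u L K : lip L u -> (forall x, `|u x| <= K) -> forall x, `|smooth u x| <= K.
Proof.
by move=> Lu Ku; apply: (smoothk_bound _ (smoothk_lip _ Lu)); exact: smoothk_bound Lu Ku.
Qed.

Section StepSmoothing.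
Variables (Omega : Type) (E : sublinear_expectation R Omega) (Z : Omega -> V).
Hypothesis FZ : feller E Z.
Variables (b : V -> V) (kap l : R).
Hypothesis Hb : forall x y, `|b x - b y - (x - y)| <= kap * `|x - y|.
Hypothesis lb : lip l b.
Hypothesis kap0 : 0 <= kap.

Lemma step_lip u K L : lip L u -> (forall x, `|u x| <= K) -> lip (L * l) (step E Z b u).
Proof.
move=> Lu Ku x y; have L0 := lipV_ge0 Lu.
apply: le_trans (shiftE_lip FZ (lip_Cb Lu Ku) Lu _ _) _; rewrite -mulrA.
by apply: ler_wpM2l.
Qed.

Lemma step_smoothk k u K L x : lip L u -> (forall x, `|u x| <= K) ->
  step E Z b (smoothk k u) x <= smoothk k (step E Z b u) x + k%:R * (L * kap * eps).
Proof.
move=> Lu Ku; have L0 := lipV_ge0 Lu; elim: k x => [|k IH] x /=.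
  by rewrite mul0r addr0.
have Lv := smoothk_lip k Lu; have Kv := smoothk_bound k Lu Ku.
have ex : exists l, lip l b by exists l.
apply: le_trans (step_avg FZ _ _ Lv Kv Hb (lip_continuous lb) ex) _.
rewrite -natr1 mulrDl mul1r addrA; apply: lerD.
  apply: avg_leDc (step_lip Lv Kv) (smoothk_lip k (step_lip Lu Ku)) IH _.
by apply: ler_wpM2l; [rewrite mulr_ge0 | exact: ebase_norm].
Qed.

(** Jensen's inequality for the smoothing operator, up to the drift error. *)
Lemma step_smooth u K L x : lip L u -> (forall x, `|u x| <= K) ->
  step E Z b (smooth u) x <= smooth (step E Z b u) x + 2 * d.+1%:R * (L * kap * eps).
Proof.
move=> Lu Ku; have Lv := smoothk_lip d.+1 Lu; have Kv := smoothk_bound d.+1 Lu Ku.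
apply: le_trans (step_smoothk d.+1 x Lv Kv) _.
rewrite (_ : 2 * d.+1%:R * (L * kap * eps) =
  d.+1%:R * (L * kap * eps) + d.+1%:R * (L * kap * eps)); last by ring.
rewrite addrA lerD2r.
apply: (smoothk_leDc _ (step_lip Lv Kv) (smoothk_lip d.+1 (step_lip Lu Ku))) => z.
exact: step_smoothk.
Qed.

End StepSmoothing.

End Smoothing.

(** * Comparison of the iterates of two schemes *)

Section Comparison.
Variables (R : realType) (d : nat).
Let V := 'cV[R]_d.+1.

(** Agreement of the two noises on functions with a second-order expansion.
    In the application r is of order h^(3/2). *)
Definition consistent Omega1 (E1 : sublinear_expectation R Omega1) (Z1 : Omega1 -> V)
    Omega2 (E2 : sublinear_expectation R Omega2) (Z2 : Omega2 -> V) (r : R) :=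
  forall (f : V -> R) c p A M, Cb R V f -> 0 < M -> taylor2 f c p A M ->
    `|E1 (fun w => f (Z1 w)) - E2 (fun w => f (Z2 w))| <= r * M.

Lemma consistent_sym Omega1 (E1 : sublinear_expectation R Omega1) (Z1 : Omega1 -> V)
    Omega2 (E2 : sublinear_expectation R Omega2) (Z2 : Omega2 -> V) (r : R) :
  consistent E1 Z1 E2 Z2 r -> consistent E2 Z2 E1 Z1 r.
Proof. by move=> H f c p A M Cf M0 T; rewrite distrC; exact: H T. Qed.

Section OneSided.
Variables (Omega1 Omega2 : Type).
Variables (E1 : sublinear_expectation R Omega1) (Z1 : Omega1 -> V).
Variables (E2 : sublinear_expectation R Omega2) (Z2 : Omega2 -> V).
Hypotheses (F1 : feller E1 Z1) (F2 : feller E2 Z2).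
Variable r : R.
Hypothesis cons : consistent E1 Z1 E2 Z2 r.
Variables (b : V -> V) (kap l eps : R).
Hypothesis Hb : forall x y, `|b x - b y - (x - y)| <= kap * `|x - y|.
Hypothesis lb : lip l b.
Hypothesis kap0 : 0 <= kap.
Hypothesis l1 : 1 <= l.
Hypothesis eps0 : 0 < eps.

(** Let S and P be the steps of the first and the second noise, and u_n the
    iterates of S. They are only Lipschitz, so consistency cannot be applied to
    them. But smoothing them produces a supersolution of the scheme S:
    smooth (S u_n) >= S (smooth u_n) - c by convexity, and on the smooth
    function smooth u_n the steps S and P are consistent. By induction the
    P-iterates stay below the smoothed S-iterates. Both schemes being convex,
    the roles can be exchanged, which gives the two-sided bound. *)
Lemma iterates_le (g : V -> R) K L m : lip L g -> (forall x, `|g x| <= K) ->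
  forall x, iter m (step E2 Z2 b) g x <= iter m (step E1 Z1 b) g x
    + (4 * d.+1%:R * (L * l ^+ m * eps)
       + m%:R * (2 * d.+1%:R * (L * l ^+ m * kap * eps) + r * (taylor_const d eps (L * l ^+ m) + 1))).
Proof.
move=> Lg Kg; have L0 := lipV_ge0 Lg; have cb := lip_continuous lb.
have Cg := lip_Cb Lg Kg.
set Lm := L * l ^+ m.
set s := 2 * d.+1%:R * (Lm * eps).
set c := 2 * d.+1%:R * (Lm * kap * eps) + r * (taylor_const d eps Lm + 1).
pose u n := iter n (step E1 Z1 b) g; pose v n := iter n (step E2 Z2 b) g.
have Lu n : (n <= m)%N -> lip Lm (u n).
  move=> nm x y; apply: le_trans (iter_step_lip F1 n lb L0 Cg Lg _ _) _.
  apply: ler_wpM2r => //; apply: ler_wpM2l => //; exact: ler_weXn2l.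
have Ku n x : `|u n x| <= K by exact: iter_step_bound.
have Lm0 : 0 <= Lm by rewrite mulr_ge0 // exprn_ge0 // (le_trans ler01).
have main n : (n <= m)%N -> forall x, v n x <= smooth eps (u n) x + (s + n%:R * c).
  elim: n => [_|n IH nm] x.
    rewrite mul0r addr0 -lerBlDl; apply: le_trans (ler_norm _) _.
    by rewrite distrC; exact: (smooth_near eps0 _ (Lu 0%N (leq0n _))).
  have nm' := ltnW nm; have Lun := Lu n nm'.
  have Csm : Cb R V (smooth eps (u n)) :=
    lip_Cb (smooth_lip eps Lun) (smooth_bound eps Lun (Ku n)).
  have h1 : v n.+1 x <= step E2 Z2 b (smooth eps (u n)) x + (s + n%:R * c).
    apply: (shiftE_leDc F2 _ Csm) => //; last exact: IH.
    exact: iter_step_Cb.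
  have h2 : step E2 Z2 b (smooth eps (u n)) x <=
      step E1 Z1 b (smooth eps (u n)) x + r * (taylor_const d eps Lm + 1).
    have [p [A [sA T]]] := smooth_taylor eps0 (b x) Lun.
    have Cs := Cb_comp Csm (@shift_continuous _ _ (b x)).
    have T' : taylor2 (fun y => smooth eps (u n) (b x + y)) (smooth eps (u n) (b x)) p A (taylor_const d eps Lm + 1).
      split=> // y; apply: le_trans (T y) _; apply: ler_wpM2r; first by rewrite exprn_ge0.
      by rewrite lerDl.
    have M0 : 0 < taylor_const d eps Lm + 1.
      by rewrite ltr_wpDl // taylor_const_ge0.
    have := cons Cs M0 T'; rewrite ler_distlC => /andP[_].
    by rewrite /step /shiftE /=; apply.
  have h3 := step_smooth eps0 F1 Hb lb kap0 x Lun (Ku n).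
  have -> : smooth eps (u n.+1) = smooth eps (step E1 Z1 b (u n)) by [].
  have h4 : step E2 Z2 b (smooth eps (u n)) x <= smooth eps (step E1 Z1 b (u n)) x + c.
    by apply: (le_trans h2); rewrite /c addrA lerD2r.
  have -> : s + n.+1%:R * c = c + (s + n%:R * c) by rewrite -natr1; ring.
  by apply: (le_trans h1); rewrite [leRHS]addrA lerD2r.
move=> x; apply: le_trans (main m (leqnn m) x) _.
have := smooth_near eps0 x (Lu m (leqnn m)); rewrite ler_distl => /andP[_ h].
have -> : 4 * d.+1%:R * (Lm * eps) = s + s by rewrite /s; ring.
by rewrite -/s in h; rewrite -/(u m); lra.
Qed.

End OneSided.

Lemma iterates_dist Omega1 (E1 : sublinear_expectation R Omega1) (Z1 : Omega1 -> V)
    Omega2 (E2 : sublinear_expectation R Omega2) (Z2 : Omega2 -> V)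
    (r : R) (b : V -> V) (kap l eps : R) (g : V -> R) K L m x :
  feller E1 Z1 -> feller E2 Z2 -> consistent E1 Z1 E2 Z2 r ->
  (forall x y, `|b x - b y - (x - y)| <= kap * `|x - y|) -> lip l b ->
  0 <= kap -> 1 <= l -> 0 < eps -> lip L g -> (forall x, `|g x| <= K) ->
  `|iter m (step E1 Z1 b) g x - iter m (step E2 Z2 b) g x| <=
    4 * d.+1%:R * (L * l ^+ m * eps)
       + m%:R * (2 * d.+1%:R * (L * l ^+ m * kap * eps) + r * (taylor_const d eps (L * l ^+ m) + 1)).
Proof.
move=> F1 F2 cons Hb lb k0 l1 e0 Lg Kg.
have h1 := iterates_le F1 F2 cons Hb lb k0 l1 e0 m Lg Kg x.
have h2 := iterates_le F2 F1 (consistent_sym cons) Hb lb k0 l1 e0 m Lg Kg x.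
by rewrite ler_distl h2 lerBlDr h1.
Qed.

End Comparison.

(** * The Euler scheme driven by the G-Brownian motion *)

Section LinearGrowth.
Variables (R : realType) (M : topologicalType) (sz : M -> R).
Hypothesis sz1 : forall A, 1 <= sz A.

(** Functions of this class, applied to finitely many values of the process
    (W, X), are in the domain of the expectation; sz measures the size of the
    sampled values. *)
Definition lingrow (W : normedModType R) (Y : M -> W) := continuous Y /\
  exists C : R, forall A, `|Y A| <= C * sz A.

Lemma lingrow_bounded (W : normedModType R) (Y : M -> W) K :
  continuous Y -> (forall A, `|Y A| <= K) -> lingrow Y.
Proof.
move=> cY KY; split=> //; exists K => A; apply: le_trans (KY A) _.
have K0 : 0 <= K by apply: le_trans (KY A).
by apply: ler_peMr => //; exact: sz1.
Qed.

Lemma lingrow_cst (W : normedModType R) (c : W) : lingrow (fun=> c).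
Proof.
split; first exact: cst_continuous.
exists `|c| => A; apply: ler_peMr => //; exact: sz1.
Qed.

Lemma lingrow_add (W : normedModType R) (Y Z : M -> W) :
  lingrow Y -> lingrow Z -> lingrow (fun A => Y A + Z A).
Proof.
move=> [cY [C HC]] [cZ [D HD]]; split.
  by move=> A; apply: cvgD; [exact: cY | exact: cZ].
by exists (C + D) => A; rewrite mulrDl; apply: le_trans (ler_normD _ _) (lerD (HC A) (HD A)).
Qed.

Lemma lingrow_lip (W W' : normedModType R) (Y : M -> W) (f : W -> W') L :
  lip L f -> 0 <= L -> lingrow Y -> lingrow (fun A => f (Y A)).
Proof.
move=> Lf L0 [cY [C HC]]; split.
  by move=> A; apply: continuous_comp; [exact: cY | exact: lip_continuous Lf _].
exists (`|f 0| + L * C) => A.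
rewrite -[f _](subrK (f 0)) addrC; apply: le_trans (ler_normD _ _) _.
rewrite mulrDl; apply: lerD; first by apply: ler_peMr => //; exact: sz1.
apply: le_trans (Lf _ _) _; rewrite subr0 -mulrA; apply: ler_wpM2l => //; exact: HC.
Qed.

Lemma lingrow_scale (W : normedModType R) (Y : M -> W) (s : R) :
  lingrow Y -> lingrow (fun A => s *: Y A).
Proof.
by apply: (@lingrow_lip _ _ _ _ `|s|) => // x y; rewrite -scalerBr normrZ.
Qed.

Lemma lingrow_norm (W : normedModType R) (Y : M -> W) :
  lingrow Y -> lingrow (fun A => `|Y A| : R).
Proof.
apply: (@lingrow_lip _ _ _ (fun y : W => `|y| : R^o) 1) => // x y.
by rewrite mul1r; exact: ler_dist_dist.
Qed.

End LinearGrowth.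

Section MatrixGrowth.
Variables (R : realType) (d m n : nat).
Let V := 'cV[R]_d.+1.

Definition mxsize (A : 'M[R]_(m, n)) : R := 1 + \sum_(i < m) \sum_(j < n) `|A i j|.

Lemma mxsize1 A : 1 <= mxsize A.
Proof. by rewrite lerDl; apply: sumr_ge0 => i _; apply: sumr_ge0. Qed.

Lemma lingrow_col (i : 'I_m) (f : 'I_d.+1 -> 'I_n) :
  lingrow mxsize (fun A : 'M[R]_(m, n) => (\col_j A i (f j)) : V).
Proof.
have H A : `|(\col_j A i (f j)) : V| <= \sum_(i < m) \sum_(j < n) `|A i j|.
  apply: mx_norm_le => [|j k]; first by apply: sumr_ge0 => ? _; apply: sumr_ge0.
  rewrite mxE (bigD1 i) //= (bigD1 (f j)) //= -addrA lerDl.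
  by apply: addr_ge0; [apply: sumr_ge0 | apply: sumr_ge0 => ? _; apply: sumr_ge0].
split; last by exists 1 => A; rewrite mul1r; apply: le_trans (H A) _; rewrite lerDr.
apply: (@lip_continuous _ _ _ 1) => A B; rewrite mul1r.
apply: mx_norm_le => // j k; rewrite !mxE.
by have := mx_norm_ge (A - B) i (f j); rewrite !mxE.
Qed.

End MatrixGrowth.

Lemma Cb_shift_pair (R : realType) (S : topologicalType) (V : normedModType R)
    (del : R) (Y : S -> V) (g : V -> R) : continuous Y -> Cb R V g ->
  Cb R (S * V)%type (fun q => g (Y q.1 + del *: q.2)).
Proof.
move=> cY Cg; apply: (Cb_comp Cg) => q; apply: (@cvgD _ V _ (nbhs q)).
  apply: (@continuous_comp _ _ _ (fun q : S * V => q.1) Y); first exact: cvg_fst.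
  exact: cY.
apply: (@continuous_comp _ _ _ (fun q : S * V => q.2) (fun y => del *: y)).
  exact: cvg_snd.
exact: scale_continuous.
Qed.

Section EulerScheme.
Variables (R : realType) (d : nat).
Let V := 'cV[R]_d.+1.
Variables (psi : V -> V) (del : R) (x0 : V) (h : R).

Definition drift (x : V) : V := x + h *: psi x.

Lemma drift_lip L : lip L psi -> 0 <= h -> lip (1 + L * h) drift.
Proof.
move=> psiL h0 x y; rewrite /drift opprD addrACA -scalerBr.
apply: le_trans (ler_normD _ _) _; rewrite mulrDl mul1r lerD2l normrZ (ger0_norm h0).
by rewrite mulrAC mulrC; apply: ler_wpM2r.
Qed.

(** A function of the path z sampled at grid points, rather than of the random
    increments, so that it is visibly continuous in finitely many values. *)
Fixpoint euler (z : nat -> V) (k : nat) : V :=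
  if k is k'.+1 then drift (euler z k') + del *: (z k'.+1 - z k') else x0.

Lemma eq_euler z z' k : (forall i, (i <= k)%N -> z i = z' i) -> euler z k = euler z' k.
Proof.
elim: k => [//|k IH] H /=.
rewrite IH; first by rewrite !H.
by move=> i ik; apply: H; exact: leqW.
Qed.

Lemma euler_lingrow m n L (z : nat -> 'M[R]_(m, n) -> V) k : lip L psi ->
  (forall i, lingrow (@mxsize R m n) (z i)) -> lingrow (@mxsize R m n) (fun A => euler (fun i => z i A) k).
Proof.
move=> Lp Hz; have s1 := @mxsize1 R m n.
elim: k => [|k IH] /=; first exact: (lingrow_cst s1).
apply: lingrow_add.
  apply: lingrow_add; first exact: IH.
  by apply: (lingrow_scale s1); apply: (lingrow_lip s1 Lp (lipV_ge0 Lp)).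
apply: (lingrow_scale s1); apply: lingrow_add; first exact: Hz.
have -> : (fun A => - z k A) = (fun A => (-1) *: z k A).
  by apply/funext => A; rewrite scaleN1r.
exact: (lingrow_scale s1).
Qed.

Variables (Omega : Type) (E : sublinear_expectation R Omega) (W : R -> Omega -> V).
Hypothesis BW : G_brownian_motion E W.
Hypothesis del0 : 0 < del.
Hypothesis h0 : 0 <= h.

Definition eulerW (k : nat) (w : Omega) : V := euler (fun i => W (i%:R * h) w) k.

Lemma increment_shift (g : V -> R) c t s : Cb R V g -> 0 <= t -> 0 <= s ->
  E (fun w => g (c + del *: (W (t + s) w - W t w))) = shiftE E (fun w => del *: W s w) g c.
Proof.
move=> Cg t0 s0.
have cc : continuous (fun y : V => c + del *: y).
  by move=> y; apply: (@cvgD _ V V (nbhs y)); [exact: cvg_cst | exact: scale_continuous].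
have Cf := Cb_comp Cg cc.
have := increment_stationary BW 0 Cf t0 s0.
rewrite /shiftE /= => H.
rewrite (_ : (fun w => g (c + del *: W s w)) = (fun w => g (c + del *: (0 + W s w)))).
  by rewrite -H; apply: eq_expect => w; rewrite add0r.
by apply/funext => w; rewrite add0r.
Qed.

(** The last increment of W is independent of the past, so that it can be
    integrated out first; this is one application of the step operator. *)
Lemma euler_markov (g : V -> R) L k : lip L psi -> Cb R V g ->
  dom E (fun w => g (eulerW k w)) /\
  E (fun w => g (eulerW k w)) = iter k (step E (fun w => del *: W h w) drift) g x0.
Proof.
move=> Lp; elim: k g => [|k IH] g Cg.
  by rewrite /eulerW /= expect_cst; split=> //; exact: dom_cst.
have cdrift := lip_continuous (drift_lip Lp h0).
have t0 : 0 <= k%:R * h by rewrite mulr_ge0.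
pose ts (i : 'I_k.+1) : R := (i : nat)%:R * h.
have Hts i : 0 <= ts i <= k%:R * h.
  by rewrite /ts mulr_ge0 //= ler_wpM2r // ler_nat -ltnS.
have [_ _ _ /(_ _ ts _ _ t0 h0 Hts) ind _] := BW.
pose zc i (A : 'M[R]_(k.+1, d.+1)) : V := \col_j A (inord i) j.
pose f (q : 'M[R]_(k.+1, d.+1) * V) := g (drift (euler (fun i => zc i q.1) k) + del *: q.2).
have [contE _] := @euler_lingrow _ _ _ zc k Lp (fun i => @lingrow_col _ _ _ _ _ id).
have cY := continuous_compose contE cdrift.
have Cf : Cb R ('M[R]_(k.+1, d.+1) * V)%type f := Cb_shift_pair del cY Cg.
have sampleE w : euler (fun i => zc i (sample W ts w)) k = eulerW k w.
  apply: eq_euler => i ik; apply/matrixP => a b.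
  by rewrite !mxE /ts inordK ?ltnS // (ord1 b).
have fE w : f (sample W ts w, W (k%:R * h + h) w - W (k%:R * h) w) = g (eulerW k.+1 w).
  rewrite /f /= sampleE /eulerW /=; congr (g (_ + _ *: (W _ w - _))).
  by rewrite -natr1 mulrDl mul1r.
have fE2 w : E (fun w' => f (sample W ts w, W (k%:R * h + h) w' - W (k%:R * h) w')) =
    step E (fun w => del *: W h w) drift g (eulerW k w).
  by rewrite /f /= sampleE; exact: increment_shift.
have [d1 _ _ ee] := ind f Cf.
split; first by apply: eq_dom d1.
rewrite iterSr; have [_ <-] := IH _ (step_Cb (feller_W BW del0 h0) cdrift Cg).
rewrite -(eq_expect E fE) ee; exact: eq_expect.
Qed.

End EulerScheme.

(** * Error of the Euler scheme *)

Section EulerError.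
Variables (R : realType) (d : nat).
Let V := 'cV[R]_d.+1.
Variables (Omega : Type) (E : sublinear_expectation R Omega) (W : R -> Omega -> V).
Hypothesis BW : G_brownian_motion E W.
Variables (psi : V -> V) (C Lp del : R) (x0 : V) (X : R -> Omega -> V).
Hypothesis psiC : forall y, `|psi y| <= C.
Hypothesis psiL : lip Lp psi.
Hypothesis Lp0 : 0 < Lp.
Hypothesis del0 : 0 < del.
Hypothesis HX : sde_solution E psi W del x0 X.

Let C0 : 0 <= C. Proof. exact: le_trans (psiC 0). Qed.
Let Z t w : 'cV[R]_(d.+1 + d.+1) := col_mx (W t w) (X t w).

Section Grid.
Variables (m : nat) (p : nat -> R).
Hypothesis p0 : forall i, 0 <= p i.
Let mat := 'M[R]_(m.+1, d.+1 + d.+1).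
Let smp w : mat := sample Z (fun i : 'I_m.+1 => p i) w.

Definition coordW i (A : 'M[R]_(m.+1, d.+1 + d.+1)) : V := \col_j A (inord i) (lshift d.+1 j).
Definition coordX i (A : 'M[R]_(m.+1, d.+1 + d.+1)) : V := \col_j A (inord i) (rshift d.+1 j).

Lemma coordWE i w : (i <= m)%N -> coordW i (smp w) = W (p i) w.
Proof.
by move=> im; apply/matrixP => a b; rewrite mxE /smp mxE /Z col_mxEu inordK ?ltnS // (ord1 b).
Qed.

Lemma coordXE i w : (i <= m)%N -> coordX i (smp w) = X (p i) w.
Proof.
by move=> im; apply/matrixP => a b; rewrite mxE /smp mxE /Z col_mxEd inordK ?ltnS // (ord1 b).
Qed.

Lemma coordW_lingrow i : lingrow (@mxsize R _ _) (coordW i).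
Proof. exact: lingrow_col. Qed.

Lemma coordX_lingrow i : lingrow (@mxsize R _ _) (coordX i).
Proof. exact: lingrow_col. Qed.

Lemma dom_grid (Y : mat -> R) : lingrow (@mxsize R _ _) Y -> dom E (fun w => Y (smp w)).
Proof.
move=> [cY [K HK]]; have [dZ _ _] := HX.
by apply: dZ => //; exists K.
Qed.

End Grid.

Lemma dom_X (g : V -> R) t : Cb R V g -> 0 <= t -> dom E (fun w => g (X t w)).
Proof.
move=> /CbP[cg [K bg]] t0.
have H : lingrow (@mxsize R 1 (d.+1 + d.+1)) (fun A => g (coordX 0%N A)).
  apply: (lingrow_bounded (@mxsize1 _ _ _) (K := K)) => [A|A]; last exact: bg.
  apply: (@continuous_comp _ _ _ (fun A => coordX 0%N A) g); last exact: cg.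
  by have [cc _] := @coordX_lingrow 0 0; exact: cc.
have := @dom_grid 0 (fun=> t) (fun=> t0) _ H.
by apply: eq_dom => w; rewrite coordXE.
Qed.

(** The increment of the solution without its noise, i.e. formally the integral
    of the drift over [s, s + r]. *)
Definition dinc s r w : V := X (s + r) w - X s w - del *: (W (s + r) w - W s w).

Lemma dom_dinc s r : 0 <= s -> 0 <= r -> dom E (fun w => `|dinc s r w|).
Proof.
move=> s0 r0; pose p i := if i is 0%N then s else s + r.
have Hp i : 0 <= p i by case: i => //= _; exact: addr_ge0.
have s1 := @mxsize1 R 2 (d.+1 + d.+1).
pose Y (A : 'M[R]_(2, d.+1 + d.+1)) : V :=
  (coordX 1 A + (-1) *: coordX 0 A) + (- del) *: (coordW 1 A + (-1) *: coordW 0 A).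
have LY : lingrow (@mxsize R 2 (d.+1 + d.+1)) Y.
  apply: lingrow_add; [apply: lingrow_add|apply: (lingrow_scale s1); apply: lingrow_add].
  - exact: coordX_lingrow.
  - by apply: (lingrow_scale s1); exact: coordX_lingrow.
  - exact: coordW_lingrow.
  - by apply: (lingrow_scale s1); exact: coordW_lingrow.
have := @dom_grid 1 p Hp _ (lingrow_norm s1 LY).
by apply: eq_dom => w; rewrite /Y !coordXE // !coordWE // /dinc !scaleN1r scaleNr.
Qed.

Lemma dom_defect s r : 0 <= s -> 0 <= r -> dom E (fun w => `|dinc s r w - r *: psi (X s w)|).
Proof.
move=> s0 r0; pose p i := if i is 0%N then s else s + r.
have Hp i : 0 <= p i by case: i => //= _; exact: addr_ge0.
have s1 := @mxsize1 R 2 (d.+1 + d.+1).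
pose Y (A : 'M[R]_(2, d.+1 + d.+1)) : V :=
  ((coordX 1 A + (-1) *: coordX 0 A) + (- del) *: (coordW 1 A + (-1) *: coordW 0 A))
  + (- r) *: psi (coordX 0 A).
have LY : lingrow (@mxsize R 2 (d.+1 + d.+1)) Y.
  apply: lingrow_add; last first.
    apply: (lingrow_scale s1); apply: (lingrow_lip s1 psiL (ltW Lp0)); exact: coordX_lingrow.
  apply: lingrow_add; [apply: lingrow_add|apply: (lingrow_scale s1); apply: lingrow_add].
  - exact: coordX_lingrow.
  - by apply: (lingrow_scale s1); exact: coordX_lingrow.
  - exact: coordW_lingrow.
  - by apply: (lingrow_scale s1); exact: coordW_lingrow.
have := @dom_grid 1 p Hp _ (lingrow_norm s1 LY).
by apply: eq_dom => w; rewrite /Y !coordXE // !coordWE // /dinc !scaleN1r !scaleNr.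
Qed.

(** Subtracts the Riemann sums of the time integrals up to s + r and up to s,
    taken on partitions that agree on [0, s]. The approximation error e is
    arbitrary while N depends on e, so later bounds must be uniform in N. *)
Lemma riemann_increment s r e : 0 <= s -> 0 <= r -> 0 < e ->
  exists N : nat, exists2 Err : Omega -> R, dom E Err /\ E Err <= e &
    forall w, `|dinc s r w -
      \sum_(i < N.+1) (r / N.+1%:R) *: psi (X (s + i%:R * (r / N.+1%:R)) w)| <= Err w.
Proof.
move=> s0 r0 e0; have [_ _ Hint] := HX.
have e2 : 0 < e / 2 by lra.
have [q1 q10 H1] := Hint s s0 _ e2; have [q2 q20 H2] := Hint (s + r) (addr_ge0 s0 r0) _ e2.
pose q := Num.min q1 q2; have q0 : 0 < q by rewrite lt_min q10.
pose N := Num.trunc ((s + r) / q); pose M : R := N.+1%:R.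
have M0 : 0 < M by rewrite ltr0n.
have mesh : (s + r) / M <= q.
  have : (s + r) / q < N.+1%:R.
    by have := @trunc_itv R ((s + r) / q) (divr_ge0 (addr_ge0 s0 r0) (ltW q0)) => /andP[].
  by rewrite ltr_pdivrMr // ler_pdivrMr // mulrC => /ltW.
have sM0 : 0 <= s / M by rewrite divr_ge0 // ltW.
have rM0 : 0 <= r / M by rewrite divr_ge0 // ltW.
have sM : s / M <= q by apply: le_trans mesh; rewrite ler_pM2r ?invr_gt0 // lerDl.
have rM : r / M <= q by apply: le_trans mesh; rewrite ler_pM2r ?invr_gt0 // lerDr.
(* N.+1 equal pieces of [0, s] followed by N.+1 equal pieces of [s, s + r] *)
pose p (i : nat) : R := if (i <= N.+1)%N then i%:R * (s / M) else s + (i - N.+1)%:R * (r / M).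
have pN : p N.+1 = s by rewrite /p leqnn mulrC divfK // gt_eqF.
have pNi i : p (N.+1 + i)%N = s + i%:R * (r / M).
  case: i => [|i]; first by rewrite addn0 pN mul0r addr0.
  by rewrite /p -[X in (_ <= X)%N]addn0 leq_add2l /= addKn.
have pi i : (i <= N.+1)%N -> p i = i%:R * (s / M) by rewrite /p => ->.
have p00 : p 0%N = 0 by rewrite pi // mul0r.
have pE : p (N.+1 + N.+1)%N = s + r.
  by rewrite pNi; congr (_ + _); rewrite mulrC divfK // gt_eqF.
have meshp i : p i <= p i.+1 <= p i + q.
  have [iN|iN] := ltnP i N.+1.
    by rewrite (pi i (ltnW iN)) (pi i.+1 iN) -natr1 mulrDl mul1r lerDl sM0 lerD2l.
  rewrite -(subnKC iN) -addnS !pNi -natr1 mulrDl mul1r addrA lerDl rM0 lerD2l.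
  exact: rM.
have dp1 (i : nat) : (i < N.+1)%N -> p i.+1 - p i = s / M.
  by move=> iN; rewrite (pi i (ltnW iN)) (pi i.+1 iN) -natr1; ring.
have dp2 i : p (N.+1 + i).+1 - p (N.+1 + i)%N = r / M.
  by rewrite -addnS !pNi -natr1; ring.
have [d1 E1] : let S w := \sum_(i < N.+1) (p i.+1 - p i) *: psi (X (p i) w) in
    dom E (fun w => enorm (X s w - x0 - del *: W s w - S w)) /\
    E (fun w => enorm (X s w - x0 - del *: W s w - S w)) <= e / 2.
  apply: H1 => // i _; have /andP[-> h] := meshp i; apply: le_trans h _.
  by rewrite lerD2l ge_min lexx.
have [d2 E2] : let S w := \sum_(i < N.+1 + N.+1) (p i.+1 - p i) *: psi (X (p i) w) in
    dom E (fun w => enorm (X (s + r) w - x0 - del *: W (s + r) w - S w)) /\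
    E (fun w => enorm (X (s + r) w - x0 - del *: W (s + r) w - S w)) <= e / 2.
  apply: H2 => // i _; have /andP[-> h] := meshp i; apply: le_trans h _.
  by rewrite lerD2l ge_min lexx orbT.
exists N; exists (fun w =>
  enorm (X (s + r) w - x0 - del *: W (s + r) w -
     \sum_(i < N.+1 + N.+1) (p i.+1 - p i) *: psi (X (p i) w)) +
  enorm (X s w - x0 - del *: W s w - \sum_(i < N.+1) (p i.+1 - p i) *: psi (X (p i) w))).
  split; first exact: domD.
  apply: le_trans (expect_subadd d2 d1) _; lra.
move=> w; rewrite big_split_ord /=.
set S1 := \sum_(i < N.+1) _ *: psi (X (p i) w).
have -> : \sum_(i < N.+1) (p (N.+1 + i).+1 - p (N.+1 + i)%N) *: psi (X (p (N.+1 + i)%N) w) =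
    \sum_(i < N.+1) (r / M) *: psi (X (s + i%:R * (r / M)) w).
  by apply: eq_bigr => i _; rewrite dp2 pNi.
set S2 := \sum_(i < N.+1) (r / M) *: _.
have -> : dinc s r w - S2 = (X (s + r) w - x0 - del *: W (s + r) w - (S1 + S2))
    - (X s w - x0 - del *: W s w - S1).
  by rewrite /dinc; apply/matrixP => i j; rewrite !mxE; ring.
by apply: le_trans (ler_normB _ _) (lerD _ _); exact: enorm_ge.
Qed.

Lemma dinc_bound s r : 0 <= s -> 0 <= r -> E (fun w => `|dinc s r w|) <= C * r.
Proof.
move=> s0 r0; apply/ler_addgt0Pr => e e0.
have [N [Err [dErr EErr] H]] := riemann_increment s0 r0 e0.
rewrite addrC; apply: le_trans (lerD EErr (lexx _)).
apply: expect_leDc => //; first exact: dom_dinc.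
move=> w; rewrite -[dinc s r w](subrK (\sum_(i < N.+1)
  (r / N.+1%:R) *: psi (X (s + i%:R * (r / N.+1%:R)) w))).
apply: le_trans (ler_normD _ _) (lerD (H w) _).
apply: le_trans (ler_norm_sum _ _ _) _.
have rN0 : 0 <= r / N.+1%:R by rewrite divr_ge0.
apply: (@le_trans _ _ (\sum_(i < N.+1) (r / N.+1%:R * C))).
  by apply: ler_sum => i _; rewrite normrZ (ger0_norm rN0); apply: ler_wpM2l.
by rewrite sum_const mulrA (mulrC _ (r / _)) divfK ?pnatr_eq0 // mulrC.
Qed.

Let K := Lp * del * bm_const E W * 2.

Let K0 : 0 <= K.
Proof. by rewrite /K !mulr_ge0 // ?ltW //; exact: bm_const_gt0 BW. Qed.

Lemma noise_moment s r : 0 <= s -> 0 <= r ->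
  dom E (fun w => Num.min (2 * C) (Lp * del * `|W (s + r) w - W s w|)) /\
  E (fun w => Num.min (2 * C) (Lp * del * `|W (s + r) w - W s w|)) <= K * Num.sqrt r.
Proof.
move=> s0 r0; have C20 : 0 <= 2 * C by rewrite mulr_ge0.
have Ld : 0 < Lp * del by rewrite mulr_gt0.
split.
  have Cf := trunc_Cb (0 : V) C20 (ltW Ld).
  by have := dom_increment BW Cf s0 r0; under eq_fun do rewrite subr0.
move: r0; rewrite le_eqVlt => /orP[/eqP <-|r0].
  rewrite sqrtr0 mulr0 (_ : (fun w => _) = fun=> 0) ?expect_cst //.
  apply/funext => w; rewrite addr0 subrr normr0 mulr0.
  by apply/min_idPr.
by have := increment_moment BW C20 Ld s0 r0; rewrite /K.
Qed.

(** One-step error of order r^(3/2). The drift at X_{s+q} is compared with the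
    drift at X_s; the part due to the noise is bounded both by 2C and by
    its Lipschitz estimate, and thus by a bounded function of the increment
    of W, on which E is controlled. *)
Lemma defect_bound s r : 0 <= s -> 0 <= r ->
  E (fun w => `|dinc s r w - r *: psi (X s w)|) <= r * (Lp * C * r + K * Num.sqrt r).
Proof.
move=> s0 r0; apply/ler_addgt0Pr => e e0.
have [N [Err [dErr EErr] H]] := riemann_increment s0 r0 e0.
pose q i := i%:R * (r / N.+1%:R) : R.
have rN0 : 0 <= r / N.+1%:R by rewrite divr_ge0.
have q0 i : 0 <= q i by rewrite mulr_ge0.
have qr i : (i < N.+1)%N -> q i <= r.
  move=> iN; rewrite /q mulrCA; apply: ler_piMr => //.
  by rewrite ler_pdivrMr ?ltr0n // mul1r ler_nat ltnW.
pose Y i w := r / N.+1%:R * (Lp * `|dinc s (q i) w| +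
  Num.min (2 * C) (Lp * del * `|W (s + q i) w - W s w|)).
have dY0 i : dom E (fun w => Lp * `|dinc s (q i) w| +
  Num.min (2 * C) (Lp * del * `|W (s + q i) w - W s w|)).
  have [dm _] := noise_moment s0 (q0 i).
  by apply: domD => //; apply: domZ; exact: dom_dinc.
have dY i : (i < N.+1)%N -> dom E (Y i) by move=> _; exact: domZ.
have EY i : (i < N.+1)%N -> E (Y i) <= r / N.+1%:R * (Lp * C * r + K * Num.sqrt r).
  move=> iN; have [dm Em] := noise_moment s0 (q0 i).
  rewrite expect_homog //; apply: ler_wpM2l => //.
  have dd := dom_dinc s0 (q0 i).
  apply: le_trans (expect_subadd (domZ Lp dd) dm) _; apply: lerD.
    rewrite (expect_homog dd (ltW Lp0)) -mulrA; apply: ler_wpM2l; first exact: ltW.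
    apply: le_trans (dinc_bound s0 (q0 i)) _; apply: ler_wpM2l => //; exact: qr.
  apply: le_trans Em _; apply: ler_wpM2l => //; apply: ler_wsqrtr; exact: qr.
have dS := dom_sum dY.
apply: (@le_trans _ _ (E (fun w => Err w + \sum_(i < N.+1) Y i w))).
  apply: expect_mono; [exact: dom_defect | exact: domD | move=> w].
  set S := \sum_(i < N.+1) (r / N.+1%:R) *: psi (X (s + i%:R * (r / N.+1%:R)) w) in H *.
  have Sw := H w; rewrite -/S in Sw.
  rewrite -(subrKA (\sum_(i < N.+1) (r / N.+1%:R) *: psi (X (s + q i) w))).
  apply: le_trans (ler_normD _ _) (lerD (H w) _).
  have -> : r *: psi (X s w) = \sum_(i < N.+1) (r / N.+1%:R) *: psi (X s w).
    by rewrite sumr_const card_ord -scaler_nat scalerA mulrC divfK ?pnatr_eq0.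
  rewrite -sumrB; apply: le_trans (ler_norm_sum _ _ _) _; apply: ler_sum => i _.
  rewrite -scalerBr normrZ (ger0_norm rN0); apply: ler_wpM2l => //.
  have XE : X (s + q i) w - X s w = dinc s (q i) w + del *: (W (s + q i) w - W s w).
    by rewrite /dinc subrK.
  have h1 : `|psi (X (s + q i) w) - psi (X s w)| <=
      Lp * `|dinc s (q i) w| + Lp * del * `|W (s + q i) w - W s w|.
    apply: le_trans (psiL _ _) _; rewrite XE -!mulrA -mulrDr; apply: ler_wpM2l; first exact: ltW.
    by apply: le_trans (ler_normD _ _) _; rewrite normrZ (gtr0_norm del0).
  have h2 : `|psi (X (s + q i) w) - psi (X s w)| <= 2 * C.
    apply: le_trans (ler_normB _ _) _.
    by have := psiC (X (s + q i) w); have := psiC (X s w); lra.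
  have h3 : 0 <= Lp * `|dinc s (q i) w| by rewrite mulr_ge0 // ltW.
  rewrite -lerBlDl le_min; apply/andP; split; first by lra.
  by rewrite lerBlDl.
apply: le_trans (expect_subadd dErr dS) _.
rewrite addrC; apply: lerD => //.
apply: le_trans (expect_sum_le dY) _.
apply: (@le_trans _ _ (\sum_(i < N.+1) (r / N.+1%:R * (Lp * C * r + K * Num.sqrt r)))).
  by apply: ler_sum => i _; exact: EY.
by rewrite sum_const mulrA (mulrC _ (r / _)) divfK ?pnatr_eq0.
Qed.

Section Scheme.
Variable h : R.
Hypothesis h0 : 0 <= h.

Let Xh := eulerW psi del x0 h W.

Lemma dom_euler_error k : dom E (fun w => `|X (k%:R * h) w - Xh k w|).
Proof.
have s1 := @mxsize1 R k.+1 (d.+1 + d.+1).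
have Hp (i : nat) : 0 <= i%:R * h by rewrite mulr_ge0.
pose Y (A : 'M[R]_(k.+1, d.+1 + d.+1)) : V :=
  coordX k A + (-1) *: euler psi del x0 h (fun i => coordW i A) k.
have LY : lingrow (@mxsize R k.+1 (d.+1 + d.+1)) Y.
  apply: lingrow_add; first exact: coordX_lingrow.
  apply: (lingrow_scale s1); apply: (euler_lingrow _ _ _ _ psiL) => i; exact: coordW_lingrow.
have := @dom_grid k (fun i => i%:R * h) Hp _ (lingrow_norm s1 LY).
apply: eq_dom => w; rewrite /Y (@coordXE k (fun i => i%:R * h) k w (leqnn k)) scaleN1r.
congr (`| _ - _ |); apply: eq_euler => i ik.
exact: (@coordWE k (fun i => i%:R * h) i w ik).
Qed.

Let rho := h * (Lp * C * h + K * Num.sqrt h).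

Lemma rho_ge0 : 0 <= rho.
Proof.
rewrite /rho mulr_ge0 // addr_ge0 //; last by rewrite mulr_ge0 // sqrtr_ge0.
by rewrite !mulr_ge0 // ltW.
Qed.

(** A discrete Gronwall argument. *)
Lemma euler_error k : E (fun w => `|X (k%:R * h) w - Xh k w|) <= k%:R * rho * (1 + Lp * h) ^+ k.
Proof.
have [_ X0 _] := HX; have r0 := rho_ge0.
have l1 : 1 <= 1 + Lp * h by rewrite lerDl mulr_ge0 // ltW.
elim: k => [|k IH].
  rewrite !mul0r (_ : (fun w => _) = fun=> 0) ?expect_cst //.
  by apply/funext => w; rewrite X0 /Xh /eulerW /= subrr normr0.
have t0 : 0 <= k%:R * h by rewrite mulr_ge0.
have dk := dom_euler_error k; have dd := dom_defect t0 h0.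
have Lh : 0 <= 1 + Lp * h by apply: le_trans l1.
apply: (@le_trans _ _ (E (fun w => (1 + Lp * h) * `|X (k%:R * h) w - Xh k w| +
    `|dinc (k%:R * h) h w - h *: psi (X (k%:R * h) w)|))).
  apply: expect_mono; [exact: dom_euler_error | by apply: domD => //; exact: domZ | move=> w].
  set D := _ - h *: psi _.
  have tk : k.+1%:R * h = k%:R * h + h by rewrite -natr1 mulrDl mul1r.
  have -> : X (k.+1%:R * h) w - Xh k.+1 w = (X (k%:R * h) w - Xh k w)
      + h *: (psi (X (k%:R * h) w) - psi (Xh k w)) + D.
    rewrite /D /dinc /Xh /eulerW /= /drift tk.
    by apply/matrixP => i j; rewrite !mxE; ring.
  apply: le_trans (ler_normD _ _) _; rewrite lerD2r mulrDl mul1r.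
  apply: le_trans (ler_normD _ _) _; rewrite lerD2l normrZ (ger0_norm h0) mulrAC mulrC.
  by apply: ler_wpM2r => //; exact: psiL.
apply: le_trans (expect_subadd (domZ _ dk) dd) _.
rewrite expect_homog //; apply: le_trans (lerD (ler_wpM2l Lh IH) (defect_bound t0 h0)) _.
rewrite -/rho exprS -[k.+1%:R]natr1.
have e1 : 1 <= (1 + Lp * h) * (1 + Lp * h) ^+ k by rewrite -exprS; exact: exprn_ege1.
have : rho * 1 <= rho * ((1 + Lp * h) * (1 + Lp * h) ^+ k) by apply: ler_wpM2l.
rewrite mulr1 => H; rewrite [leRHS](_ : _ = (1 + Lp * h) * (k%:R * rho * (1 + Lp * h) ^+ k) +
  rho * ((1 + Lp * h) * (1 + Lp * h) ^+ k)); last by ring.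
by rewrite lerD2l.
Qed.

End Scheme.

End EulerError.

(** * Convergence of the noise scheme for a fixed viscosity *)

Section InfConvolution.
Variables (R : realType) (d : nat).
Let V := 'cV[R]_d.+1.
Variables (g : V -> R) (K n : R).
Hypotheses (gK : forall y, `|g y| <= K) (n0 : 0 <= n).

Definition infconv (y : V) : R := inf [set g z + n * `|y - z| | z in [set: V]].

Let lbK y : lbound [set g z + n * `|y - z| | z in [set: V]] (- K).
Proof.
move=> _ [z _ <-]; have := gK z; rewrite ler_norml => /andP[h _].
by apply: le_trans h _; rewrite lerDl mulr_ge0.
Qed.

Lemma infconv_le y z : infconv y <= g z + n * `|y - z|.
Proof. by apply: ge_inf; [exists (- K); exact: lbK | exists z]. Qed.

Lemma infconv_ge y c : (forall z, c <= g z + n * `|y - z|) -> c <= infconv y.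
Proof.
by move=> H; apply: lb_le_inf; [exists (g y + n * `|y - y|); exists y | move=> _ [z _ <-]].
Qed.

Lemma infconv_le_id y : infconv y <= g y.
Proof. by have := infconv_le y y; rewrite subrr normr0 mulr0 addr0. Qed.

Lemma infconv_bound y : `|infconv y| <= K.
Proof.
rewrite ler_norml; apply/andP; split.
  by apply: infconv_ge => z; apply: lbK; exists z.
apply: le_trans (infconv_le_id y) _.
by have := gK y; rewrite ler_norml => /andP[].
Qed.

Lemma infconv_lip : lip n infconv.
Proof.
have H y y' : infconv y <= infconv y' + n * `|y - y'|.
  rewrite -lerBlDr; apply: infconv_ge => z; rewrite lerBlDr.
  apply: le_trans (infconv_le y z) _; rewrite -addrA lerD2l -mulrDr; apply: ler_wpM2l => //.
  by rewrite [leRHS]addrC; exact: ler_distD.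
by move=> y y'; rewrite ler_distl H lerBlDr distrC H.
Qed.

End InfConvolution.

(** Inf-convolution with a slope steep enough that only points within the
    modulus of continuity of g compete. *)
Lemma lipschitz_approx (R : realType) d (g : 'cV[R]_d.+1 -> R) (K r e : R) :
  continuous g -> (forall y, `|g y| <= K) -> 0 < e ->
  exists gt L, [/\ lip L gt, forall y, `|gt y| <= K &
    forall y, `|y| <= r -> `|g y - gt y| <= e].
Proof.
move=> cg gK e0; have [s s0 Hs] := unif_continuous_cube r cg e0.
have K0 : 0 <= K by apply: le_trans (gK 0).
have n0 : 0 <= 2 * K / s by rewrite divr_ge0 ?mulr_ge0 // ltW.
exists (infconv g (2 * K / s)), (2 * K / s); split.
- exact: infconv_lip gK n0.
- exact: infconv_bound.
move=> y yr; rewrite ger0_norm ?subr_ge0; last exact: infconv_le_id gK n0 y.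
rewrite lerBlDl -lerBlDr; apply: infconv_ge => z.
have [zy|zy] := ltP `|y - z| s.
  have := Hs y z yr zy; rewrite ler_distl => /andP[_ h].
  have : 0 <= 2 * K / s * `|y - z| by rewrite mulr_ge0.
  lra.
have h : 2 * K <= 2 * K / s * `|y - z|.
  by rewrite mulrAC ler_pdivlMr //; apply: ler_wpM2l => //; rewrite mulr_ge0.
have := gK y; have := gK z; rewrite !ler_norml => /andP[h1 _] /andP[_ h2]; lra.
Qed.

Section SmallParameters.
Variable R : realType.

Lemma small_factor (Q tol : R) : 0 <= Q -> 0 < tol -> exists2 e, 0 < e & e * Q <= tol.
Proof.
move=> Q0 t0; have Q1 : 0 < Q + 1 by lra.
exists (tol / (Q + 1)); first by rewrite divr_gt0.
by rewrite mulrAC ler_pdivrMr //; apply: ler_wpM2l; [exact: ltW | lra].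
Qed.

Lemma small_step (t e : R) : 0 < t -> 0 < e ->
  exists N0, forall m, (N0 <= m)%N -> (0 < m)%N /\ t / m%:R <= e.
Proof.
move=> t0 e0; exists (Num.trunc (t / e)).+1 => m Nm.
have m0 : (0 < m)%N by apply: leq_trans Nm.
split=> //; rewrite ler_pdivrMr ?ltr0n // mulrC -ler_pdivrMr //.
have /andP[_ h] := @trunc_itv R (t / e) (divr_ge0 (ltW t0) (ltW e0)).
by apply: le_trans (ltW h) _; rewrite ler_nat.
Qed.

Lemma expn_step_le (t L : R) m : 0 <= L -> 0 <= t -> (0 < m)%N ->
  (1 + L * (t / m%:R)) ^+ m <= expR (L * t).
Proof.
move=> L0 t0 m0; apply: (@le_trans _ _ (expR (L * (t / m%:R)) ^+ m)).
  apply: lerXn2r; rewrite ?nnegrE ?expR_ge0 //; last exact: expR_ge1Dx.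
  by rewrite addr_ge0 // mulr_ge0 // divr_ge0.
by rewrite -expRM_natl mulrCA (mulrC m%:R) divfK // pnatr_eq0 -lt0n.
Qed.

End SmallParameters.

Section FixedViscosity.
Variables (R : realType) (d : nat).
Let V := 'cV[R]_d.+1.
Variables (Omega : Type) (E : sublinear_expectation R Omega) (xi : Omega -> V) (B : R).
Hypothesis xiB : forall w, `|xi w| <= B.
Hypothesis xi_dom : forall f, Cb R V f -> dom E (fun w => f (xi w)).
Hypothesis xi_centered : forall a : V,
  dom E (fun w => (a^T *m xi w) 0 0) /\ E (fun w => (a^T *m xi w) 0 0) = 0.
Variables (Omega' : Type) (E' : sublinear_expectation R Omega') (W : R -> Omega' -> V).
Hypothesis BW : G_brownian_motion E' W.
Hypothesis cov : forall a : 'M[R]_d.+1, a^T = a ->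
  dom E (fun w => quadr a (xi w)) /\ E' (fun w => quadr a (W 1 w)) = E (fun w => quadr a (xi w)).
Variables (psi : V -> V) (C Lp del : R) (x0 : V) (X : R -> Omega' -> V).
Hypothesis psiC : forall y, `|psi y| <= C.
Hypothesis psiL : lip Lp psi.
Hypothesis Lp0 : 0 < Lp.
Hypothesis del0 : 0 < del.
Hypothesis HX : sde_solution E' psi W del x0 X.
Variable t : R.
Hypothesis t0 : 0 < t.

Let C0 : 0 <= C. Proof. exact: le_trans (psiC 0). Qed.

Definition noise_step (h : R) := step E (fun w => (del * Num.sqrt h) *: xi w) (drift psi h).
Definition bm_step (h : R) := step E' (fun w => del *: W h w) (drift psi h).

Lemma drift_near_id h x y : 0 <= h ->
  `|drift psi h x - drift psi h y - (x - y)| <= Lp * h * `|x - y|.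
Proof.
move=> h0; have -> : drift psi h x - drift psi h y - (x - y) = h *: (psi x - psi y).
  by rewrite /drift; apply/matrixP => i j; rewrite !mxE; ring.
rewrite normrZ (ger0_norm h0).
by rewrite mulrAC mulrC; apply: ler_wpM2r.
Qed.

Let c0 := (`|B| ^+ 3 + bm_const E' W) * del ^+ 3.

Let c0_ge0 : 0 <= c0.
Proof.
rewrite /c0 mulr_ge0 ?exprn_ge0 ?(ltW del0) // addr_ge0 ?exprn_ge0 //.
exact: ltW (bm_const_gt0 BW).
Qed.

Lemma noise_bm_consistent h : 0 < h ->
  consistent E (fun w => (del * Num.sqrt h) *: xi w) E' (fun w => del *: W h w)
    (c0 * (h * Num.sqrt h)).
Proof.
move=> h0 f c p A M Cf M0 T.
have T' := taylor2_scale del T; set A' := del ^+ 2 *: A in T'.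
have Cf' : Cb R V (fun y => f (del *: y)) := Cb_comp Cf (@scale_continuous _ _ del).
have M0' : 0 < M * `|del| ^+ 3 by rewrite mulr_gt0 // exprn_gt0 // normr_gt0 gt_eqF.
have h1 := noise_consistent xiB xi_dom xi_centered (fun a sa => (cov sa).1) Cf' M0' h0 T'.
have h2 := W_consistent BW Cf' M0' h0 T'.
have [sA' _] := T'.
have GE : Gfun E xi A' = Gfun E' (W 1) A' by rewrite /Gfun (cov sA').2.
rewrite GE in h1.
have -> : E (fun w => f ((del * Num.sqrt h) *: xi w)) = E (fun w => f (del *: (Num.sqrt h *: xi w))).
  by apply: eq_expect => w; rewrite scalerA.
rewrite -(subrKA (c + h * Gfun E' (W 1) A')).
apply: le_trans (ler_normD _ _) _; rewrite [X in _ + X <= _]distrC.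
apply: le_trans (lerD h1 h2) _; rewrite (gtr0_norm del0) /c0.
by rewrite le_eqVlt; apply/orP; left; apply/eqP; ring.
Qed.

Lemma noise_feller s : feller E (fun w => s *: xi w).
Proof. exact: feller_bounded xiB xi_dom s. Qed.

(** The error is at most eps * Q1 + sqrt h * Q2, where Q2 depends on eps:
    first the smoothing parameter is fixed, then the step. *)
Lemma iterates_converge (u : V -> R) L K tol : lip L u -> (forall y, `|u y| <= K) -> 0 < tol ->
  exists N0, forall m, (N0 <= m)%N ->
    `|iter m (noise_step (t / m%:R)) u x0 - iter m (bm_step (t / m%:R)) u x0| <= tol.
Proof.
move=> Lu Ku tol0; have L0 := lipV_ge0 Lu.
pose Lam := L * expR (Lp * t).
have Lam0 : 0 <= Lam by rewrite mulr_ge0 // expR_ge0.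
pose Q1 := d.+1%:R * Lam * (4 + 2 * (Lp * t)).
have Lpt : 0 <= Lp * t by rewrite mulr_ge0 // ltW.
have Q10 : 0 <= Q1 by rewrite !mulr_ge0 // addr_ge0 // mulr_ge0.
have tol2 : 0 < tol / 2 by lra.
have [eps eps0 H1] := small_factor Q10 tol2.
pose Q2 := t * c0 * (taylor_const d eps Lam + 1).
have M30 : 0 <= taylor_const d eps Lam + 1 by rewrite addr_ge0 // taylor_const_ge0.
have tc : 0 <= t * c0 by apply: mulr_ge0 => //; exact: ltW.
have Q20 : 0 <= Q2 by exact: mulr_ge0.
have [q q0 H2] := small_factor Q20 tol2.
have q20 : 0 < q ^+ 2 by rewrite exprn_gt0.
have [N0 HN] := small_step t0 q20.
exists N0 => m /HN [m0 tm].
set h := t / m%:R in tm *.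
have h0 : 0 < h by rewrite divr_gt0 // ltr0n.
have mh : m%:R * h = t by rewrite mulrC divfK // pnatr_eq0 -lt0n.
have h0' := ltW h0.
have l1 : 1 <= 1 + Lp * h by rewrite lerDl mulr_ge0 // ltW.
have k0 : 0 <= Lp * h by rewrite mulr_ge0 // ltW.
apply: le_trans (iterates_dist m x0 (noise_feller _) (feller_W BW del0 h0')
  (noise_bm_consistent h0) (fun x y => drift_near_id x y h0') (drift_lip psiL h0') k0 l1 eps0 Lu Ku) _.
set Lm := L * _ ^+ m.
have LmL : Lm <= Lam by apply: ler_wpM2l => //; exact: expn_step_le (ltW Lp0) (ltW t0) m0.
have Lm0 : 0 <= Lm by rewrite mulr_ge0 // exprn_ge0 // (le_trans ler01).
have sq : Num.sqrt h <= q.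
  by rewrite -(ger0_norm (ltW q0)) -sqrtr_sqr; apply: ler_wsqrtr.
have -> : 4 * d.+1%:R * (Lm * eps) + m%:R * (2 * d.+1%:R * (Lm * (Lp * h) * eps) +
    c0 * (h * Num.sqrt h) * (taylor_const d eps Lm + 1)) =
  eps * (d.+1%:R * Lm * (4 + 2 * (Lp * (m%:R * h)))) + Num.sqrt h * ((m%:R * h) * c0 * (taylor_const d eps Lm + 1)).
  by ring.
rewrite mh [tol](_ : _ = tol / 2 + tol / 2); last by field.
apply: lerD.
  apply: le_trans H1; apply: ler_wpM2l; first exact: ltW.
  by apply: ler_wpM2r; [rewrite addr_ge0 // mulr_ge0 | apply: ler_wpM2l].
apply: le_trans H2; apply: ler_pM; rewrite ?sqrtr_ge0 //.
  by apply: mulr_ge0 => //; rewrite addr_ge0 // taylor_const_ge0.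
apply: ler_wpM2l => //.
rewrite lerD2r /taylor_const /tangent_const; apply: ler_wpM2l => //; apply: ler_wpM2l => //.
have ie : 0 <= eps^-1 by rewrite invr_ge0 ltW.
apply: ler_wpM2r => //; apply: ler_wpM2l => //.
by apply: ler_wpM2r => //; apply: ler_wpM2l.
Qed.

Let K := Lp * del * bm_const E' W * 2.

Lemma euler_converge (u : V -> R) L M tol : lip L u -> (forall y, `|u y| <= M) -> 0 < tol ->
  exists N0, forall m, (N0 <= m)%N ->
    `|iter m (bm_step (t / m%:R)) u x0 - E' (fun w => u (X t w))| <= tol.
Proof.
move=> Lu Ku tol0; have L0 := lipV_ge0 Lu; have Cu := lip_Cb Lu Ku.
have K0 : 0 <= K by rewrite /K !mulr_ge0 // ?ltW //; exact: bm_const_gt0 BW.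
have ex0 : 0 <= expR (Lp * t) by exact: expR_ge0.
pose Q := L * t * (Lp * C + K) * expR (Lp * t).
have Q0 : 0 <= Q by rewrite !mulr_ge0 // ?(ltW t0) // addr_ge0 // mulr_ge0 // ltW.
have [q q0 H] := small_factor Q0 tol0.
pose q' := Num.min (q ^+ 2) q.
have q'0 : 0 < q' by rewrite lt_min q0 exprn_gt0.
have [N0 HN] := small_step t0 q'0.
exists N0 => m /HN [m0]; rewrite le_min => /andP[tm1 tm2].
set h := t / m%:R in tm1 tm2 *.
have h0 : 0 < h by rewrite divr_gt0 // ltr0n.
have mh : m%:R * h = t by rewrite mulrC divfK // pnatr_eq0 -lt0n.
have h0' := ltW h0.
have [d1 <-] := euler_markov x0 BW del0 h0' m psiL Cu.
have d2 := dom_X HX Cu (ltW t0).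
have dD := dom_euler_error psiL HX h0' m.
have err := euler_error BW psiC psiL Lp0 del0 HX h0' m.
rewrite mh in dD err.
have H3 : `|E' (fun w => u (eulerW psi del x0 h W m w)) - E' (fun w => u (X t w))|
    <= L * E' (fun w => `|X t w - eulerW psi del x0 h W m w|).
  rewrite -(expect_homog dD L0) ler_distl; apply/andP; split.
    rewrite lerBlDr; apply: le_trans (expect_subadd d1 (domZ L dD)).
    apply: expect_mono => //; first by apply: domD => //; exact: domZ.
    move=> w; rewrite -lerBlDl; apply: le_trans (ler_norm _) (Lu _ _).
  apply: le_trans (expect_subadd d2 (domZ L dD)).
  apply: expect_mono => //; first by apply: domD => //; exact: domZ.
  move=> w; rewrite -lerBlDl distrC; apply: le_trans (ler_norm _) (Lu _ _).
apply: (le_trans H3); apply: le_trans H.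
have sq : Num.sqrt h <= q.
  by rewrite -(ger0_norm (ltW q0)) -sqrtr_sqr; apply: ler_wsqrtr.
apply: le_trans (ler_wpM2l L0 err) _.
have -> : q * Q = L * (t * (Lp * C * q + K * q) * expR (Lp * t)) by rewrite /Q; ring.
apply: ler_wpM2l => //.
rewrite [m%:R * _]mulrA mh; apply: ler_pM.
- apply: mulr_ge0; first exact: ltW.
  by apply: addr_ge0; [apply: mulr_ge0 => //; rewrite mulr_ge0 // ltW | rewrite mulr_ge0 // sqrtr_ge0].
- by apply: exprn_ge0; apply: addr_ge0 => //; rewrite mulr_ge0 // ltW.
- apply: ler_wpM2l; first exact: ltW.
  by apply: lerD; apply: ler_wpM2l => //; rewrite mulr_ge0 // ltW.
- exact: expn_step_le (ltW Lp0) (ltW t0) m0.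
Qed.

Lemma lip_converge (u : V -> R) L M tol : lip L u -> (forall y, `|u y| <= M) -> 0 < tol ->
  exists N0, forall m, (N0 <= m)%N ->
    `|iter m (noise_step (t / m%:R)) u x0 - E' (fun w => u (X t w))| <= tol.
Proof.
move=> Lu Ku tol0; have tol2 : 0 < tol / 2 by lra.
have [N1 H1] := iterates_converge Lu Ku tol2.
have [N2 H2] := euler_converge Lu Ku tol2.
exists (maxn N1 N2) => m; rewrite geq_max => /andP[/H1 h1 /H2 h2].
rewrite -(subrKA (iter m (bm_step (t / m%:R)) u x0)).
by apply: le_trans (ler_normD _ _) _; lra.
Qed.

Let tail_const := t * C + del * bm_const E' W * 2 * Num.sqrt t.

(** Tightness of X_t: the drift contributes at most t * C, and the truncated
    noise has small expectation. *)
Lemma tail_bound (N : R) : 0 < N ->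
  E' (fun w => Num.min 1 (N^-1 * `|X t w - x0|)) <= N^-1 * tail_const.
Proof.
move=> N0; have iN : 0 < N^-1 by rewrite invr_gt0.
have Cf := trunc_Cb x0 ler01 (ltW iN).
have dN : 0 < N^-1 * del by rewrite mulr_gt0.
have Cg : Cb R V (fun y => Num.min 1 (N^-1 * del * `|y|)).
  by have := trunc_Cb (0 : V) ler01 (ltW dN); under eq_fun do rewrite subr0.
have d1 := dom_X HX Cf (ltW t0).
have d2 := dom_increment BW Cg (lexx 0) (ltW t0).
have d3 := dom_dinc HX (lexx 0) (ltW t0).
have [_ X0 _] := HX.
apply: (@le_trans _ _ (E' (fun w => N^-1 * `|dinc W del X 0 t w| +
    Num.min 1 (N^-1 * del * `|W (0 + t) w - W 0 w|)))).
  apply: expect_mono => //; first by apply: domD => //; exact: domZ.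
  move=> w; have XE : X t w - x0 = dinc W del X 0 t w + del *: (W (0 + t) w - W 0 w).
    by rewrite /dinc subrK add0r X0.
  have h1 : N^-1 * `|X t w - x0| <= N^-1 * `|dinc W del X 0 t w| +
      N^-1 * del * `|W (0 + t) w - W 0 w|.
    rewrite XE -mulrA -mulrDr; apply: ler_wpM2l; first exact: ltW.
    by apply: le_trans (ler_normD _ _) _; rewrite normrZ (gtr0_norm del0).
  have h2 : 0 <= N^-1 * `|dinc W del X 0 t w| by rewrite mulr_ge0 // ltW.
  rewrite -lerBlDl le_min; apply/andP; split; last by rewrite lerBlDl ge_min h1 orbT.
  have : Num.min 1 (N^-1 * `|X t w - x0|) <= 1 by rewrite ge_min lexx.
  lra.
apply: le_trans (expect_subadd (domZ _ d3) d2) _.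
rewrite (expect_homog d3 (ltW iN)) /tail_const mulrDr; apply: lerD.
  apply: ler_wpM2l; first exact: ltW.
  rewrite [leRHS]mulrC. exact: (dinc_bound psiC HX (lexx 0) (ltW t0)).
have := increment_moment BW ler01 dN (lexx 0) t0.
by rewrite -!mulrA.
Qed.

(** A bounded continuous function agrees with a Lipschitz one up to a small
    constant and a multiple of the cutoff chi. The cutoff is itself Lipschitz,
    so its expectation under the scheme is governed by the limit, where it is
    small by tightness. *)
Lemma Cb_converge (g : V -> R) tol : Cb R V g -> 0 < tol ->
  exists N0, forall m, (N0 <= m)%N ->
    `|iter m (noise_step (t / m%:R)) g x0 - E' (fun w => g (X t w))| <= tol.
Proof.
move=> Cg tol0; have [cg [M gM]] := (CbP g).1 Cg.
have M0 : 0 <= M by apply: le_trans (gM 0).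
have tc0 : 0 <= tail_const.
  rewrite addr_ge0 // !mulr_ge0 // ?sqrtr_ge0 // ?ltW //; exact: bm_const_gt0 BW.
have tol8 : 0 < tol / 8 by lra.
have [a a0 Ha] := small_factor (mulr_ge0 (mulr_ge0 (ler0n R 4) M0) tc0) tol8.
have M40 : 0 <= 2 * M by rewrite mulr_ge0.
have [b b0 Hb] := small_factor M40 tol8.
pose N := a^-1; have N0 : 0 < N by rewrite invr_gt0.
have iN : 0 < N^-1 by rewrite invr_gt0.
have [gt [L [Lgt Kgt Hgt]]] := lipschitz_approx (`|x0| + N) cg gM tol8.
have Cgt := lip_Cb Lgt Kgt.
pose chi (y : V) := Num.min 1 (N^-1 * `|y - x0|).
have Lchi : lip N^-1 chi by exact: trunc_lip (ltW iN).
have Cchi : Cb R V chi by exact: trunc_Cb ler01 (ltW iN).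
have chi0 y : 0 <= chi y by apply: trunc_ge0 => //; exact: ltW.
have Kchi y : `|chi y| <= 1 by rewrite ger0_norm // /chi ge_min lexx.
have ggt y : `|g y - gt y| <= 2 * M * chi y + tol / 8.
  have [yN|yN] := leP `|y - x0| N.
    have : `|g y - gt y| <= tol / 8.
      apply: Hgt; rewrite -[y](subrK x0) addrC; apply: le_trans (ler_normD _ _) _.
      by rewrite lerD2l.
    have : 0 <= 2 * M * chi y by rewrite mulr_ge0.
    lra.
  have -> : chi y = 1.
    by apply/min_idPl; rewrite mulrC ler_pdivlMr // mul1r ltW.
  apply: le_trans (ler_normB _ _) _; have := gM y; have := Kgt y; lra.
have [N1 H1] := lip_converge Lchi Kchi b0.
have [N2 H2] := lip_converge Lgt Kgt tol8.
exists (maxn N1 N2) => m; rewrite geq_max => /andP[/H1 h1 /H2 h2].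
set h := t / m%:R in h1 h2 *.
have h0 : 0 <= h by rewrite divr_ge0 // ltW.
have cd := lip_continuous (drift_lip psiL h0).
have FZ := @noise_feller (del * Num.sqrt h).
pose S u := iter m (noise_step h) u x0; rewrite -/(S g) -/(S chi) -/(S gt) in h1 h2 *.
pose EX u := E' (fun w => u (X t w)); rewrite -/(EX g) -/(EX chi) -/(EX gt) in h1 h2 *.
have tail : EX chi <= a * tail_const by have := tail_bound N0; rewrite [X in _ <= X * _]invrK.
have Schi : S chi <= a * tail_const + b by move: h1; rewrite ler_distl => /andP[_]; lra.
have SD u v : Cb R V u -> Cb R V v -> (forall y, `|u y - v y| <= 2 * M * chi y + tol / 8) ->
    S u <= S v + 2 * M * S chi + tol / 8.
  move=> Cu Cv uv.
  have Cw : Cb R V (fun y => v y + 2 * M * chi y) := Cb_add Cv (Cb_scale (2 * M) Cchi).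
  apply: le_trans (iter_step_leDc FZ m cd Cu Cw (c := tol / 8) _ _) _.
    by move=> y; have := uv y; rewrite ler_distl => /andP[_]; lra.
  by rewrite lerD2r; apply: (iter_step_sublin FZ m cd Cw Cv M40 Cchi) => y.
have ED u v : Cb R V u -> Cb R V v -> (forall y, `|u y - v y| <= 2 * M * chi y + tol / 8) ->
    EX u <= EX v + 2 * M * EX chi + tol / 8.
  move=> Cu Cv uv.
  have du := dom_X HX Cu (ltW t0); have dv := dom_X HX Cv (ltW t0).
  have dc := dom_X HX Cchi (ltW t0).
  have dw := domD dv (domZ (2 * M) dc).
  apply: le_trans (expect_leDc (c := tol / 8) du dw _) _.
    by move=> w; have := uv (X t w); rewrite ler_distl => /andP[_]; lra.
  rewrite lerD2r -(expect_homog dc M40); apply: expect_subadd => //; exact: domZ.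
have ggt' y : `|gt y - g y| <= 2 * M * chi y + tol / 8 by rewrite distrC.
have s1 := SD g gt Cg Cgt ggt; have s2 := SD gt g Cgt Cg ggt'.
have e1 := ED g gt Cg Cgt ggt; have e2 := ED gt g Cgt Cg ggt'.
have MS : 2 * M * S chi <= tol / 16 + tol / 8.
  apply: le_trans (ler_wpM2l M40 Schi) _; rewrite mulrDr [2 * M * b]mulrC.
  by apply: lerD => //; move: Ha; rewrite [4 * M](_ : _ = 2 * (2 * M)); [lra | ring].
have ME : 2 * M * EX chi <= tol / 16.
  apply: le_trans (ler_wpM2l M40 tail) _.
  by move: Ha; rewrite [4 * M](_ : _ = 2 * (2 * M)); [lra | ring].
by move: h2; rewrite !ler_distl => /andP[? ?]; apply/andP; split; lra.
Qed.

End FixedViscosity.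

(** * Logarithmic transform and the vanishing viscosity limit *)

Lemma ln_dist (R : realType) (c a b e : R) : 0 < c -> c <= a -> c <= b -> 0 <= e ->
  `|a - b| <= c * e -> `|ln a - ln b| <= e.
Proof.
move=> c0 ca cb e0 ab.
have H (u v : R) : c <= u -> c <= v -> `|u - v| <= c * e -> ln u - ln v <= e.
  move=> cu cv uv; have u0 : 0 < u by exact: lt_le_trans cu.
  have v0 : 0 < v by exact: lt_le_trans cv.
  rewrite -ln_div ?posrE //.
  have uv0 : 0 < u / v by rewrite divr_gt0.
  have uvE : u / v = 1 + (u - v) / v by field; rewrite gt_eqF.
  rewrite uvE in uv0 *; apply: le_trans (le_ln1Dx _) _; first by lra.
  rewrite ler_pdivrMr //; apply: le_trans (ler_norm _) _; apply: le_trans uv _.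
  by rewrite mulrC; apply: ler_wpM2l.
by rewrite ler_norml lerNl opprB !H // distrC.
Qed.

Section LogarithmicTransform.
Variables (R : realType) (d : nat).
Let V := 'cV[R]_d.+1.
Variables (Omega : Type) (E : sublinear_expectation R Omega) (xi : Omega -> V).
Variables (psi : V -> V) (h eta alpha : R) (f : V -> R) (K : R).
Hypothesis FZ : feller E (fun w => (eta * Num.sqrt h) *: xi w).
Hypothesis cpsi : continuous (drift psi h).
Hypothesis Cf : Cb R V f.
Hypothesis fK : forall y, `|f y| <= K.
Hypothesis alpha0 : 0 < alpha.

Let S := step E (fun w => (eta * Num.sqrt h) *: xi w) (drift psi h).
Let G (y : V) := expR (alpha * f y).

Lemma exp_Cb : Cb R V G.
Proof.
have [cf _] := (CbP f).1 Cf; apply/CbP; split.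
  move=> y; apply: (@continuous_comp _ _ _ (fun y => alpha * f y) expR); last exact: continuous_expR.
  exact: (cont_mul (@cont_cst _ _ alpha) cf).
exists (expR (alpha * K)) => y; rewrite ger0_norm ?expR_ge0 // ler_expR.
by apply: ler_wpM2l; [exact: ltW | have := fK y; rewrite ler_norml => /andP[]].
Qed.

Lemma exp_ge y : expR (- (alpha * K)) <= G y.
Proof.
rewrite ler_expR -mulrN; apply: ler_wpM2l; first exact: ltW.
by have := fK y; rewrite ler_norml => /andP[].
Qed.

Lemma iter_exp_ge m y : expR (- (alpha * K)) <= iter m S G y.
Proof.
elim: m y => [|m IH] y /=; first exact: exp_ge.
apply: expect_ge_cst => [|w]; last exact: IH.
by apply: (shift_dom FZ); exact: (iter_step_Cb FZ _ cpsi exp_Cb).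
Qed.

(** The logarithm of one step undoes the exponential of the next. *)
Lemma iter_J m y : iter m (J E psi xi h eta alpha) f y = alpha^-1 * ln (iter m S G y).
Proof.
elim: m y => [|m IH] y /=.
  by rewrite /G expRK mulrA mulVf ?mul1r // gt_eqF.
rewrite {1}/J; congr (_ * ln _); rewrite /S /step /shiftE; apply: eq_expect => w.
rewrite IH mulrA mulfV ?mul1r ?gt_eqF // lnK //.
by rewrite posrE (lt_le_trans _ (iter_exp_ge m _)) // expR_gt0.
Qed.

End LogarithmicTransform.

Theorem corollary3p10 (R : realType) (d : nat)
    (* the i.i.d. sequence *)
    (Omega : Type) (E : sublinear_expectation R Omega)
    (xi : nat -> Omega -> 'cV[R]_d.+1)
    (* the G-Brownian motion *)
    (Omega' : Type) (E' : sublinear_expectation R Omega')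
    (W : R -> Omega' -> 'cV[R]_d.+1)
    (psi : 'cV[R]_d.+1 -> 'cV[R]_d.+1)
    (* X delta x t *)
    (X : R -> 'cV[R]_d.+1 -> R -> Omega' -> 'cV[R]_d.+1)
    (T : R -> ('cV[R]_d.+1 -> R) -> ('cV[R]_d.+1 -> R))
    (psi_bounded : bounded_fun psi)
    (psi_lipschitz : lipschitz psi)
    (xi_iid : iid E xi)
    (xi_third_moment : dom E (fun w => enorm (xi 0%N w) ^+ 3))
    (xi_centered : forall a : 'cV[R]_d.+1,
       dom E (fun w => (a^T *m xi 0%N w) 0 0) /\
       E (fun w => (a^T *m xi 0%N w) 0 0) = 0)
    (W_brownian : G_brownian_motion E' W)
    (W_covariance : forall a : 'M[R]_d.+1, a^T = a ->
       dom E (fun w => quadr a (xi 0%N w)) /\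
       E' (fun w => quadr a (W 1 w)) = E (fun w => quadr a (xi 0%N w)))
    (X_solution : forall delta x, 0 < delta ->
       sde_solution E' psi W delta x (X delta x))
    (T_limit : is_T10 E psi (xi 0%N) T)
    (xi_bounded : bounded_fun (xi 0%N))
    (delta : nat -> R)
    (delta_pos : forall n, 0 < delta n)
    (delta_cvg : delta @ \oo --> (0 : R)) :
  forall (t : R) (x : 'cV[R]_d.+1) (f : 'cV[R]_d.+1 -> R),
    0 <= t -> Cb R 'cV[R]_d.+1 f ->
    (fun n => delta n ^+ 2 *
       ln (E' (fun w => expR ((delta n ^+ 2)^-1 * f (X (delta n) x t w)))))
      @ \oo --> T t f x.
Proof.
move=> t x f t_ge0 Cf.
have [C psiC] := (boundedP psi).1 psi_bounded.
have [B xiB] := (boundedP (xi 0%N)).1 xi_bounded.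
have [Lp Lp0 psiL] : exists2 Lp, 0 < Lp & lip Lp psi.
  have [M [_ HM]] := psi_lipschitz.
  exists (`|M| + 1); first by rewrite ltr_wpDl.
  move=> y z; have := HM (`|M| + 1) _ (y, z) => /=; apply; last by split.
  by apply: le_lt_trans (ler_norm _) _; rewrite ltrDl.
have xi_dom g : Cb R 'cV[R]_d.+1 g -> dom E (fun w => g (xi 0%N w)).
  by move=> Cg; have [iid1 _] := xi_iid; have [] := iid1 0%N g Cg.
have [cf [K fK]] := (CbP f).1 Cf.
have [_ Tlim] := T_limit t f t_ge0 Cf.
have d2 n : 0 < delta n ^+ 2 by rewrite exprn_gt0.
have a0 n : 0 < (delta n ^+ 2)^-1 by rewrite invr_gt0.
have alpha_eta : (fun k => (delta k ^+ 2)^-1 * delta k ^+ 2) @ \oo --> (1 : R).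
  rewrite (_ : (fun k => _) = fun=> 1); first exact: cvg_cst.
  by apply/funext => k; rewrite mulVf // gt_eqF.
have point (F : nat -> 'cV[R]_d.+1 -> R) (g : 'cV[R]_d.+1 -> R) : bounded_loc_unif_cvg F g -> (fun n => F n x) @ \oo --> g x.
  have cx : compact [set x] by exact: compact_set1.
  move=> [_ H]; have := H [set x] cx.
  by rewrite uniform_set1.
move: t_ge0; rewrite le_eqVlt => /orP[/eqP t00|t0].
  (* for t = 0 both sides equal f x, as seen from the scheme without steps *)
  have -> : (fun n => delta n ^+ 2 *
       ln (E' (fun w => expR ((delta n ^+ 2)^-1 * f (X (delta n) x t w))))) = fun=> f x.
    apply/funext => n; have [_ X0 _] := X_solution (delta n) x (delta_pos n).
    rewrite (_ : (fun w => _) = fun=> expR ((delta n ^+ 2)^-1 * f x)).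
      by rewrite expect_cst expRK mulrA mulfV ?mul1r // gt_eqF.
    by apply/funext => w; rewrite -t00 X0.
  apply: (point (fun=> f)).
  apply: (Tlim (fun k => delta k ^+ 4) delta (fun k => (delta k ^+ 2)^-1) (fun=> 0%N)) => //.
  - by move=> k; split=> //; rewrite exprn_gt0.
  - rewrite (_ : (fun k => _) = fun k => delta k * delta k * (delta k * delta k)).
      have := cvgM (cvgM delta_cvg delta_cvg) (cvgM delta_cvg delta_cvg).
      by rewrite !mul0r; apply.
    by apply/funext => k; ring.
  - rewrite (_ : (fun k => _) = (fun k => delta k * delta k)).
      by have := cvgM delta_cvg delta_cvg; rewrite mul0r; apply.
    by apply/funext => k; field; rewrite gt_eqF.
  - by rewrite -t00; under eq_fun do rewrite mul0r; exact: cvg_cst.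
pose G n y := expR ((delta n ^+ 2)^-1 * f y).
have CG n : Cb R 'cV[R]_d.+1 (G n) := exp_Cb Cf fK (a0 n).
have Hm n : exists m : nat, [/\ (0 < m)%N, (delta n ^+ 2)^-1 * (t / m%:R) <= n.+1%:R^-1,
    t / m%:R <= n.+1%:R^-1 &
    `|iter m (J E psi (xi 0%N) (t / m%:R) (delta n) (delta n ^+ 2)^-1) f x -
      delta n ^+ 2 * ln (E' (fun w => G n (X (delta n) x t w)))| <= 1 / n.+1%:R].
  pose c := expR (- ((delta n ^+ 2)^-1 * K)); have c0 : 0 < c by exact: expR_gt0.
  have i0 : 0 < n.+1%:R^-1 :> R by rewrite invr_gt0 ltr0n.
  pose e := (delta n ^+ 2)^-1 * n.+1%:R^-1; have e0 : 0 < e by rewrite mulr_gt0.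
  (* The tolerance c * e, with c a lower bound of both arguments of the
     logarithm, becomes e after taking logarithms and 1 / n.+1 after
     multiplication by delta^2. *)
  have [N1 H1] := Cb_converge xiB xi_dom xi_centered W_brownian W_covariance psiC psiL Lp0
    (delta_pos n) (X_solution (delta n) x (delta_pos n)) t0 (CG n) (mulr_gt0 c0 e0).
  have [N2 H2] := small_step t0 i0.
  have di : 0 < delta n ^+ 2 * n.+1%:R^-1 by rewrite mulr_gt0.
  have [N3 H3] := small_step t0 di.
  pose m := maxn N1 (maxn N2 N3); exists m.
  have [m0 m2] : (0 < m)%N /\ t / m%:R <= n.+1%:R^-1.
    by apply: H2; rewrite /m !leq_max leqnn orbT.
  have [_ m3] : (0 < m)%N /\ t / m%:R <= delta n ^+ 2 * n.+1%:R^-1.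
    by apply: H3; rewrite /m !leq_max leqnn !orbT.
  have {}H1 := H1 m (leq_maxl _ _).
  split=> //; first by rewrite [leLHS]mulrC ler_pdivrMr // [leRHS]mulrC.
  have h0 : 0 <= t / m%:R by rewrite divr_ge0 // ltW.
  have cd := lip_continuous (drift_lip psiL h0).
  have FZ := noise_feller xiB xi_dom (delta n * Num.sqrt (t / m%:R)).
  rewrite (iter_J FZ cd Cf fK (a0 n)) invrK -mulrBr normrM (gtr0_norm (d2 n)).
  have -> : 1 / n.+1%:R = delta n ^+ 2 * e by rewrite /e mulrA mulfV ?gt_eqF.
  apply: ler_wpM2l; first exact: ltW.
  apply: (ln_dist c0) (ltW e0) H1; first exact: (iter_exp_ge FZ cd Cf fK (a0 n)).
  apply: expect_ge_cst => [|w]; last exact: exp_ge fK (a0 n) _.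
  have dX := dom_X (X_solution (delta n) x (delta_pos n)) (CG n) (ltW t0). exact: dX.
have [m /= Hm'] := choice Hm.
pose h n := t / (m n)%:R.
have mpos n : (0 < m n)%N by have [] := Hm' n.
have hpos n : 0 < h n by rewrite divr_gt0 // ltr0n.
have squeeze (u : nat -> R) : (forall n, 0 <= u n <= n.+1%:R^-1) -> u @ \oo --> (0 : R).
  move=> Hu; apply: (@cvg_of_harmonic _ u 0 1) => n.
  by have /andP[u0 un] := Hu n; rewrite subr0 ger0_norm // div1r.
have lim1 : (fun n => iter (m n) (J E psi (xi 0%N) (h n) (delta n) (delta n ^+ 2)^-1) f x)
    @ \oo --> T t f x.
  apply: (point (fun n => iter (m n) (J E psi (xi 0%N) (h n) (delta n) (delta n ^+ 2)^-1) f)).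
  apply: Tlim => //.
  - by apply: squeeze => n; have [_ _ h1 _] := Hm' n; rewrite (ltW (hpos n)).
  - apply: squeeze => n; have [_ h1 _ _] := Hm' n.
    by rewrite h1 andbT mulr_ge0 // ltW.
  - rewrite (_ : (fun n => _) = fun=> t); first exact: cvg_cst.
    by apply/funext => n; rewrite /h mulrC divfK // pnatr_eq0 -lt0n.
have lim0 : (fun n => delta n ^+ 2 * ln (E' (fun w => G n (X (delta n) x t w))) -
    iter (m n) (J E psi (xi 0%N) (h n) (delta n) (delta n ^+ 2)^-1) f x) @ \oo --> (0 : R).
  apply: (@cvg_of_harmonic _ _ 0 1) => n.
  by have [_ _ _] := Hm' n; rewrite subr0 distrC.
pose steps n := iter (m n) (J E psi (xi 0%N) (h n) (delta n) (delta n ^+ 2)^-1) f x.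
pose value n := delta n ^+ 2 * ln (E' (fun w => G n (X (delta n) x t w))).
have -> : (fun n => delta n ^+ 2 *
       ln (E' (fun w => expR ((delta n ^+ 2)^-1 * f (X (delta n) x t w))))) =
    fun n => (value n - steps n) + steps n by apply/funext => n; rewrite subrK.
by rewrite -[T t f x]add0r; exact: cvgD lim0 lim1.
Qed.
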